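(* Let $G$ be a finitely generated group that splits as a graph of groups. Suppose that, for every vertex group $V\leq G$, all incident edge groups $E\leq V$ are finitely generated, undistorted in $G$, and relatively wide in $V$. Then every connected component of $\partial_M G$ is either a singleton or homeomorphic to a connected component of the Morse boundary $\partial_M V$ of a vertex group $V$.
   Context: Splittings. A finitely generated group $G$ splits as a graph of groups if it acts without inversions and without a global fixed point (non-elliptically) on a simplicial tree $T$; we fix such an action. Vertex groups are the $G$-stabilisers of vertices of $T$, and edge groups are the $G$-stabilisers of edges of $T$. The edge groups incident to the stabiliser $V$ of a vertex $p$ are the stabilisers of edges of $T$ containing $p$. A finitely generated subgroup $H\leq G$ is undistorted if the inclusion is a quasi-isometric embedding with respect to word metrics. (If all incident edge groups are finitely generated and undistorted in $G$, then $V$ is finitely generated and $E$ is undistorted in $V$, so that relative wideness below makes sense.) Relative wideness. Let $H\leq K$ be finitely generated groups, with $H$ undistorted in $K$. $H$ is relatively wide in $K$ if, for every asymptotic cone $K_\omega$ of $K$ (with arbitrary non-principal ultrafilter, basepoints and scaling factors), no two points of the limit $H_\omega\subseteq K_\omega$ (the set of points represented by sequences in $H$) are separated by a cut point of $K_\omega$; i.e. there are no $x,y\in H_\omega$ and $z\in K_\omega\setminus\{x,y\}$ such that $x,y$ lie in distinct connected components of $K_\omega\setminus\{z\}$. Morse boundaries. A $C$-quasi-geodesic is a $(C,C)$-quasi-geodesic, i.e. a map $\gamma$ from an interval with $\frac1C|s-t|-C\leq d(\gamma(s),\gamma(t))\leq C|s-t|+C$. Let $X$ be a proper geodesic metric space.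 A quasi-geodesic $\gamma\subseteq X$ is $N$-Morse, for a function $N\colon[1,+\infty)\to[0,+\infty)$ (a Morse gauge), if every $C$-quasi-geodesic with endpoints on $\gamma$ is contained in the $N(C)$-neighbourhood of $\gamma$. For a basepoint $p\in X$, $\partial_M^N X_p$ is the set of $N$-Morse geodesic rays based at $p$, identifying rays at finite Hausdorff distance, with the compact-open topology. Let $\partial_M X_p=\bigcup_N\partial_M^N X_p$, where a subset $U$ is open (resp. closed) if and only if $U\cap\partial_M^N X_p$ is open (resp. closed) in $\partial_M^N X_p$ for every $N$. Up to canonical homeomorphism this does not depend on $p$; it is denoted $\partial_M X$. For a finitely generated group $G$, $\partial_M G$ is the Morse boundary of a Cayley graph with respect to a finite generating set (well defined up to homeomorphism). *)

(* Defs.v *)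
From HB Require Import structures.
From mathcomp Require Import all_boot all_order all_algebra.
From mathcomp Require Import all_classical all_reals all_analysis.
From mathcomp Require Import ring lra.
Import numFieldNormedType.Exports.

Set Implicit Arguments.
Unset Strict Implicit.
Unset Printing Implicit Defensive.
Set SsrOldRewriteGoalsOrder.

Import Order.TTheory GRing.Theory Num.Theory.

Local Open Scope classical_set_scope.
Local Open Scope ring_scope.
Local Open Scope quotient_scope.

Definition homeomorphic (X Y : topologicalType) : Prop :=
  exists (f : X -> Y) (g : Y -> X),
    [/\ continuous f, continuous g, cancel f g & cancel g f].

Definition qi_embedding (R : realType) (X Y : metricType R) (f : X -> Y) :
    Prop :=
  exists2 C : R, 1 <= C & forall x y : X,
    C^-1 * mdist x y - C <= mdist (f x) (f y) <= C * mdist x y + C.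

(* The metric space obtained from a pseudometric by identifying points at
   distance zero. *)
Record pseudodist (R : realType) (T : Type) := PseudoDist {
  pdist :> T -> T -> R;
  pdistxx : forall x, pdist x x = 0;
  pdistC : forall x y, pdist x y = pdist y x;
  pdist_triangle : forall y x z, pdist x z <= pdist x y + pdist y z }.

Section MetricQuotient.
Context {R : realType} {T : choiceType} (d : pseudodist R T).

Lemma pdist_ge0 x y : 0 <= d x y.
Proof.
by have := pdist_triangle d y x x; rewrite pdistxx (pdistC d y x); lra.
Qed.

Definition pdist0 : rel T := fun x y => d x y == 0.

Lemma pdist0_refl : reflexive pdist0.
Proof. by move=> x; rewrite /pdist0 pdistxx. Qed.

Lemma pdist0_sym : symmetric pdist0.
Proof. by move=> x y; rewrite /pdist0 pdistC. Qed.

Lemma pdist0_trans : transitive pdist0.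
Proof.
move=> y x z /eqP xy /eqP yz; apply/eqP/le_anti; rewrite pdist_ge0 andbT.
by rewrite -(addr0 0) -{1}xy -yz pdist_triangle.
Qed.

Canonical pdist0_equiv := EquivRel pdist0 pdist0_refl pdist0_sym pdist0_trans.

Definition metric_quotient : Type := {eq_quot pdist0}.
HB.instance Definition _ := Choice.on metric_quotient.
HB.instance Definition _ := Quotient.on metric_quotient.

Definition mqdist (x y : metric_quotient) : R := d (repr x) (repr y).

Lemma mqdistxx x : mqdist x x = 0.
Proof. exact: pdistxx. Qed.

Lemma mqdist_positivity x y : mqdist x y = 0 -> x = y.
Proof.
move=> xy; rewrite -(reprK x) -(reprK y).
by apply/eqquotP/eqP.
Qed.

Lemma mqdistC x y : mqdist x y = mqdist y x.
Proof. exact: pdistC. Qed.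

Lemma mqdist_triangle y x z : mqdist x z <= mqdist x y + mqdist y z.
Proof. exact: pdist_triangle. Qed.

HB.instance Definition _ := isMetric.Build R metric_quotient
  mqdistxx mqdist_positivity mqdistC mqdist_triangle.

End MetricQuotient.

Section WordMetric.
Local Open Scope group_scope.
Context {G : groupType}.

(* Words in the elements of S and their inverses. *)
Definition is_word (S w : seq G) : bool :=
  all (fun s => (s \in S) || (s^-1 \in S)) w.

Definition spells (S : seq G) (n : nat) (g : G) : Prop :=
  exists w, [/\ is_word S w, size w = n & \prod_(s <- w) s = g].

Definition generates (S : seq G) : Prop := forall g, exists n, spells S n g.

End WordMetric.

Record genset (G : groupType) := Genset {
  genseq :> seq G;
  genseqP : generates genseq }.

Definition finitely_generated (G : groupType) : Prop :=
  exists S : seq G, generates S.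

Section WordLength.
Local Open Scope group_scope.
Context {G : groupType} (S : genset G).

Lemma word_length_subproof (g : G) : exists n, `[< spells S n g >].
Proof. by have [n gn] := genseqP S g; exists n; apply/asboolP. Qed.

Definition word_length (g : G) : nat := ex_minn (word_length_subproof g).

Definition wdist (g h : G) : nat := word_length (g^-1 * h).

Lemma word_lengthP g : spells S (word_length g) g.
Proof. by rewrite /word_length; case: ex_minnP => n /asboolP. Qed.

Lemma word_length_le n g : spells S n g -> (word_length g <= n)%N.
Proof. by move=> ng; rewrite /word_length; case: ex_minnP => m _; apply; apply/asboolP. Qed.

Lemma spells0 g : spells S 0 g -> g = 1.
Proof. by move=> [w [_ /size0nil -> <-]]; rewrite big_nil. Qed.

Lemma spells1 : spells S 0 1.
Proof. by exists [::]; rewrite big_nil. Qed.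

Lemma spellsV n g : spells S n g -> spells S n g^-1.
Proof.
move=> [w [Sw <- <-]]; elim: w Sw => [|s w IH] /=.
  by rewrite big_nil invg1 => _; exact: spells1.
move=> /andP[Ss /IH[w' [Sw' sw' w'E]]].
exists (rcons w' s^-1); split; rewrite ?size_rcons ?sw'//.
  by rewrite /is_word all_rcons; apply/andP; split => //; rewrite invgK orbC.
by rewrite big_cons -cats1 big_cat big_seq1 w'E invgM.
Qed.

Lemma spellsM m n g h : spells S m g -> spells S n h -> spells S (m + n) (g * h).
Proof.
move=> [w [Sw <- <-]] [w' [Sw' <- <-]]; exists (w ++ w').
by rewrite /is_word all_cat size_cat big_cat; split => //; exact/andP.
Qed.

Lemma wdistxx g : wdist g g = 0%N.
Proof.
apply/eqP; rewrite -leqn0 /wdist mulVg.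
exact: word_length_le spells1.
Qed.

Lemma wdist_eq0 g h : wdist g h = 0%N -> g = h.
Proof.
move=> gh; have := word_lengthP (g^-1 * h).
rewrite -/(wdist g h) gh => /spells0 gh1.
by rewrite -[h]mul1g -(mulgV g) -mulgA gh1 mulg1.
Qed.

Lemma wdist_le g h : (wdist g h <= wdist h g)%N.
Proof.
by apply: word_length_le; rewrite -[h in _ * h]invgK -invgM; exact/spellsV/word_lengthP.
Qed.

Lemma wdistC g h : wdist g h = wdist h g.
Proof. by apply/eqP; rewrite eqn_leq !wdist_le. Qed.

Lemma wdist_triangle h g k : (wdist g k <= wdist g h + wdist h k)%N.
Proof.
apply: word_length_le.
have -> : g^-1 * k = (g^-1 * h) * (h^-1 * k) by rewrite -mulgA (mulgA h) mulgV mul1g.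
by apply: spellsM; exact: word_lengthP.
Qed.

End WordLength.

(* G with the left-invariant word metric of S. *)
Definition word_space (R : realType) (G : groupType) (S : genset G) : Type := G.

Section WordSpace.
Context {R : realType} {G : groupType} {S : genset G}.
Local Notation W := (word_space R S).

HB.instance Definition _ := Choice.copy W G.

Definition word_mdist (g h : W) : R := (wdist S g h)%:R.

Lemma word_mdistxx g : word_mdist g g = 0.
Proof. by rewrite /word_mdist wdistxx. Qed.

Lemma word_mdist_positivity g h : word_mdist g h = 0 -> g = h.
Proof. by move=> /eqP; rewrite pnatr_eq0 => /eqP/wdist_eq0. Qed.

Lemma word_mdistC g h : word_mdist g h = word_mdist h g.
Proof. by rewrite /word_mdist wdistC. Qed.

Lemma word_mdist_triangle h g k :
  word_mdist g k <= word_mdist g h + word_mdist h k.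
Proof. by rewrite /word_mdist -natrD ler_nat wdist_triangle. Qed.

HB.instance Definition _ := isMetric.Build R W
  word_mdistxx word_mdist_positivity word_mdistC word_mdist_triangle.

End WordSpace.

(* A subgroup H of G enters as a group with its inclusion f : H -> G. *)
Definition undistorted (R : realType) (H G : groupType) (f : H -> G) : Prop :=
  forall (T : genset H) (S : genset G),
    qi_embedding (f : word_space R T -> word_space R S).

(* The triple (u, v, t) with d(u, v) <= 1 stands for the point at distance
   t * d(u, v) from u on the edge from u to v; it is the vertex u when u = v.
   Identifying triples at distance 0 yields the geometric realization of the
   (simplicial) Cayley graph, every edge having length 1. *)
Section Cayley.
Context {R : realType} {G : groupType} (S : genset G).

Local Notation "d( u , v )" := ((wdist S u v)%:R : R) (format "d( u ,  v )").

Definition on_edge (x : G * G * R) : bool :=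
  (wdist S x.1.1 x.1.2 <= 1)%N && (0 <= x.2 <= 1).

Definition edge_point : Type := {x : G * G * R | on_edge x}.
HB.instance Definition _ := Choice.on edge_point.

Implicit Types x y z : edge_point.

Definition src x : G := (val x).1.1.
Definition tgt x : G := (val x).1.2.
Definition src_dist x : R := (val x).2 * d(src x, tgt x).
Definition tgt_dist x : R := (1 - (val x).2) * d(src x, tgt x).

(* Distance to the vertex w. *)
Definition vertex_dist x (w : G) : R :=
  Num.min (src_dist x + d(src x, w)) (tgt_dist x + d(tgt x, w)).

(* If x and y do not lie on a common edge, a path from x to y enters the edge
   of y through one of its endpoints. *)
Definition edge_dist x y : R :=
  if (src x == src y) && (tgt x == tgt y) then `|src_dist x - src_dist y|
  else if (src x == tgt y) && (tgt x == src y) then `|src_dist x - tgt_dist y|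
  else Num.min (vertex_dist x (src y) + src_dist y)
               (vertex_dist x (tgt y) + tgt_dist y).

Let dC (u v : G) : d(u, v) = d(v, u).
Proof. by rewrite wdistC. Qed.

Let dxx (u : G) : d(u, u) = 0.
Proof. by rewrite wdistxx. Qed.

Let dT (v u w : G) : d(u, w) <= d(u, v) + d(v, w).
Proof. by rewrite -natrD ler_nat wdist_triangle. Qed.

Let d0 (u v : G) : 0 <= d(u, v). Proof. by []. Qed.

Let src_ge0 x : 0 <= src_dist x.
Proof. by case/andP: (valP x) => _ /andP[? ?]; apply: mulr_ge0. Qed.

Let tgt_ge0 x : 0 <= tgt_dist x.
Proof.
by case/andP: (valP x) => _ /andP[? ?]; apply: mulr_ge0 => //; rewrite subr_ge0.
Qed.

Let srcDtgt x : src_dist x + tgt_dist x = d(src x, tgt x).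
Proof. by rewrite /src_dist /tgt_dist; ring. Qed.

Lemma edge_distxx x : edge_dist x x = 0.
Proof. by rewrite /edge_dist !eqxx subrr normr0. Qed.

Lemma edge_distC x y : edge_dist x y = edge_dist y x.
Proof.
rewrite /edge_dist (eq_sym (src y)) (eq_sym (tgt y)) distrC.
case: ifP => // _; rewrite (eq_sym (src y)) (eq_sym (tgt y)) [in RHS]andbC.
case: ifP => [/andP[/eqP e1 /eqP e2]|_].
  have := srcDtgt x; have := srcDtgt y; rewrite e1 e2 (dC (tgt y)) => h1 h2.
  congr `|_|; lra.
rewrite /vertex_dist (dC (src y) (src x)) (dC (src y) (tgt x)).
rewrite (dC (tgt y) (src x)) (dC (tgt y) (tgt x)).
rewrite !minElt; repeat case: ifPn; rewrite -?leNgt => *; lra.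
Qed.

Let edge_dist_le_src x y : edge_dist x y <= vertex_dist x (src y) + src_dist y.
Proof.
rewrite /edge_dist; case: ifPn => [/andP[/eqP e1 /eqP e2]|_].
  have := srcDtgt x; have := srcDtgt y; rewrite /vertex_dist e1 e2 !dxx.
  have := src_ge0 x; have := src_ge0 y; have := tgt_ge0 x; have := tgt_ge0 y.
  rewrite (dC (tgt y)) ler_norml minElt; case: ifP => _ *; apply/andP; split; lra.
case: ifPn => [/andP[/eqP e1 /eqP e2]|_].
  have := srcDtgt x; have := srcDtgt y; rewrite /vertex_dist e1 e2 !dxx.
  have := src_ge0 x; have := src_ge0 y; have := tgt_ge0 x; have := tgt_ge0 y.
  rewrite (dC (tgt y)) ler_norml minElt; case: ifP => _ *; apply/andP; split; lra.
by rewrite ge_min lexx.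
Qed.

Let edge_dist_le_tgt x y : edge_dist x y <= vertex_dist x (tgt y) + tgt_dist y.
Proof.
rewrite /edge_dist; case: ifPn => [/andP[/eqP e1 /eqP e2]|_].
  have := srcDtgt x; have := srcDtgt y; rewrite /vertex_dist e1 e2 !dxx.
  have := src_ge0 x; have := src_ge0 y; have := tgt_ge0 x; have := tgt_ge0 y.
  rewrite ler_norml minElt; case: ifP => _ *; apply/andP; split; lra.
case: ifPn => [/andP[/eqP e1 /eqP e2]|_].
  have := srcDtgt x; have := srcDtgt y; rewrite /vertex_dist e1 e2 !dxx.
  have := src_ge0 x; have := src_ge0 y; have := tgt_ge0 x; have := tgt_ge0 y.
  rewrite (dC (tgt y)) ler_norml minElt; case: ifP => _ *; apply/andP; split; lra.
by rewrite ge_min lexx orbT.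
Qed.

Let vertex_dist_lip x y w : vertex_dist x w <= edge_dist x y + vertex_dist y w.
Proof.
have sx := src_ge0 x; have sy := src_ge0 y.
have tx := tgt_ge0 x; have ty := tgt_ge0 y.
have ex := srcDtgt x; have ey := srcDtgt y.
rewrite /edge_dist; case: ifPn => [/andP[/eqP e1 /eqP e2]|_].
  rewrite /vertex_dist e1 e2 in ex *.
  have := ler_norm (src_dist x - src_dist y).
  have := ler_norm (src_dist y - src_dist x); rewrite distrC.
  by rewrite !minElt; repeat case: ifPn; rewrite -?leNgt => *; lra.
case: ifPn => [/andP[/eqP e1 /eqP e2]|_].
  rewrite /vertex_dist e1 e2 (dC (tgt y)) in ex *.
  have := ler_norm (src_dist x - tgt_dist y).
  have := ler_norm (tgt_dist y - src_dist x); rewrite distrC.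
  by rewrite !minElt; repeat case: ifPn; rewrite -?leNgt => *; lra.
have h1 := dT (src y) (src x) w; have h2 := dT (tgt y) (src x) w.
have h3 := dT (src y) (tgt x) w; have h4 := dT (tgt y) (tgt x) w.
have h5 := dT (src y) (tgt y) w; have h6 := dT (tgt y) (src y) w.
have h7 := dC (src y) (tgt y).
rewrite /vertex_dist.
by rewrite !minElt; repeat case: ifPn; rewrite -?leNgt => *; lra.
Qed.

Definition same_edge x y :=
  ((src x == src y) && (tgt x == tgt y)) || ((src x == tgt y) && (tgt x == src y)).

Let edge_dist_via y x z : ~~ same_edge y z ->
  edge_dist x z <= edge_dist x y + edge_dist y z.
Proof.
rewrite negb_or {3}/edge_dist => /andP[/negPf -> /negPf ->].
have h1 := edge_dist_le_src x z; have h2 := edge_dist_le_tgt x z.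
have h3 := vertex_dist_lip x y (src z); have h4 := vertex_dist_lip x y (tgt z).
by rewrite minElt; case: ifP => _; lra.
Qed.

Let same_edge_sym x y : same_edge x y = same_edge y x.
Proof.
by rewrite /same_edge !(eq_sym (src x)) !(eq_sym (tgt x)) [X in _ || X]andbC.
Qed.

Let same_edgeP x y : same_edge x y ->
  (src x = src y /\ tgt x = tgt y) \/ (src x = tgt y /\ tgt x = src y).
Proof.
by move=> /orP[/andP[/eqP ? /eqP ?]|/andP[/eqP ? /eqP ?]]; [left|right].
Qed.

Let edge_dist_same x y : src x = src y -> tgt x = tgt y ->
  edge_dist x y = `|src_dist x - src_dist y|.
Proof. by rewrite /edge_dist => -> ->; rewrite !eqxx. Qed.

Let edge_dist_swap x y : src x = tgt y -> tgt x = src y ->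
  edge_dist x y = `|src_dist x - tgt_dist y|.
Proof.
move=> e1 e2; rewrite /edge_dist e1 e2 !eqxx /=; case: ifPn => // /andP[/eqP e _].
have ex := srcDtgt x; have ey := srcDtgt y.
move: ex ey; rewrite e1 e2 e dxx => ex ey.
have sx := src_ge0 x; have sy := src_ge0 y.
have tx := tgt_ge0 x; have ty := tgt_ge0 y.
congr `|_|; lra.
Qed.

Lemma edge_dist_triangle y x z : edge_dist x z <= edge_dist x y + edge_dist y z.
Proof.
have [yz|] := boolP (same_edge y z); last exact: edge_dist_via.
have [xy|] := boolP (same_edge x y); last first.
  rewrite same_edge_sym => yx; rewrite (edge_distC x z) addrC (edge_distC y z).
  by rewrite (edge_distC x y); exact: edge_dist_via.
have ex := srcDtgt x; have ey := srcDtgt y; have ez := srcDtgt z.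
have abs_tri (a b c : R) : `|a - c| <= `|a - b| + `|b - c|.
  by rewrite (le_trans _ (ler_normD _ _))// addrA subrK.
case: (same_edgeP xy) => [[xy1 xy2]|[xy1 xy2]];
  case: (same_edgeP yz) => [[yz1 yz2]|[yz1 yz2]].
- by rewrite !edge_dist_same// ?xy1 ?xy2.
- rewrite (edge_dist_swap (x := x) (y := z)) ?xy1 ?xy2//.
  by rewrite edge_dist_same// edge_dist_swap.
- rewrite (edge_dist_swap (x := x) (y := z)) ?xy1 ?xy2//.
  rewrite (edge_dist_swap (x := x) (y := y))// (edge_dist_same (x := y))//.
  rewrite yz1 yz2 in ey; have -> : `|src_dist y - src_dist z| =
    `|tgt_dist y - tgt_dist z| by rewrite -normrN; congr `|_|; lra.
  exact: abs_tri.
- rewrite (edge_dist_same (x := x) (y := z)) ?xy1 ?xy2//.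
  rewrite !edge_dist_swap//.
  rewrite yz1 yz2 (dC (tgt z)) in ey; have -> : `|src_dist y - tgt_dist z| =
    `|tgt_dist y - src_dist z| by rewrite -normrN; congr `|_|; lra.
  exact: abs_tri.
Qed.

Definition edge_pseudodist : pseudodist R edge_point :=
  PseudoDist edge_distxx edge_distC edge_dist_triangle.

Definition cayley_graph : metricType R := metric_quotient edge_pseudodist.

Lemma on_edge_vertex (g : G) : on_edge (g, g, 0).
Proof. by rewrite /on_edge /= wdistxx lexx ler01. Qed.

Definition vertex_point (g : G) : cayley_graph :=
  \pi_(metric_quotient edge_pseudodist)
    (exist _ (g, g, 0) (on_edge_vertex g) : edge_point).

End Cayley.
Arguments cayley_graph R {G} S.


(* The non-principal ultrafilter, the basepoints and the scaling factors of an
   asymptotic cone of X; the n-th metric is mdist / cone_scale n. *)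
Record cone_data (R : realType) (X : metricType R) := ConeData {
  cone_filter : set_system nat;
  cone_ultra : UltraFilter cone_filter;
  cone_nonprincipal : forall n, ~ cone_filter [set n];
  cone_base : nat -> X;
  cone_scale : nat -> R;
  cone_scale_gt0 : forall n, 0 < cone_scale n;
  cone_scale_pinfty : cone_scale n @[n --> cone_filter] --> +oo }.
#[global] Existing Instance cone_ultra.


Lemma ultra_bounded_cvg (R : realType) (w : set_system nat)
    (w_ultra : UltraFilter w) (f : nat -> R) (M : R) :
  (\forall n \near w, `|f n| <= M) -> cvg (f n @[n --> w]).
Proof.
move=> fM.
have PF : ProperFilter (f @ w) by exact: fmap_proper_filter.
have := @segment_compact R (- M) M (f @ w) PF; case.
  by near=> n => /=; rewrite in_itv /= -ler_norml; near: n.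
move=> p [_ pf]; apply/cvg_ex; exists p => A pA.
have [//|wA] := in_ultra_setVsetC (f @^-1` A) w_ultra.
by have [x []] := pf (~` A) A wA pA.
Unshelve. all: by end_near. Qed.

Section Cone.
Context {R : realType} {X : metricType R} (D : cone_data X).
Local Notation w := (cone_filter D).
Local Notation e := (cone_base D).
Local Notation mu := (cone_scale D).

Definition cone_seq : Type := {s : nat -> X |
  `[< exists M : R, \forall n \near w, mdist (s n) (e n) / mu n <= M >]}.
HB.instance Definition _ := Choice.on cone_seq.

Definition cone_dist (s t : cone_seq) : R :=
  lim (mdist (val s n) (val t n) / mu n @[n --> w]).

Let mu0 n : 0 < (mu n)^-1. Proof. by rewrite invr_gt0 cone_scale_gt0. Qed.

Lemma cone_dist_cvg (s t : cone_seq) :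
  mdist (val s n) (val t n) / mu n @[n --> w] --> cone_dist s t.
Proof.
have /asboolP[M sM] := valP s; have /asboolP[N tN] := valP t.
apply: (@ultra_bounded_cvg R w _ _ (M + N)).
near=> n; rewrite ger0_norm; last by rewrite mulr_ge0 ?mdist_ge0 ?ltW.
apply: (@le_trans _ _ ((mdist (val s n) (e n) + mdist (e n) (val t n)) / mu n)).
  by rewrite ler_pM2r// metric_triangle.
rewrite mulrDl (metric_sym (e n)) lerD//; near: n; [exact: sM|exact: tN].
Unshelve. all: by end_near. Qed.

Lemma cone_distxx s : cone_dist s s = 0.
Proof.
rewrite /cone_dist; under eq_fun do rewrite mdistxx mul0r.
exact: lim_cst.
Qed.

Lemma cone_distC s t : cone_dist s t = cone_dist t s.
Proof.
by rewrite /cone_dist; under eq_fun do rewrite metric_sym.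
Qed.

Lemma cone_dist_triangle t s u :
  cone_dist s u <= cone_dist s t + cone_dist t u.
Proof.
have st := cvgD (@cone_dist_cvg s t) (@cone_dist_cvg t u).
apply: (ler_cvg_to (@cone_dist_cvg s u) (st _)).
apply: nearW => n /=.
by rewrite -mulrDl ler_pM2r// metric_triangle.
Qed.

Definition cone_pseudodist : pseudodist R cone_seq :=
  PseudoDist cone_distxx cone_distC cone_dist_triangle.

Definition asymptotic_cone : metricType R := metric_quotient cone_pseudodist.

Definition cone_limit (H : set X) : set asymptotic_cone :=
  [set \pi_(metric_quotient cone_pseudodist) s
    | s in [set s : cone_seq | forall n, H (val s n)]].

End Cone.

Definition separated_by (X : topologicalType) (z x y : X) : Prop :=
  [/\ x <> z, y <> z & ~ connected_component (~` [set z]) x y].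

(* This is meant for K finitely generated and H finitely generated and
   undistorted in K. Asymptotic cones of K for two finite generating sets and
   the same data are bi-Lipschitz equivalent, so that quantifying over all
   generating sets adds nothing. *)
Definition relatively_wide (R : realType) (K : groupType) (H : set K) : Prop :=
  forall (S : genset K) (D : cone_data (word_space R S))
         (x y z : asymptotic_cone D),
    @cone_limit R _ D H x -> @cone_limit R _ D H y -> ~ separated_by z x y.

Section Rays.
Context {R : realType} {X : metricType R}.

Definition half_line : Type := [set t : R | 0 <= t].
HB.instance Definition _ := Topological.on half_line.

Definition time (t : half_line) : R := set_val t.

Definition is_geodesic_ray (p : X) (c : half_line -> X) : Prop :=
  (forall t, time t = 0 -> c t = p) /\
  forall s t, mdist (c s) (c t) = `|time s - time t|.

Definition is_quasi_geodesic (C a b : R) (q : R -> X) : Prop :=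
  forall s t, s \in `[a, b] -> t \in `[a, b] ->
    C^-1 * `|s - t| - C <= mdist (q s) (q t) <= C * `|s - t| + C.

Record morse_gauge := MorseGauge {
  gauge_fun :> R -> R;
  gauge_ge0 : forall C, 1 <= C -> 0 <= gauge_fun C }.

(* The image of a geodesic ray is closed and X is meant to be proper, so that
   the distance to the ray is attained: this is the neighbourhood of points at
   distance at most N C. *)
Definition is_morse (N : morse_gauge) (c : half_line -> X) : Prop :=
  forall (C a b : R) (q : R -> X), 1 <= C -> a <= b ->
    is_quasi_geodesic C a b q -> range c (q a) -> range c (q b) ->
    forall t, t \in `[a, b] -> exists s, mdist (q t) (c s) <= N C.

(* Finite Hausdorff distance. *)
Definition asymptotic (c c' : half_line -> X) : Prop :=
  exists M : R, (forall s, exists t, mdist (c s) (c' t) <= M) /\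
                (forall t, exists s, mdist (c s) (c' t) <= M).

Lemma asymptotic_refl c : asymptotic c c.
Proof. by exists 0; split => s; exists s; rewrite mdistxx. Qed.

Lemma asymptotic_sym c c' : asymptotic c c' -> asymptotic c' c.
Proof.
move=> [M [cM c'M]]; exists M; split => s.
  by have [t] := c'M s; exists t; rewrite metric_sym.
by have [t] := cM s; exists t; rewrite metric_sym.
Qed.

Lemma asymptotic_trans c2 c1 c3 :
  asymptotic c1 c2 -> asymptotic c2 c3 -> asymptotic c1 c3.
Proof.
move=> [M [h1 h2]] [N [h3 h4]]; exists (M + N); split => s.
  have [t st] := h1 s; have [u tu] := h3 t; exists u.
  by rewrite (le_trans (metric_triangle _ (c2 t) _))// lerD.
have [t st] := h4 s; have [u tu] := h2 t; exists u.
by rewrite (le_trans (metric_triangle _ (c2 t) _))// lerD.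
Qed.

End Rays.
Arguments morse_gauge R : clear implicits.

Section MorseBoundary.
Context {R : realType} {X : metricType R} (p : X).

Local Notation ray_space := {compact-open, half_line -> X}.

Definition morse_rays (N : morse_gauge R) : set ray_space :=
  [set c | is_geodesic_ray p c /\ is_morse N c].

Definition all_morse_rays : set ray_space := \bigcup_N morse_rays N.

Definition asymptotic_in (A : set ray_space) : rel A :=
  fun c c' => `[< asymptotic (set_val c) (set_val c') >].

Lemma asymptotic_in_refl A : reflexive (@asymptotic_in A).
Proof. by move=> c; apply/asboolP/asymptotic_refl. Qed.

Lemma asymptotic_in_sym A : symmetric (@asymptotic_in A).
Proof. by move=> c c'; apply/asboolP/asboolP => /asymptotic_sym. Qed.

Lemma asymptotic_in_trans A : transitive (@asymptotic_in A).
Proof.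
by move=> c2 c1 c3 /asboolP h /asboolP h'; apply/asboolP/(asymptotic_trans h h').
Qed.

Canonical asymptotic_equiv A := EquivRel (@asymptotic_in A)
  (@asymptotic_in_refl A) (@asymptotic_in_sym A) (@asymptotic_in_trans A).

(* N-Morse rays with the topology induced by the compact-open topology, modulo
   finite Hausdorff distance. *)
Definition morse_stratum (N : morse_gauge R) : topologicalType :=
  quotient_topology {eq_quot (@asymptotic_in (morse_rays N))}.

Definition morse_boundary : Type := {eq_quot (@asymptotic_in all_morse_rays)}.
HB.instance Definition _ := Choice.on morse_boundary.

Lemma morse_rays_sub N c : c \in morse_rays N -> c \in all_morse_rays.
Proof. by rewrite !inE => h; exists N. Qed.

Definition stratum_incl (N : morse_gauge R) (x : morse_stratum N) :
    morse_boundary :=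
  \pi_{eq_quot (@asymptotic_in all_morse_rays)}
    (exist (fun c => c \in all_morse_rays) _ (morse_rays_sub (valP (repr x)))).

(* The preimage under stratum_incl N plays the role of the intersection with
   the N-th stratum. *)
Definition morse_open (U : set morse_boundary) : Prop :=
  forall N : morse_gauge R, open (@stratum_incl N @^-1` U).

Lemma morse_openT : morse_open setT.
Proof. by move=> N; rewrite preimage_setT; exact: openT. Qed.

Lemma morse_openI : setI_closed morse_open.
Proof. by move=> U V oU oV N; rewrite preimage_setI; exact: openI. Qed.

Lemma morse_open_bigcup (I : Type) (f : I -> set morse_boundary) :
  (forall i, morse_open (f i)) -> morse_open (\bigcup_i f i).
Proof.
by move=> fo N; rewrite preimage_bigcup; apply: bigcup_open => i _; exact: fo.
Qed.

HB.instance Definition _ := isOpenTopological.Build morse_boundary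
  morse_openT morse_openI morse_open_bigcup.

End MorseBoundary.

Definition group_morse_boundary (R : realType) (G : groupType) (S : genset G) :
    topologicalType :=
  morse_boundary (vertex_point S 1%g : cayley_graph R S).

Definition is_tree (T : eqType) (adj : rel T) : Prop :=
  [/\ irreflexive adj, symmetric adj, inhabited T,
      forall x y, exists2 s, path adj x s & last x s = y &
      forall c : seq T, ucycle adj c -> (size c <= 2)%N].

(* Without inversions, an action fixing a point of the tree fixes a vertex. *)
Record splitting (G : groupType) := Splitting {
  vertex : choiceType;
  adj : rel vertex;
  act : G -> vertex -> vertex;
  adj_tree : is_tree adj;
  act1 : forall x, act 1%g x = x;
  actM : forall g h x, act (g * h)%g x = act g (act h x);
  act_adj : forall g x y, adj (act g x) (act g y) = adj x y;
  act_no_inversion : forall g x y, adj x y -> ~ (act g x = y /\ act g y = x);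
  act_no_fixpoint : ~ exists x, forall g, act g x = x }.

Section Stabilisers.
Context {G : groupType} (T : splitting G).
Implicit Types (g h : G) (p q : vertex T).

Definition vstab p : {pred G} := [pred g | act g p == p].

(* The setwise stabiliser of the edge {p, q}. *)
Definition estab p q : {pred G} := [pred g |
  (act g p == p) && (act g q == q) || (act g p == q) && (act g q == p)].

Lemma actV g p q : act g p = q -> act g^-1%g q = p.
Proof. by move=> <-; rewrite -actM mulVg act1. Qed.

Lemma vstab_closed p : group_closed (vstab p).
Proof.
split=> [|g h]; first by rewrite inE act1.
rewrite !inE => /eqP gp /eqP hp.
by rewrite actM (actV hp) gp.
Qed.

Lemma estab_closed p q : group_closed (estab p q).
Proof.
split=> [|g h]; first by rewrite inE !act1 !eqxx.
rewrite !inE !actM.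
by move=> /orP[|] /andP[/eqP gp /eqP gq] /orP[|] /andP[/eqP/actV hp /eqP/actV hq];
  rewrite hp hq gp gq !eqxx ?orbT.
Qed.

Definition vertex_group p : Type := {g : G | vstab p g}.
HB.instance Definition _ p := SubChoice.on (vertex_group p).
HB.instance Definition _ p :=
  SubChoice_isSubGroup.Build G (vstab p) (vertex_group p) (vstab_closed p).

Definition edge_group p q : Type := {g : G | estab p q g}.
HB.instance Definition _ p q := SubChoice.on (edge_group p q).
HB.instance Definition _ p q :=
  SubChoice_isSubGroup.Build G (estab p q) (edge_group p q) (estab_closed p q).

(* The edge group of {p, q} as a set of elements of the vertex group of p. *)
Definition edge_in_vertex_group p q : set (vertex_group p) :=
  [set g | estab p q (val g)].

End Stabilisers.
Arguments edge_in_vertex_group {G T} p q _.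

(* Main.v *)
(* A Morse quasi-geodesic is one along which paths avoiding a ball of radius
   s/L have length more than L s for large s; relative wideness says, through
   asymptotic cones, that two points of an edge group can instead be joined
   around such a ball by a path of length O(s). Hence a Morse ray stays near
   the coset of an edge group for a bounded time only, and it selects either
   an end or a vertex of the tree. Sides of edges are clopen in the boundary,
   so a connected component lies over one end or one vertex. Over an end, two
   Morse rays cross the same infinitely many edges and the triangle they span
   with such a crossing has bounded third side, so that they are asymptotic.
   Over a vertex p, the rays remain near the vertex group V; replacing the
   excursions of paths outside of V by detours in V shows that Morse rays of
   V are Morse in G, and the boundary of V embeds onto the closed set of
   points lying over p. *)
From HB Require Import structures.
Require Import Defs.
From mathcomp Require Import all_boot all_order all_algebra.
From mathcomp Require Import all_classical all_reals all_analysis.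
From mathcomp Require Import ring lra zify.
Import numFieldNormedType.Exports.
Import Order.TTheory GRing.Theory Num.Theory.

Set Implicit Arguments.
Unset Strict Implicit.
Unset Printing Implicit Defensive.

Local Open Scope classical_set_scope.

(** * Word metrics *)

(** Every constant has to depend on the Morse gauge alone and not on the ray, since openness is
    tested inside one stratum; this is why constants are chosen before rays throughout. The geometry
    takes place in the integral word metric, and the reals come back only through the vertices that
    a geodesic ray visits at integral times. Cones enter once: a sequence of missing detours yields
    a cone with a cut point between two points of the limit of the edge group. From then on only
    lengths and radii proportional to a scale [s] matter, and divergence is the form of the Morse
    property that can be compared with them. The tree is not assumed cocompact. Uniformity comes
    from a finite walk [F] in it: the translates gF follow the paths of [G], and an edge in gF is
    moved by the inverse of g to one of the finitely many edges of [F]. The two directions at a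
    vertex differ in nature: gauges pass from [G] to [V] by undistortion, while passing from [V] to
    [G] needs divergence and detours. *)

Section WordGeometry.
Local Open Scope group_scope.
Context {G : groupType} (S : genset G).
Local Notation d := (wdist S).
Implicit Types (g h k x y z : G) (n m : nat) (P : G -> Prop).

Lemma wdistM k g h : d (k * g) (k * h) = d g h.
Proof. by rewrite /wdist invgM -mulgA mulKg. Qed.

Lemma wdist_leD m n x y z : (d x y <= m)%N -> (d y z <= n)%N -> (d x z <= m + n)%N.
Proof.
by move=> xy yz; apply: (leq_trans (wdist_triangle S y x z)); exact: leq_add.
Qed.

Lemma wdist_step n x y : d x y = n.+1 -> exists z, d x z = 1%N /\ d z y = n.
Proof.
move=> xy; have := word_lengthP S (x^-1 * y); rewrite -/(d x y) xy.
move=> [[|s w] [//= /andP[Ss Sw] [sw] pw]].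
exists (x * s).
have h1 : (d x (x * s) <= 1)%N.
  apply: word_length_le; exists [:: s]; split => //=; first by rewrite Ss.
  by rewrite big_seq1 mulKg.
have h2 : (d (x * s) y <= n)%N.
  apply: word_length_le; exists w; split => //.
  by move: pw; rewrite big_cons invgM -mulgA => <-; rewrite mulKg.
have := wdist_triangle S (x * s) x y; lia.
Qed.

Lemma geodesic_segment x y : exists f : nat -> G, [/\ f 0 = x, f (d x y) = y &
  forall i j, (i <= j <= d x y)%N -> d (f i) (f j) = (j - i)%N].
Proof.
have [n xy] : exists n, d x y = n by exists (d x y).
elim: n x xy => [|n IH] x xy.
  exists (fun=> x); split => //; first exact: (wdist_eq0 xy).
  by move=> i j; rewrite wdistxx; lia.
have [z [xz zy]] := wdist_step xy; have [f [f0 fn fg]] := IH _ zy.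
exists (fun i => if i is i'.+1 then f i' else x); split => //.
  by rewrite xy /=; rewrite zy in fn.
move=> [|i] [|j] ij; rewrite ?wdistxx//.
  have fj : d z (f j) = j by rewrite -f0 fg; lia.
  have fy : d (f j) y = (n - j)%N by rewrite -{1}fn fg; lia.
  have := wdist_triangle S z x (f j); have := wdist_triangle S (f j) x y; lia.
by rewrite fg; lia.
Qed.

Lemma finite_ball n : exists s : seq G, forall g, (d 1 g <= n)%N -> g \in s.
Proof.
elim: n => [|n [s sP]].
  exists [:: 1] => g; rewrite leqn0 => /eqP /wdist_eq0 <-; exact: mem_head.
exists (s ++ [seq a * b | a <- s, b <- S ++ [seq c^-1 | c <- S]]) => g gn.
rewrite mem_cat; case: (leqP (d 1 g) n) => [/sP ->//|ng].
have /wdist_step[z [gz z1]] : d g 1 = n.+1 by rewrite wdistC; lia.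
apply/orP; right; apply/allpairsP; exists (z, z^-1 * g); split => /=.
- by apply: sP; rewrite wdistC z1.
- have := word_lengthP S (z^-1 * g); rewrite -/(d z g) wdistC gz.
  move=> [[|a [|b w]] [/= aS // _]]; rewrite big_seq1 => <-.
  rewrite andbT in aS.
  rewrite mem_cat; case/orP: aS => [->//|aS]; apply/orP; right.
  by apply/mapP; exists a^-1; rewrite ?invgK.
- by rewrite mulVKg.
Qed.

(** Steps of length 0 are allowed, so that the index is only an upper bound for the length of the
    path. *)
Inductive conn P : nat -> G -> G -> Prop :=
| conn0 x : P x -> conn P 0 x x
| connS n x y z : P x -> (d x y <= 1)%N -> conn P n y z -> conn P n.+1 x z.

Lemma conn_start P n x y : conn P n x y -> P x.
Proof. by case. Qed.

Lemma conn_end P n x y : conn P n x y -> P y.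
Proof. by elim. Qed.

Lemma conn_cat P n m x y z : conn P n x y -> conn P m y z -> conn P (n + m) x z.
Proof.
by elim=> // {}n {}x u {}y Px xu _ IH /IH yz; exact: (connS Px xu).
Qed.

Lemma conn_rcons P n x y z : conn P n x y -> (d y z <= 1)%N -> P z ->
  conn P n.+1 x z.
Proof.
move=> xy yz Pz; rewrite -addn1; apply: (conn_cat xy).
by apply: (connS (conn_end xy) yz); exact: conn0.
Qed.

Lemma conn_sym P n x y : conn P n x y -> conn P n y x.
Proof.
elim=> [{}x Px|{}n {}x u {}y Px xu _ IH]; first exact: conn0.
by apply: (conn_rcons IH) => //; rewrite wdistC.
Qed.

Lemma conn_leq P n m x y : (n <= m)%N -> conn P n x y -> conn P m x y.
Proof.
move=> nm xy; rewrite -(subnKC nm); apply: (conn_cat xy).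
elim: (m - n)%N => [|k IH]; first exact/conn0/(conn_end xy).
by apply: (connS _ _ IH); rewrite ?wdistxx//; exact: conn_end xy.
Qed.

Lemma conn_sub P P' n x y : (forall w, P w -> P' w) -> conn P n x y ->
  conn P' n x y.
Proof.
move=> PP'; elim=> [{}x Px|{}n {}x u {}y Px xu _ IH]; first exact/conn0/PP'.
by apply: connS IH => //; exact: PP'.
Qed.

Lemma conn_wdist P n x y : conn P n x y -> (d x y <= n)%N.
Proof.
elim=> [{}x _|{}n {}x u {}y Px xu _ IH]; first by rewrite wdistxx.
by have := wdist_triangle S u x y; lia.
Qed.

Lemma conn_geodesic P x y :
  (forall w, (d x w + d w y <= d x y)%N -> P w) -> conn P (d x y) x y.
Proof.
have [n xy] : exists n, d x y = n by exists (d x y).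
rewrite [X in conn _ X]xy; elim: n x xy => [|n IH] x xy Pxy.
  by rewrite (wdist_eq0 xy); apply/conn0/Pxy; rewrite wdistxx; lia.
have [z [xz zy]] := wdist_step xy; apply: (@connS _ _ _ z).
- by apply: Pxy; rewrite wdistxx.
- lia.
- apply: IH => // w zw; apply: Pxy; have := wdist_triangle S z x w; lia.
Qed.

Lemma conn_map (P P' : G -> Prop) k n x y : (forall w, P w -> P' (k * w)) ->
  conn P n x y -> conn P' n (k * x) (k * y).
Proof.
move=> PP'; elim=> [{}x Px|{}n {}x u {}y Px xu _ IH]; first exact/conn0/PP'.
by apply: connS IH; [exact: PP'|rewrite wdistM].
Qed.

End WordGeometry.

(** A discrete intermediate value theorem; [t] need not be monotone. *)
Lemma crossing_index (t : nat -> nat) n m : t 0 <= m -> m < t n ->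
  exists2 i, i < n & t i <= m < t i.+1.
Proof.
elim: n => [|n IH] t0 tn; first lia.
case: (ltnP m (t n)) => h; last by exists n; rewrite ?h ?tn.
by have [i i_n im] := IH t0 h; exists i => //; lia.
Qed.

(** * Morse rays and divergence *)

Section DiscreteMorse.
Local Open Scope group_scope.
Context {G : groupType} (S : genset G).
Local Notation d := (wdist S).
Local Notation conn := (conn S).
Implicit Types (x y z : G) (q r : nat -> G) (P : G -> Prop).

(** The lower bound is multiplied out to stay within natural numbers; the domain [I] covers both
    segments and rays. *)
Definition quasi_isometric_on (I : nat -> Prop) (A : nat) q :=
  forall i j, I i -> I j -> (i <= j)%N ->
    (d (q i) (q j) <= A * (j - i) + A)%N /\
    (j - i <= A * d (q i) (q j) + A)%N.

Definition qgeod A n q := quasi_isometric_on (fun i => i <= n)%N A q.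
Definition qray A r := quasi_isometric_on (fun=> True) A r.

Definition ray r := r 0 = 1 /\ forall i j, (i <= j)%N -> d (r i) (r j) = (j - i)%N.

(** Endpoints need only lie within [A] of the ray, which makes the notion stable under bounded
    perturbations. *)
Definition morse (N : nat -> nat) r := forall A n q a b, qgeod A n q ->
  (d (q 0) (r a) <= A)%N -> (d (q n) (r b) <= A)%N ->
  forall i, (i <= n)%N -> exists t, (d (q i) (r t) <= N A)%N.

(* Superlinear divergence. One parameter L bounds both the length of the path,
   by L s, and the radius of the ball around r m that it avoids, by s/L. *)
Definition diverges (f : nat -> nat) r := forall L s a b m n,
  (f L <= s)%N -> (a + s <= m)%N -> (m + s <= b)%N -> (n <= L * s)%N ->
  ~ conn (fun w => (s < L * d w (r m))%N) n (r a) (r b).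

Lemma ray_qray r : ray r -> qray 1%N r.
Proof. by move=> [_ rr] i j _ _ ij; rewrite rr//; lia. Qed.

(** The parameters of points of [v] near [u 0], ..., [u n] lead from [a] to [b] with increases of at
    most [B * (2 * K + A) + B] per step, and one of these steps passes over [m]. *)
Lemma shadow I A B K n u v a b m : (forall i, (i < n)%N -> (d (u i) (u i.+1) <= A)%N) ->
  quasi_isometric_on I B v -> I a -> I b -> I m ->
  (forall i, (i <= n)%N -> exists2 t, I t & (d (u i) (v t) <= K)%N) ->
  (d (u 0) (v a) <= K)%N -> (d (u n) (v b) <= K)%N -> (a <= m <= b)%N ->
  exists2 i, (i <= n)%N &
    (d (u i) (v m) <= K + (B * (B * (2 * K + A) + B) + B))%N.
Proof.
move=> uA vB Ia Ib Im uv ua ub /andP[am].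
rewrite leq_eqVlt => /orP[/eqP->|mb]; first by exists n => //; lia.
have /choice[c cP] : forall i, exists t, (i <= n)%N -> I t /\ (d (u i) (v t) <= K)%N.
  move=> i; case: (leqP i n) => [/uv[t It ut]|ni]; first by exists t.
  by exists 0%N.
(* The values [a] and [b] are put before and after the chosen parameters, the endpoints of [u] being
   repeated, so that the crossing argument starts and stops at them. *)
pose t i := if i == 0%N then a else if (n.+1 < i)%N then b else c i.-1.
pose U i := u (minn i.-1 n).
have tP i : I (t i) /\ (d (U i) (v (t i)) <= K)%N.
  rewrite /t /U; case: eqP => [->|i0]; first by rewrite min0n.
  case: ltnP => ni; first by have -> : minn i.-1 n = n by lia.
  by have -> : minn i.-1 n = i.-1 by [lia]; apply: cP; lia.
have [||i _ im] := @crossing_index t n.+2 m; first exact: am.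
  by rewrite /t /= leqnn.
have [Ii Ui] := tP i; have [Ii1 Ui1] := tP i.+1.
exists (minn i.-1 n); first lia.
have UA : (d (U i) (U i.+1) <= A)%N.
  rewrite /U /=; have [ni|ni] : (n < i)%N \/ (i <= n)%N by lia.
    have -> : minn i.-1 n = n by lia.
    by have -> : minn i n = n by [lia]; rewrite wdistxx.
  case: i {im Ii Ui Ii1 Ui1} ni => [|i] i_n /=; first by rewrite !min0n wdistxx.
  have -> : minn i n = i by lia.
  by have -> : minn i.+1 n = i.+1 by [lia]; apply: uA.
have tt : (t i.+1 - t i <= B * (2 * K + A) + B)%N.
  have [] := vB (t i) (t i.+1) Ii Ii1; first lia.
  move=> _ /leq_trans; apply; rewrite leq_add2r leq_mul2l; apply/orP; right.
  have := wdist_triangle S (U i) (v (t i)) (v (t i.+1)).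
  have := wdist_triangle S (U i.+1) (U i) (v (t i.+1)).
  rewrite (wdistC S (v (t i)) (U i)); lia.
have vm : (d (v (t i)) (v m) <= B * (B * (2 * K + A) + B) + B)%N.
  have [] := vB (t i) m Ii Im; first lia.
  move=> /leq_trans + _; apply; rewrite leq_add2r leq_mul2l; apply/orP; right.
  lia.
have := wdist_triangle S (v (t i)) (U i) (v m); rewrite /U in Ui *; lia.
Qed.

Section WeightedPaths.
Context (wt : G -> nat) (K : nat).
Hypothesis wt_bounds : forall x, (0 < wt x <= K)%N.

Inductive wconn : nat -> G -> G -> Prop :=
| wconn0 x : wconn 0 x x
| wconnS c x y z : (d x y <= 1)%N -> wconn c y z -> wconn (wt x + c) x z.

Lemma wconn_cat c c' x y z : wconn c x y -> wconn c' y z -> wconn (c + c') x z.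
Proof.
by elim=> // {}c {}x u {}y xu _ IH /IH uz; rewrite -addnA; exact: wconnS uz.
Qed.

Lemma conn_wconn n x y : conn (fun=> True) n x y ->
  exists2 c, (c <= K * n)%N & wconn c x y.
Proof.
elim=> [{}x _|{}n {}x u {}y _ xu _ [c cn cP]]; first by exists 0%N => //; exact: wconn0.
exists (wt x + c)%N; last exact: wconnS cP.
by have := wt_bounds x; rewrite mulnS; lia.
Qed.

Definition wgeodesic c x y := wconn c x y /\ forall c', wconn c' x y -> (c <= c')%N.

Lemma wgeodesic_exists x y : exists c, wgeodesic c x y.
Proof.
have [c _ cP] := conn_wconn (@conn_geodesic _ S (fun=> True) x y (fun _ _ => I)).
have ex : exists c, `[< wconn c x y >] by exists c; exact/asboolP.
exists (ex_minn ex); case: ex_minnP => c' /asboolP c'P c'min; split => // c'' c''P.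
by apply: c'min; exact/asboolP.
Qed.

(** Here [e i] is the cost remaining from [f i]: it decreases strictly because weights are positive,
    and tails of minimal paths are minimal. *)
Lemma wgeodesic_path c x y : wgeodesic c x y -> exists n (f : nat -> G) (e : nat -> nat),
  [/\ f 0 = x, f n = y, e 0 = c,
      forall i, (i < n)%N -> (d (f i) (f i.+1) <= 1)%N /\ (e i.+1 < e i)%N &
      forall i, (i <= n)%N -> wgeodesic (e i) (f i) y].
Proof.
elim/ltn_ind: c x => c IH x cP; have [xy cmin] := cP.
case: xy IH cmin cP => [{}x|{}c {}x u {}y xu uy] IH cmin cP.
  by exists 0%N, (fun=> x), (fun=> 0%N); split.
have uP : wgeodesic c u y.
  split => // c' uc'; have := cmin _ (wconnS xu uc'); lia.
have [|n [f [e [f0 fn e0 fs fP]]]] := IH c _ u uP.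
  by have := wt_bounds x; lia.
exists n.+1, (fun i => if i is i'.+1 then f i' else x).
exists (fun i => if i is i'.+1 then e i' else (wt x + c)%N); split => //.
  move=> [|i] ni; last exact: fs.
  by rewrite f0 e0; split => //; have := wt_bounds x; lia.
by move=> [|i] // ni; apply: fP.
Qed.

Lemma coarse_lipschitz n q A : (forall i, (i < n)%N -> (d (q i) (q i.+1) <= A)%N) ->
  forall i j, (i <= j <= n)%N -> (d (q i) (q j) <= A * (j - i))%N.
Proof.
move=> qA i; elim=> [|j IH] ij.
  by have -> : i = 0%N by [lia]; rewrite wdistxx.
case: (eqVneq i j.+1) => [->|ne]; first by rewrite wdistxx.
have := IH ltac:(lia); have := qA j ltac:(lia).
have := wdist_triangle S (q j) (q i) (q j.+1).
have -> : (j.+1 - i = (j - i).+1)%N by lia.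
rewrite mulnS; lia.
Qed.

Lemma weighted_quasi_geodesic c x y : wconn c x y -> exists n q,
  [/\ q 0 = x, q n = y, qgeod K n q &
      forall i, (i <= n)%N -> exists2 c', (c' <= c)%N & wconn c' (q i) y].
Proof.
move=> xy; have [c0 c0P] := wgeodesic_exists x y.
have [n [q [e [q0 qn e0 qs qP]]]] := wgeodesic_path c0P.
have K0 : (0 < K)%N by have := wt_bounds x; lia.
have e_dec i j : (i <= j <= n)%N -> (j - i + e j <= e i)%N.
  elim: j => [|j IH] ij; first by have -> : i = 0%N by lia.
  case: (eqVneq i j.+1) => [->|ne]; first lia.
  have := IH ltac:(lia); have [_] := qs j ltac:(lia); lia.
exists n, q; split => //.
  move=> i j i_n jn ij; split.
    have h : (d (q i) (q j) <= 1 * (j - i))%N.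
      by apply: (@coarse_lipschitz n) => //; [move=> k /qs[]|lia].
    by rewrite mul1n in h; have := leq_pmull (j - i)%N K0; lia.
  have [c1 c1le c1P] :=
    conn_wconn (@conn_geodesic _ S (fun=> True) (q i) (q j) (fun _ _ => I)).
  have [jy _] := qP j jn; have [_ imin] := qP i i_n.
  have := imin _ (wconn_cat c1P jy).
  have := e_dec i j ltac:(lia); lia.
move=> i i_n; exists (e i); last by have [] := qP i i_n.
have := e_dec 0%N i ltac:(lia); have [_ /(_ _ xy)] := c0P; lia.
Qed.

End WeightedPaths.

(* A path minimising a length that counts the ball of radius s/L around r m
   with a large weight K is a K-quasi-geodesic; it avoids a smaller ball as
   soon as some path of length L s avoids the larger one. *)
Lemma morse_diverges B N : exists f, forall r, qray B r -> morse N r -> diverges f r.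
Proof.
(* A path that enters the ball of radius s/(2L) pays at least K s/(2L) to leave the ball of radius
   s/L, while its cost is at most L s; hence K just above 2 L^2. [D L] is the constant given by
   [shadow]. *)
pose K L := (2 * (L * L) + 1)%N; pose M L := (N (K L) + K L)%N.
pose D L := (M L + (B * (B * (2 * M L + 2 * K L) + B) + B))%N.
exists (fun L => 2 * L * D L + 1)%N => r rB rN L s a b m n fs am mb nL ab.
pose wt x := if (L * d x (r m) <= s)%N then K L else 1%N.
have wtP x : (0 < wt x <= K L)%N by rewrite /wt /K; case: ifP => _; lia.
have abc : wconn wt n (r a) (r b).
  elim: ab => [x _|n' x y z Px xy _ IH]; first exact: wconn0.
  rewrite (_ : n'.+1 = (wt x + n')%N); first by apply: wconnS IH.
  by rewrite /wt leqNgt Px.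
have [l [q [q0 ql qK qc]]] := weighted_quasi_geodesic wtP abc.
have far i : (i <= l)%N -> (s < 2 * L * d (q i) (r m))%N.
  move=> il; have [c cn cP] := qc i il; rewrite ltnNge; apply/negP => near.
  (* One step lowers the truncated difference by at most [L], and it costs [K L] as long as the
     difference is positive; at the end [r b] the difference is 0. *)
  have bound : (K L * (s - L * d (q i) (r m)) <= L * c)%N.
    have := conn_end ab; elim: cP => [x|c' x y z xy _ IH] zP.
      by have -> : (s - L * d x (r m) = 0)%N by [lia]; rewrite muln0.
    have := IH zP; rewrite /wt; case: (leqP _ s) => xs; last first.
      by have -> : (s - L * d x (r m) = 0)%N by [lia]; rewrite muln0.
    have h : (s - L * d x (r m) <= L + (s - L * d y (r m)))%N.
      have := wdist_triangle S x y (r m); rewrite (wdistC S y x).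
      have : (L * d y (r m) <= L * (d x (r m)).+1)%N ->
        (s - L * d x (r m) <= L + (s - L * d y (r m)))%N by rewrite mulnS; lia.
      by move=> hh tri; apply: hh; rewrite leq_mul2l; apply/orP; right; lia.
    have := leq_mul (leqnn (K L)) h; move: (K L) => k.
    rewrite !mulnDr (mulnC L k); lia.
  have h2 : (K L * s <= 2 * (L * c))%N.
    have := leq_mul (leqnn 2) bound; apply: leq_trans.
    rewrite mulnCA leq_mul2l; apply/orP; right; lia.
  have h3 : (2 * (L * c) <= 2 * (L * L) * s)%N.
    by rewrite -!mulnA !leq_mul2l (leq_trans cn)// !orbT.
  move: h2 h3; rewrite /K mulnDl mul1n; lia.
have [|||||i il] := @shadow (fun=> True) (2 * K L) B (M L) l q r a b m _ rB I I I.
- move=> i il; have [] := qK i i.+1 ltac:(lia) ltac:(lia) ltac:(lia); lia.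
- move=> i il; have [||t tP] := rN _ _ _ a b qK _ _ i il.
  + by rewrite q0 wdistxx.
  + by rewrite ql wdistxx.
  by exists t => //; rewrite /M; lia.
- by rewrite q0 wdistxx.
- by rewrite ql wdistxx.
- lia.
move=> near; have := far i il.
have := leq_mul (leqnn (2 * L)%N) near; rewrite -/(D L); lia.
Qed.


Lemma conn_along C n q P : (forall k, (k < n)%N -> (d (q k) (q k.+1) <= C)%N) ->
  (forall k, (k <= n)%N -> forall w, (d (q k) w <= C)%N -> P w) ->
  forall i j, (i <= j <= n)%N -> conn P (C * (j - i)) (q i) (q j).
Proof.
move=> qC qP i; elim=> [|j IH] ij.
  have -> : i = 0%N by lia.
  by rewrite subnn muln0; apply: conn0; apply: (qP 0%N); rewrite ?wdistxx.
case: (eqVneq i j.+1) => [->|ne].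
  by rewrite subnn muln0; apply: conn0; apply: (qP j.+1); rewrite ?wdistxx//; lia.
have -> : (C * (j.+1 - i) = C * (j - i) + C)%N.
  by rewrite addnC -mulnS; congr (_ * _)%N; lia.
apply: conn_cat (IH _) _; first lia.
have jC : (d (q j) (q j.+1) <= C)%N by apply: qC; lia.
apply: (conn_leq jC); apply: conn_geodesic => w h.
by apply: (qP j); lia.
Qed.

Lemma nat_argmax (e : nat -> nat) a b : (a <= b)%N ->
  exists2 m, (a <= m <= b)%N & forall m', (a <= m' <= b)%N -> (e m' <= e m)%N.
Proof.
move=> /subnKC <-; elim: (b - a)%N => [|n [m mb mP]].
  by exists a => [|m']; [lia|rewrite addn0 => h; have -> : m' = a by lia].
have [h|h] := leqP (e (a + n.+1)%N) (e m).
  exists m => [|m' m'b]; first lia.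
  by case: (eqVneq m' (a + n.+1)%N) => [->//|ne]; apply: mP; lia.
exists (a + n.+1)%N => [|m' m'b]; first lia.
case: (eqVneq m' (a + n.+1)%N) => [->//|ne].
by rewrite (leq_trans (mP m' _)) ?(ltnW h)//; lia.
Qed.

Lemma qray_sym B r i j : qray B r ->
  (d (r i) (r j) <= B * ((j - i) + (i - j)) + B)%N /\
  ((j - i) + (i - j) <= B * d (r i) (r j) + B)%N.
Proof.
move=> rB; case: (leqP i j) => ij.
  by have := rB i j I I ij; have -> : (i - j = 0)%N by [lia]; rewrite addn0.
have := rB j i I I (ltnW ij); rewrite wdistC.
by have -> : (j - i = 0)%N by lia.
Qed.

Lemma qray_gt0 B r : qray B r -> (0 < B)%N.
Proof. by case: B => // /(_ 0%N 1%N I I erefl) []. Qed.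

(** Let [m] be a time at which the ray is farthest from [q]. If this distance D is large, there is a
    bypass: leave the ray on either side of [m] at a distance comparable to D, jump to [q] and
    follow it. Its length is linear in D, against divergence. *)
Lemma diverges_close B f A : exists D0, forall r q n a b, qray B r ->
  diverges f r -> qgeod A n q -> (d (q 0) (r a) <= A)%N -> (d (q n) (r b) <= A)%N ->
  (a <= b)%N -> forall m, (a <= m <= b)%N ->
  exists2 i, (i <= n)%N & (d (q i) (r m) <= D0)%N.
Proof.
pose U := (8 * B + 2 * A + 2 * B * (8 * B * B + B) + B)%N.
pose L := (8 * B + 2 * A + 2 * A * (A * U + A) + 2)%N.
exists (2 * B * (f L + 2) + 4 * (A + B) + 1)%N => r q n a b rB rf qA qa qb ab.
have B0 := qray_gt0 rB.
have /choice[e eP] m : exists D, (exists2 i, (i <= n)%N & d (q i) (r m) = D) /\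
    forall j, (j <= n)%N -> (D <= d (q j) (r m))%N.
  have ex : exists D, `[< exists2 i, (i <= n)%N & d (q i) (r m) = D >].
    by exists (d (q 0) (r m)); apply/asboolP; exists 0%N.
  exists (ex_minn ex); case: ex_minnP => D /asboolP DP Dmin; split => // j jn.
  by apply: Dmin; apply/asboolP; exists j.
have [m mab mmax] := nat_argmax e ab.
suff De : (e m <= 2 * B * (f L + 2) + 4 * (A + B) + 1)%N.
  move=> m' m'ab; have [[i i_n ie] _] := eP m'; exists i => //.
  by rewrite ie (leq_trans (mmax _ m'ab)).
rewrite leqNgt; apply/negP => D0.
have [_ Dmin] := eP m; set D := e m in D0 Dmin mmax.
pose s := (D %/ (2 * B))%N; pose s' := (2 * B * D + B)%N.
have sD : (2 * B * s <= D)%N by rewrite mulnC leq_trunc_div.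
have Ds : (D < 2 * B * s.+1)%N by rewrite mulnC ltn_ceil//; lia.
have fs : (f L + 1 <= s)%N.
  rewrite /s leq_divRL; last lia.
  rewrite mulnC; move: D0; rewrite !mulnDr; lia.
have D4 : (D <= 4 * B * s)%N.
  have : (B * 1 <= B * s)%N by rewrite leq_mul2l; lia.
  move: Ds; rewrite mulnS; lia.
have Bs : (s <= B * s)%N by rewrite leq_pmull.
have L2 : (2 <= L)%N by rewrite /L; lia.
pose P w := (s < L * d w (r m))%N.
have Pfar w : (D <= d w (r m) + 2 * A)%N -> P w.
  move=> h; have : (2 * d w (r m) <= L * d w (r m))%N by rewrite leq_mul2r L2 orbT.
  rewrite /P; lia.
(* Meant for the pairs [(a, 0)] and [(b, n)]: the ray is left [s'] away from [m], unless its end at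
   time [c] comes first, which is near [q i0] by hypothesis. *)
have side c i0 : (i0 <= n)%N -> (a <= c <= b)%N -> (d (q i0) (r c) <= A)%N ->
    exists c' i, [/\ (i <= n)%N, (s <= (c' - m) + (m - c') <= s')%N,
      (c <= m)%N -> (c <= c' <= m)%N, (m <= c)%N -> (m <= c' <= c)%N &
      conn P (D + A) (r c') (q i)].
  move=> i0n cab ci0; case: (leqP s' ((c - m) + (m - c))) => h.
    pose c' := (if c <= m then m - s' else m + s')%N.
    have c'm : ((c' - m) + (m - c') = s')%N by rewrite /c'; case: leqP; lia.
    have c'c : ((c <= m -> c <= c' <= m) /\ (m <= c -> m <= c' <= c))%N.
      by rewrite /c'; case: leqP; lia.
    have [[i i_n ie] _] := eP c'.
    have iD : (d (r c') (q i) <= D)%N.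
      rewrite wdistC ie; apply: mmax; case: c'c; case: (leqP c m); lia.
    exists c', i; split => //; [|by case: c'c|by case: c'c|].
      rewrite c'm leqnn andbT /s'; have : (1 * D <= B * D)%N by rewrite leq_mul2r B0 orbT.
      lia.
    have [_] := qray_sym m c' rB; rewrite addnC addnC [X in (X <= _)%N]addnC.
    rewrite (_ : ((m - c') + (c' - m) = s')%N); last by rewrite -c'm addnC.
    rewrite /s' leq_add2r -mulnA mulnCA leq_pmul2l// wdistC => far.
    apply: (@conn_leq _ _ _ (d (r c') (q i))); first lia.
    apply: conn_geodesic => w w_geo; apply: Pfar.
    have := wdist_triangle S w (r c') (r m); lia.
  exists c, i0; split => //; try lia; last first.
    apply: (@conn_leq _ _ _ (d (r c) (q i0))); first by rewrite wdistC; lia.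
    apply: conn_geodesic => w w_geo; apply: Pfar.
    have := wdist_triangle S w (q i0) (r m); have := Dmin _ i0n.
    rewrite (wdistC S (q i0) w) (wdistC S (q i0) (r c)) in ci0 *; lia.
  apply/andP; split; last lia.
  have [+ _] := qray_sym c m rB => rc.
  have := wdist_triangle S (r c) (q i0) (r m); have := Dmin _ i0n => h1 h2.
  rewrite -(leq_pmul2l B0) addnC; lia.
have [a' [i [i_n sa a'm _ ai]]] := side a 0%N (leq0n _) ltac:(lia) qa.
have [b' [j [jn sb _ b'm bj]]] := side b n (leqnn _) ltac:(lia) qb.
have dij : (d (q i) (q j) <= s * U)%N.
  have h1 := conn_wdist ai; have h2 := conn_wdist bj.
  have [h3 _] := qray_sym a' b' rB.
  have := wdist_triangle S (r a') (q i) (q j); have := wdist_triangle S (r b') (r a') (q j).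
  rewrite (wdistC S (q i) (r a')) => h4 h5.
  have h6 : (B * ((b' - a') + (a' - b')) <= B * (2 * s'))%N.
    by rewrite leq_mul2l; apply/orP; right; lia.
  have h7 : (B * s' <= B * (2 * B * (4 * B * s) + B))%N.
    by rewrite leq_mul2l /s' leq_add2r leq_mul2l D4 !orbT.
  have h8 : (B * B * 1 <= B * B * s)%N by rewrite leq_mul2l; apply/orP; right; lia.
  have h9 : (A * 1 <= A * s)%N by rewrite leq_mul2l; apply/orP; right; lia.
  rewrite /U; lia.
have step k : (k < n)%N -> (d (q k) (q k.+1) <= 2 * A)%N.
  by move=> kn; have [] := qA k k.+1 ltac:(lia) ltac:(lia) ltac:(lia); lia.
have qP k : (k <= n)%N -> forall w, (d (q k) w <= 2 * A)%N -> P w.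
  move=> kn w qw; apply: Pfar; have := Dmin _ kn.
  have := wdist_triangle S w (q k) (r m); lia.
have mid : conn P (2 * A * (A * (s * U) + A)) (q i) (q j).
  case: (leqP i j) => ij; last apply: conn_sym.
    apply: (@conn_leq _ _ _ (2 * A * (j - i))); last by apply: (conn_along step qP); lia.
    rewrite leq_mul2l; apply/orP; right; have [_] := qA i j i_n jn ij.
    by move=> /leq_trans; apply; rewrite leq_add2r leq_mul2l dij orbT.
  apply: (@conn_leq _ _ _ (2 * A * (i - j))); last by apply: (conn_along step qP); lia.
  rewrite leq_mul2l; apply/orP; right; have [_] := qA j i jn i_n (ltnW ij).
  move=> /leq_trans; apply; rewrite leq_add2r leq_mul2l wdistC dij orbT//.
have := conn_cat ai (conn_cat mid (conn_sym bj)).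
apply: (rf L s); [lia|lia|lia|].
have h9 : (A * 1 <= A * s)%N by rewrite leq_mul2l; apply/orP; right; lia.
have h10 : (A * A * 1 <= A * A * s)%N by rewrite leq_mul2l; apply/orP; right; lia.
rewrite /L; lia.
Qed.

(** [diverges_close] puts a segment of the ray near [q]; [shadow], with the ray as the path that
    moves along [q], turns this into every point of [q] being near the ray. *)
Lemma diverges_morse B f : exists N, forall r, qray B r -> diverges f r -> morse N r.
Proof.
have /choice[D DP] := diverges_close B f.
pose E A := (D A + A)%N.
exists (fun A => E A + (A * (A * (2 * E A + 2 * B) + A) + A))%N.
move=> r rB rf; suff main A n q a b : qgeod A n q -> (d (q 0) (r a) <= A)%N ->
    (d (q n) (r b) <= A)%N -> (a <= b)%N -> forall i, (i <= n)%N ->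
    exists t, (d (q i) (r t) <= E A + (A * (A * (2 * E A + 2 * B) + A) + A))%N.
  move=> A n q a b qA qa qb i i_n; case: (leqP a b) => ab; first exact: (main A n q a b qA qa qb ab i i_n).
  pose q' i := q (n - i)%N.
  have [||||t] := main A n q' b a _ _ _ (ltnW ab) (n - i)%N.
  - move=> j k jn kn jk; have := qA (n - k)%N (n - j)%N ltac:(lia) ltac:(lia) ltac:(lia).
    by rewrite wdistC /q'; have -> : (n - j - (n - k) = k - j)%N by lia.
  - by rewrite /q' subn0.
  - by rewrite /q' subnn.
  - lia.
  by rewrite /q' subKn// => tP; exists t.
move=> qA qa qb ab i i_n.
have [||||||||t _ tP] := @shadow (fun i => i <= n)%N (2 * B) A (E A) (b - a) (fun i => r (a + i)%N) q 0%N n i _ qA.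
- move=> k kb; have [] := rB (a + k)%N (a + k.+1)%N I I ltac:(lia).
  have -> : (a + k.+1 - (a + k) = 1)%N by lia.
  lia.
- by [].
- by [].
- by [].
- move=> k kb; have [j jn jP] := DP A r q n a b rB rf qA qa qb ab (a + k)%N ltac:(lia).
  by exists j => //; rewrite wdistC /E; lia.
- by rewrite addn0 wdistC /E; lia.
- by rewrite subnKC// wdistC /E; lia.
- lia.
by exists (a + t)%N; rewrite wdistC.
Qed.

End DiscreteMorse.

(** * Limits of geodesics and straightening of Morse quasi-geodesics *)

Lemma eventual_ultrafilter : exists w : set_system nat,
  UltraFilter w /\ forall n0, w [set n | (n0 <= n)%N].
Proof.
have [w [wU ow]] := @ultraFilterLemma nat \oo _.
by exists w; split => // n0; apply: ow; exists n0.
Qed.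

Lemma ultra_pigeonhole (I : Type) (T : eqType) (w : set_system I) (f : I -> T)
    (s : seq T) : UltraFilter w -> w [set i | f i \in s] ->
  exists2 x, x \in s & w [set i | f i = x].
Proof.
move=> wU; elim: s => [|x s IH] ws.
  by case: (@filter_not_empty _ w _); apply: filterS ws.
have [wx|wx] := in_ultra_setVsetC [set i | f i = x] wU.
  by exists x => //; exact: mem_head.
have [|y ys wy] := IH.
  apply: filterS2 ws wx => i /=; rewrite inE => /orP[/eqP//|//].
by exists y => //; rewrite inE ys orbT.
Qed.

Section Straighten.
Local Open Scope group_scope.
Context {G : groupType} (S : genset G).
Local Notation d := (wdist S).
Implicit Types (x y z : G) (q r : nat -> G).

(** The limit is taken coordinatewise along an ultrafilter, each coordinate ranging over a finite
    ball. *)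
Lemma konig (g : nat -> nat -> G) : (forall n i, (d 1 (g n i) <= i)%N) ->
  exists r, forall m n0, exists2 n, (n0 <= n)%N & forall i, (i <= m)%N -> g n i = r i.
Proof.
move=> gb; have [w [wU wn]] := eventual_ultrafilter.
have /choice[r rP] i : exists x, w [set n | g n i = x].
  have [s sP] := finite_ball S i.
  have [|x _ xP] := @ultra_pigeonhole _ _ w (g ^~ i) s wU; last by exists x.
  by apply: filterS (wn 0%N) => n _ /=; exact/sP/gb.
exists r => m n0.
have wm : w [set n | forall i, (i <= m)%N -> g n i = r i].
  elim: m => [|m IH].
    by apply: filterS (rP 0%N) => n /= gr i; rewrite leqn0 => /eqP ->.
  apply: filterS2 IH (rP m.+1) => n /= h h' i; rewrite leq_eqVlt => /orP[/eqP->//|].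
  by rewrite ltnS; exact: h.
by have [n [n0n nP]] := filter_ex (filterI (wn n0) wm); exists n.
Qed.

Definition close_to K (u v : nat -> G) := (forall i, exists j, (d (u i) (v j) <= K)%N) /\
  forall j, exists i, (d (u i) (v j) <= K)%N.

Lemma close_to_sym K u v : close_to K u v -> close_to K v u.
Proof.
move=> [uv vu]; split => i.
  by have [j] := vu i; rewrite wdistC; exists j.
by have [j] := uv i; rewrite wdistC; exists j.
Qed.

Lemma close_to_trans K L u v t : close_to K u v -> close_to L v t -> close_to (K + L) u t.
Proof.
move=> [uv vu] [vt tv]; split => i.
  have [j ij] := uv i; have [k jk] := vt j; exists k.
  have := wdist_triangle S (v j) (u i) (t k); lia.
have [j ij] := tv i; have [k jk] := vu j; exists k.
have := wdist_triangle S (v j) (u k) (t i); lia.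
Qed.

Lemma quasi_isometric_on_le I A B q : (A <= B)%N -> quasi_isometric_on S I A q ->
  quasi_isometric_on S I B q.
Proof.
move=> AB qA i j Ii Ij ij; have [h1 h2] := qA i j Ii Ij ij.
split; [apply: (leq_trans h1)|apply: (leq_trans h2)].
  by rewrite leq_add// leq_mul2r AB orbT.
by rewrite leq_add// leq_mul2r AB orbT.
Qed.

Lemma morse_close K N u v : close_to K u v -> morse S N u ->
  morse S (fun A => N (A + K) + K)%N v.
Proof.
move=> [uv vu] uN A n q a b qA qa qb i i_n.
have [a' a'P] := vu a; have [b' b'P] := vu b.
have [|||t tP] := uN (A + K)%N n q a' b' _ _ _ i i_n.
- exact: quasi_isometric_on_le (leq_addr _ _) qA.
- have := wdist_triangle S (v a) (q 0%N) (u a'); rewrite (wdistC S (v a)); lia.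
- have := wdist_triangle S (v b) (q n) (u b'); rewrite (wdistC S (v b)); lia.
have [j jP] := uv t; exists j; have := wdist_triangle S (u t) (q i) (v j); lia.
Qed.

Lemma ray_dist1 r i : ray S r -> d 1 (r i) = i.
Proof. by move=> [r0 rr]; rewrite -r0 rr// subn0. Qed.

Lemma ray_qgeod r n : ray S r -> qgeod S 1%N n r.
Proof. by move=> [_ rr] i j _ _ ij; rewrite rr//; lia. Qed.

(** The point [r' i] is close to some [r t], and since both rays start at 1, [t] differs from [i] by
    at most that distance; hence the factor 2. *)
Lemma fellow_travel N K r r' a b : ray S r -> ray S r' -> morse S N r ->
  (d (r a) (r' b) <= K)%N ->
  forall i, (i <= b)%N -> (d (r i) (r' i) <= 2 * N (K + 1))%N.
Proof.
move=> rr rr' rN ab i ib.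
have [|||t tP] := rN (K + 1)%N b r' 0%N a _ _ _ i ib.
- refine (quasi_isometric_on_le _ (ray_qgeod rr')); lia.
- by case: rr rr' => [-> _] [-> _]; rewrite wdistxx.
- by rewrite wdistC; lia.
have ti := ray_dist1 t rr; have ii := ray_dist1 i rr'.
have [h|h] := leqP i t.
  have ritt : d (r i) (r t) = (t - i)%N by case: rr => _ ->.
  have := wdist_triangle S (r t) (r i) (r' i); rewrite (wdistC S (r t)).
  have := wdist_triangle S (r' i) 1 (r t); lia.
have ritt : d (r t) (r i) = (i - t)%N by case: rr => _ -> //; exact: ltnW.
have := wdist_triangle S (r t) (r i) (r' i); rewrite (wdistC S (r t)) (wdistC S (r i)).
have := wdist_triangle S (r t) 1 (r' i); rewrite (wdistC S (r t) (r' i)) (wdistC S (r t) (r i)) in ritt *; lia.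
Qed.

(** The ray is a limit of geodesics from 1 to [u n]: the Morse property keeps these near [u], and
    [shadow] brings all of [u] near them. *)
Lemma straighten A N : exists K, forall u, qray S A u -> (d 1 (u 0%N) <= A)%N ->
  morse S N u -> exists2 r, ray S r & close_to K u r.
Proof.
pose K0 := (N (A + 1) + A + 1)%N.
pose K := (K0 + (A * (A * (2 * K0 + 1) + A) + A))%N.
exists (K + K0)%N => u uA u0 uN.
have /choice[f fP] n := geodesic_segment S 1 (u n).
pose l n := d 1 (u n).
have lP n : (n <= A * (l n + A) + A)%N.
  have [] := uA 0%N n I I (leq0n _) => _; rewrite subn0 => /leq_trans; apply.
  rewrite leq_add2r leq_mul2l; apply/orP; right.
  have := wdist_triangle S 1 (u 0%N) (u n); rewrite (wdistC S _ 1) -/(l n); lia.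
have l_big m n : (A * (m + A) + A < n)%N -> (m < l n)%N.
  move=> mn; rewrite ltnNge; apply/negP => lm; have := lP n.
  have : (A * (l n + A) <= A * (m + A))%N by rewrite leq_mul2l leq_add2r lm orbT.
  lia.
have f1 n i : (i <= l n)%N -> d 1 (f n i) = i.
  by have [f0 _ fg] := fP n => il; rewrite -{1}f0 fg// subn0.
have fq n : qgeod S (A + 1)%N (l n) (f n).
  have [_ _ fg] := fP n; apply: (@quasi_isometric_on_le _ 1%N); first lia.
  by move=> i j il jl ij; rewrite fg -/(l n); [lia|rewrite ij jl].
(* Past its end a geodesic is prolonged by its last vertex; by [l_big] this is invisible on a given
   range once [n] is large. *)
have [|r rP] := @konig (fun n i => f n (minn i (l n))).
  by move=> n i; rewrite f1; lia.
have r_near m : exists t, (d (u t) (r m) <= K0)%N.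
  have [n n0 nP] := rP m (A * (m + A) + A).+1.
  have ml := l_big _ _ n0; rewrite -nP// (_ : minn m (l n) = m); last lia.
  have [f0 fn fg] := fP n.
  have [|||t tP] := uN (A + 1)%N (l n) (f n) 0%N n _ _ _ m (ltnW ml).
  - exact: fq.
  - by rewrite f0; lia.
  - by rewrite fn wdistxx.
  by exists t; rewrite wdistC /K0; lia.
exists r; last first.
  split => [k|j]; last first.
    by have [i iP] := r_near j; exists i; lia.
  have [n n0 nP] := rP (K + d 1 (u k))%N (k + (A * (0 + A) + A).+1)%N.
  have [f0 fn fg] := fP n.
  have [|||||i il iP] := @shadow _ S (fun=> True) 1%N A K0 (l n) (f n) u 0%N n k _ uA I I I.
  - by move=> i il; rewrite fg//; rewrite -/(l n); lia.
  - move=> i il; have [|||t tP] := uN (A + 1)%N (l n) (f n) 0%N n _ _ _ i il.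
    + exact: fq.
    + by rewrite f0; lia.
    + by rewrite fn wdistxx.
    by exists t => //; rewrite /K0; lia.
  - by rewrite f0 /K0; lia.
  - by rewrite fn wdistxx.
  - lia.
  have iK : (i <= K + d 1 (u k))%N.
    rewrite -{1}(f1 n i il); have := wdist_triangle S (u k) 1 (f n i).
    rewrite (wdistC S (u k) (f n i)) /K; lia.
  exists i; rewrite -nP// (_ : minn i (l n) = i); last lia.
  by rewrite wdistC; rewrite /K; lia.
split.
  have [n _ nP] := rP 0%N 0%N; rewrite -nP// min0n; by have [] := fP n.
move=> i j ij; have [n n0 nP] := rP j (A * (j + A) + A).+1.
have jl := l_big _ _ n0; have [_ _ fg] := fP n.
rewrite -!nP// (_ : minn i (l n) = i); last lia.
by rewrite (_ : minn j (l n) = j); [rewrite fg// -/(l n); lia|lia].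
Qed.

End Straighten.

(** * Detours in relatively wide pairs *)

Section AsymptoticCones.
Local Open Scope ring_scope.
Local Open Scope quotient_scope.

Lemma mdist_pi (R : realType) (T : choiceType) (d : pseudodist R T) (a b : T) :
  mdist (\pi_(metric_quotient d) a) (\pi_(metric_quotient d) b) = d a b.
Proof.
have h c : d (repr (\pi_(metric_quotient d) c)) c = 0.
  apply/eqP; rewrite -[_ == _]/(pdist0 d _ _); apply/(@eqquotP _ _ (metric_quotient d)).
  exact: reprK.
rewrite /mdist /= /mqdist.
set a' := repr _; set b' := repr _.
have ha := h a; have hb := h b; rewrite -/a' -/b' in ha hb.
have := pdist_triangle d a a' b'; have := pdist_triangle d b a b'.
have := pdist_triangle d a' a b; have := pdist_triangle d b' a' b.
rewrite (pdistC d b b') (pdistC d a a'); lra.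
Qed.

Lemma cone_pi_neq (R : realType) (X : metricType R) (D : cone_data X) (t t' : cone_seq D) :
  0 < cone_dist t t' -> \pi_(metric_quotient (cone_pseudodist D)) t <>
  \pi_(metric_quotient (cone_pseudodist D)) t'.
Proof.
move=> tt' e; move: tt'; rewrite -[cone_dist t t']/(cone_pseudodist D t t').
by rewrite -mdist_pi e mdistxx ltxx.
Qed.

Section WideDetour.
Context {R : realType} {K : groupType} (S : genset K).
Local Notation d := (wdist S).
Context (w : set_system nat) {wU : UltraFilter w}.
Hypothesis w_tail : forall n0, w [set n | (n0 <= n)%N].
Context (s : nat -> nat) (u z : nat -> K).
Hypothesis s_ge : forall n, (n < s n)%N.

Lemma tail_nonprincipal n : ~ w [set n].
Proof.
move=> wn; have [m [/= -> ]] := filter_ex (filterI wn (w_tail n.+1)).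
by rewrite /= ltnn.
Qed.

Lemma scale_gt0 n : 0 < (s n)%:R :> R.
Proof. by rewrite ltr0n; apply: leq_ltn_trans (s_ge n). Qed.

Lemma scale_pinfty : (s n)%:R @[n --> w] --> (+oo : set_system R).
Proof.
apply/cvgryPge => A; near=> n.
have nA : (Num.truncn A < n)%N by near: n; exact: w_tail.
apply: (@le_trans _ _ (Num.truncn A).+1%:R); first exact/ltW/truncnS_gt.
by rewrite ler_nat (leq_trans nA)// ltnW.
Unshelve. all: by end_near. Qed.

Let D : cone_data (word_space R S) :=
  @ConeData R (word_space R S) w wU tail_nonprincipal u (fun n => (s n)%:R)
    scale_gt0 scale_pinfty.

Let near_base M f := \forall n \near w, (d (u n) (f n) <= M * s n)%N.

Lemma cone_seq_subproof M f : near_base M f ->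
  `[< exists B : R, \forall n \near w, mdist (f n : word_space R S) (u n) / (s n)%:R <= B >].
Proof.
move=> fM; apply/asboolP; exists M%:R; apply: filterS fM => n nM.
rewrite ler_pdivrMr ?scale_gt0// -natrM [mdist _ _]/((wdist S _ _)%:R) ler_nat.
by rewrite wdistC.
Qed.

Definition cone_point M f (h : near_base M f) : cone_seq D :=
  exist _ f (cone_seq_subproof h).

(** One [M] controls the length of the paths and, inversely, the radius of the balls that they
    avoid; it may depend on [t] but not on [n]. *)
Definition linked (t : cone_seq D) := exists M, \forall n \near w,
  conn S (fun v => s n <= M * d v (z n))%N (M * s n) (u n) (val t n).

Lemma cone_near (a b : cone_seq D) e : cone_dist a b < e ->
  \forall n \near w, (d (val a n) (val b n))%:R < e * (s n)%:R.
Proof.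
move=> abe; have := @cvgr_lt R nat w _ _ _ (@cone_dist_cvg _ _ D a b) e abe => h; near=> n.
by rewrite -ltr_pdivrMr ?scale_gt0//; near: n; exact: h.
Unshelve. all: by end_near. Qed.

Lemma cone_far (a b : cone_seq D) e : e < cone_dist a b ->
  \forall n \near w, e * (s n)%:R < (d (val a n) (val b n))%:R.
Proof.
move=> abe; have := @cvgr_gt R nat w _ _ _ (@cone_dist_cvg _ _ D a b) e abe => h; near=> n.
by rewrite -ltr_pdivlMr ?scale_gt0//; near: n; exact: h.
Unshelve. all: by end_near. Qed.

(** At scale [s], a geodesic from [t] to [t'] is shorter than e/3 and starts more than 2e/3 away
    from [z], so it stays e/3 away from [z]. *)
Lemma linked_step (M : nat) (z_near : near_base M z) (t t' : cone_seq D) :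
  3 * cone_dist t t' < cone_dist t (cone_point z_near) -> linked t -> linked t'.
Proof.
set e := cone_dist t (cone_point z_near) => tt' [N tN].
have e0 : 0 < e by apply: le_lt_trans tt'; apply: mulr_ge0 => //; exact: (pdist_ge0 (cone_pseudodist D) t t').
have [B eB] : exists B : nat, e < B%:R by exists (Num.truncn e).+1; exact: truncnS_gt.
have [C eC] : exists C : nat, 3 / e < C%:R.
  by exists (Num.truncn (3 / e)).+1; exact: truncnS_gt.
exists (N + N + B + C)%N.
near=> n.
have near_path : conn S (fun v => s n <= N * d v (z n))%N (N * s n) (u n) (val t n).
  by near: n.
have tt'n : (d (val t n) (val t' n))%:R < e / 3 * (s n)%:R.
  by near: n; apply: (@cone_near t t'); rewrite ltr_pdivlMr// mulrC.
have tz : 2 * e / 3 * (s n)%:R < (d (val t n) (z n))%:R.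
  near: n; apply: (@cone_far t (cone_point z_near)); rewrite -/e; lra.
have s0 := scale_gt0 n.
have path2 : conn S (fun v => s n <= C * d v (z n))%N (B * s n) (val t n) (val t' n).
  apply: (@conn_leq _ _ _ (d (val t n) (val t' n))).
    rewrite -(ler_nat R) natrM ltW// (lt_trans tt'n)// ltr_pM2r//; move: (e0) (eB); clear; lra.
  apply: conn_geodesic => v v_geo.
  have h1 : (d (val t n) (z n) <= d (val t n) (val t' n) + d v (z n))%N.
    by have := wdist_triangle S v (val t n) (z n); move: v_geo; clear; lia.
  rewrite -(ler_nat R) natrM; rewrite -(ler_nat R) natrD in h1.
  have h2 : e / 3 * (s n)%:R <= (d v (z n))%:R by move: tz tt'n h1; clear; lra.
  have h3 : (3 / e) * (e / 3 * (s n)%:R) = (s n)%:R :> R.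
    by rewrite mulrA (mulrA _ e) divfK ?(lt0r_neq0 e0)// mulfV// mul1r.
  rewrite -[leLHS]h3 ler_pM//; [by rewrite divr_ge0// ltW| |exact: ltW].
  by rewrite mulr_ge0 ?divr_ge0// ltW.
apply: (@conn_leq _ _ _ (N * s n + B * s n)); first by rewrite -mulnDl leq_mul2r; apply/orP; right; clear; lia.
apply: conn_cat; [apply: conn_sub near_path|apply: conn_sub path2] => v;
  by move=> /leq_trans; apply; rewrite leq_mul2r; apply/orP; right; clear; lia.
Unshelve. all: by end_near. Qed.

(* Being linked to the base point is open and closed in the complement of z. *)
Lemma component_linked (M : nat) (z_near : near_base M z) (a b : cone_seq D) :
  let pi : cone_seq D -> asymptotic_cone D :=
    fun t => \pi_(metric_quotient (cone_pseudodist D)) t in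
  connected_component (~` [set pi (cone_point z_near)]) (pi a) (pi b) ->
  linked a -> linked b.
Proof.
move=> pi; set Z := pi _; move=> [B [Ba BZ Bconn] Bb] al.
have dist_pi t t' : mdist (pi t) (pi t') = cone_dist t t' by exact: mdist_pi.
have piK y : pi (repr y) = y by exact: reprK.
have Z_gt0 v : v <> Z -> 0 < mdist v Z.
  by move=> vZ; rewrite mdist_gt0; apply/eqP.
have link v v' : 3 * mdist v v' < mdist v Z -> linked (repr v) -> linked (repr v').
  rewrite -{1 2}(piK v) -{1}(piK v') !dist_pi; exact: linked_step.
(* Being linked is a property of sequences; away from [Z] it does not depend on the representative
   of a point. *)
have link_repr t : pi t <> Z -> linked t <-> linked (repr (pi t)).
  move=> /Z_gt0 tZ; have tr : cone_dist t (repr (pi t)) = 0.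
    by rewrite -dist_pi piK mdistxx.
  split; apply: (linked_step (z_near := z_near)).
    by rewrite tr mulr0 -dist_pi.
  rewrite (_ : cone_dist _ t = 0) ?mulr0; first by rewrite -dist_pi piK.
  by rewrite -dist_pi piK mdistxx.
pose V := [set v | v <> Z /\ linked (repr v)].
pose W := [set v | v <> Z /\ ~ linked (repr v)].
(* The factor 6 gives the hypothesis of [link] with [v] and [v'] exchanged, which is what makes [W]
   open. *)
have far v v' : v <> Z -> 6 * mdist v v' < mdist v Z ->
    v' <> Z /\ 3 * mdist v' v < mdist v' Z.
  move=> vZ vv'; have := metric_triangle v v' Z; rewrite (metric_sym v' v).
  have := mdist_ge0 v v'; have := Z_gt0 _ vZ => {vZ} h0 h1 h2.
  split; last first.
    by move: h0 h1 h2 vv'; move: (mdist v v') (mdist v' Z) (mdist v Z) => k l m; lra.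
  by move=> v'Z; move: h2 vv' h1; rewrite v'Z mdistxx {v'Z} => *; lra.
have op (Q : set (asymptotic_cone D)) : (forall v v', v <> Z -> Q v ->
    6 * mdist v v' < mdist v Z -> Q v') -> open [set v | v <> Z /\ Q v].
  move=> QP; rewrite openE => v [vZ Qv]; rewrite /interior nbhs_ballP.
  exists (mdist v Z / 6) => /=; first by rewrite divr_gt0// Z_gt0.
  rewrite ballEmdist => v' /= vv'.
  have vv6 : 6 * mdist v v' < mdist v Z by lra.
  by split; [have [] := far _ _ vZ vv6|exact: QP vv6].
have oV : open V.
  apply: op => v v' vZ vl vv'; apply: (link _ _ _ vl).
  by have h := mdist_ge0 v v'; rewrite -/Z; clear vZ vl; lra.
have oW : open W.
  apply: op => v v' vZ vl vv' v'l; apply: vl; apply: (link _ _ _ v'l).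
  by have [] := far _ _ vZ vv'.
have BV : B `&` V = B.
  apply: Bconn.
  - have aZ : pi a <> Z by exact: BZ.
    by exists (pi a); split => //; split => //; apply/(link_repr _ aZ).
  - by exists V.
  - exists (~` W); first exact: open_closedC.
    apply/seteqP; split => v [Bv h]; split => //.
      by case: h => _ vl []//.
    by split; [exact: BZ|apply: contrapT => vl; apply: h; split => //; exact: BZ].
by move: Bb; rewrite -BV => -[/BZ bZ [_ bl]]; apply/(link_repr _ bZ).
Qed.

End WideDetour.

(** Counterexamples to larger and larger constants define a cone with base points [u n] and scales
    [s n], in which the class of [z] separates those of [u] and [u']. The condition [L' <= s] makes
    the scales tend to infinity. *)
Lemma wide_detour (R : realType) (K : groupType) (S : genset K) (H : set K) :
  relatively_wide R H -> forall L, exists L', forall s u u' z, (L' <= s)%N ->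
  H u -> H u' -> (wdist S u u' <= L * s)%N -> (s <= L * wdist S z u)%N ->
  (s <= L * wdist S z u')%N ->
  conn S (fun v => s <= L' * wdist S v z)%N (L' * s) u u'.
Proof.
move=> wideH L; apply: contrapT => no.
have [w [wU w_tail]] := eventual_ultrafilter.
have /choice[F FP] n : exists t : nat * K * K * K, let: (s, u, u', z) := t in
    [/\ (n + L.+1 <= s)%N, H u /\ H u', (wdist S u u' <= L * s)%N,
        (s <= L * wdist S z u)%N /\ (s <= L * wdist S z u')%N &
        ~ conn S (fun v => s <= (n + L.+1) * wdist S v z)%N ((n + L.+1) * s) u u'].
  apply: contrapT => h; apply: no; exists (n + L.+1)%N => s u u' z Ls Hu Hu' uu' zu zu'.
  by apply: contrapT => nc; apply: h; exists (s, u, u', z).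
pose s n := (F n).1.1.1; pose u n := (F n).1.1.2; pose u' n := (F n).1.2.
pose z n := (F n).2.
have P n : [/\ (n + L.+1 <= s n)%N, H (u n) /\ H (u' n), (wdist S (u n) (u' n) <= L * s n)%N,
        (s n <= L * wdist S (z n) (u n))%N /\ (s n <= L * wdist S (z n) (u' n))%N &
        ~ conn S (fun v => s n <= (n + L.+1) * wdist S v (z n))%N ((n + L.+1) * s n) (u n) (u' n)].
  by have := FP n; rewrite /s /u /u' /z; case: (F n) => [[[? ?] ?] ?].
have s_ge n : (n < s n)%N by have [] := P n; lia.
have u_near : \forall n \near w, (wdist S (u n) (u n) <= 0 * s n)%N.
  by near=> n; rewrite wdistxx.
have u'_near : \forall n \near w, (wdist S (u n) (u' n) <= L * s n)%N.
  by near=> n; have [] := P n.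
(* If [z n] were farther away, a geodesic from [u n] to [u' n] would already be a detour; hence [z]
   defines a point of the cone. *)
have z_near : \forall n \near w, (wdist S (u n) (z n) <= L.+1 * s n)%N.
  near=> n; rewrite leqNgt; apply/negP => far; have [_ _ uu' _] := P n; apply.
  apply: (@conn_leq _ _ _ (wdist S (u n) (u' n))).
    by rewrite (leq_trans uu')// leq_mul2r; lia.
  apply: conn_geodesic => v v_geo.
  have h : (s n <= wdist S v (z n))%N.
    have := wdist_triangle S v (u n) (z n); lia.
  by rewrite (leq_trans h)// leq_pmull//; lia.
have cone_ne (M M' : nat) (t : nat -> K)
    (t_near : \forall n \near w, (wdist S (u n) (t n) <= M * s n)%N) :
    (forall n, s n <= L * wdist S (z n) (t n))%N ->
    0 < cone_dist (cone_point (R := R) (wU := wU) w_tail s_ge t_near) (cone_point (wU := wU) w_tail s_ge z_near).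
  move=> tz; rewrite lt_neqAle (pdist_ge0 (cone_pseudodist _)) andbT.
  apply/eqP => d0.
  have L0 : 0 < (2 * L.+1%:R)^-1 :> R by rewrite invr_gt0 mulr_gt0.
  rewrite d0 in L0; have near_tz := cone_near L0.
  have [n /=] := @filter_ex _ w _ _ near_tz; apply/negP; rewrite -leNgt.
  have s0 := scale_gt0 (R := R) s_ge n.
  have : (s n)%:R <= L.+1%:R * (wdist S (t n) (z n))%:R :> R.
    by rewrite -natrM ler_nat wdistC (leq_trans (tz n))// leq_mul2r leqnSn orbT.
  rewrite invfM mulrAC -ler_pdivrMl// => /(le_trans _); apply.
  by rewrite mulrC ler_pM2l ?invr_gt0// ler_piMl// ?invf_le1 ?ler1n//; lra.
have tu n : (s n <= L * wdist S (z n) (u n))%N by have [_ _ _ []] := P n.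
have tu' n : (s n <= L * wdist S (z n) (u' n))%N by have [_ _ _ []] := P n.
pose a := cone_point (R := R) (wU := wU) w_tail s_ge u_near.
pose b := cone_point (R := R) (wU := wU) w_tail s_ge u'_near.
pose c := cone_point (R := R) (wU := wU) w_tail s_ge z_near.
have ac : 0 < cone_dist a c by exact: cone_ne.
have bc : 0 < cone_dist b c by exact: cone_ne.
have al : linked z a.
  exists L; near=> n; apply: (@conn_leq _ _ _ 0%N) => //; apply: conn0.
  by rewrite wdistC.
have : linked z b.
  apply: (component_linked (z_near := z_near) _ al); apply: contrapT => sep.
  apply: (wideH S _ _ _ (\pi_(metric_quotient (cone_pseudodist _)) c)).
  - by exists a => // n; have [_ []] := P n.
  - by exists b => // n; have [_ []] := P n.
  - by split; [exact: (cone_pi_neq ac)|exact: (cone_pi_neq bc)|exact: sep].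
move=> [M Mb]; have [n [/= Mn nb]] := filter_ex (filterI (w_tail M) Mb).
have [_ _ _ _] := P n; apply.
apply: (@conn_leq _ _ _ (M * s n)); first by rewrite leq_mul2r; lia.
apply: conn_sub nb => v /leq_trans; apply; rewrite leq_mul2r; lia.
Unshelve. all: by end_near. Qed.

End AsymptoticCones.

(** * Trees and vertex groups *)

Lemma seq_bound (I : eqType) (s : seq I) (Q : I -> nat -> Prop) :
  (forall i m n, m <= n -> Q i m -> Q i n) ->
  (forall i, i \in s -> exists n, Q i n) -> exists n, forall i, i \in s -> Q i n.
Proof.
move=> Qle; elim: s => [|i s IH] Qs; first by exists 0.
have [m mP] := Qs i (mem_head _ _).
have [|n nP] := IH; first by move=> j js; apply: Qs; rewrite inE js orbT.
exists (m + n) => j; rewrite inE => /orP[/eqP->|js].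
  by apply: Qle mP; rewrite leq_addr.
by apply: Qle (nP _ js); rewrite leq_addl.
Qed.

Section Homomorphisms.
Local Open Scope group_scope.


Lemma morph1 (H G : groupType) (f : H -> G) : {morph f : x y / x * y} -> f 1 = 1.
Proof. by move=> fM; apply: (mulgI (f 1)); rewrite -fM !mulg1. Qed.

Lemma morphV (H G : groupType) (f : H -> G) : {morph f : x y / x * y} ->
  {morph f : x / x^-1}.
Proof.
by move=> fM x; apply: (mulgI (f x)); rewrite -fM !mulgV (morph1 fM).
Qed.

Lemma hom_lipschitz (H G : groupType) (T : genset H) (S : genset G) (f : H -> G) :
  {morph f : x y / x * y} ->
  exists A, forall x y, (wdist S (f x) (f y) <= A * wdist T x y)%N.
Proof.
move=> fM; have [] := @seq_bound _ (T : seq H) (fun t n => wdist S 1 (f t) <= n)%N.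
- by move=> t m n mn /leq_trans; apply.
- by move=> t _; exists (wdist S 1 (f t)).
move=> A AP; exists A => x y.
have gen t : (t \in (T : seq H)) || (t^-1 \in (T : seq H)) -> (wdist S 1 (f t) <= A)%N.
  move=> /orP[/AP//|/AP]; rewrite (morphV fM) -(wdistM S (f t)) mulgV mulg1.
  by rewrite wdistC.
have [n xy] : exists n, wdist T x y = n by exists (wdist T x y).
rewrite xy; elim: n x xy => [|n IH] x xy.
  by rewrite (wdist_eq0 xy) wdistxx.
have [z [xz zy]] := wdist_step xy; have := IH z zy.
have h : (wdist S (f x) (f z) <= A)%N.
  rewrite -(mulg1 (f x)) -(mulVKg x z) fM wdistM; apply: gen.
  have := word_lengthP T (x^-1 * z); rewrite -/(wdist T x z) xz.
  by move=> [[|s [|t w]] [/= aS // _]]; rewrite big_seq1 => <-; rewrite andbT in aS.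
have := wdist_triangle S (f z) (f x) (f y); rewrite mulnS; lia.
Qed.

Lemma undistorted_nat (R : realType) (H G : groupType) (f : H -> G) (T : genset H)
  (S : genset G) : undistorted R f ->
  exists A, forall x y, (wdist T x y <= A * wdist S (f x) (f y) + A)%N.
Proof.
move=> /(_ T S)[C C1 CP]; pose B := (Num.truncn C).+1.
have CB : (C <= B%:R)%R by apply/ltW/truncnS_gt.
exists (B * B)%N => x y.
have h : (C^-1 * (wdist T x y)%:R - C <= (wdist S (f x) (f y))%:R)%R.
  by have /andP[] := CP x y.
rewrite -(ler_nat R) natrD !natrM.
move: h; rewrite lerBlDr ler_pdivrMl; last lra.
move=> /le_trans; apply; rewrite mulrDr lerD//.
  rewrite ler_wpM2r// (le_trans CB)// ler_peMl//; lra.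
by rewrite ler_pM//; lra.
Qed.

End Homomorphisms.

Section TreeSides.
Context {G : groupType} {T : splitting G}.
Local Notation V := (vertex T).
Implicit Types (p q x y : V) (F : seq V) (g : G).

Let adj_sym : symmetric (@adj G T). Proof. by have [] := adj_tree T. Qed.

(* If q is adjacent to p, the vertices y with avoids p q y form the component of
   q in the tree minus p. *)
Definition avoids p x y := exists c, [/\ path (@adj _ T) x c, last x c = y & p \notin x :: c].

Lemma avoids_refl p x : x <> p -> avoids p x x.
Proof.
by move=> xp; exists [::]; split => //; rewrite inE eq_sym; apply/eqP.
Qed.

Lemma avoids_cons p x y z : x <> p -> adj x y -> avoids p y z -> avoids p x z.
Proof.
move=> xp xy [c [cp cl pc]]; exists (y :: c); split => //=; first by rewrite xy.
by rewrite inE negb_or pc andbT eq_sym; apply/eqP.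
Qed.

Lemma avoids_trans p x y z : avoids p x y -> avoids p y z -> avoids p x z.
Proof.
move=> [c [cp cl pc]] [c' [cp' cl' pc']]; exists (c ++ c'); split.
- by rewrite cat_path cp cl.
- by rewrite last_cat cl.
by move: pc pc'; rewrite -cat_cons mem_cat !inE !negb_or => -> /andP[_ ->].
Qed.

Lemma avoids_sym p x y : avoids p x y -> avoids p y x.
Proof.
move=> [c]; elim: c x => [|z c IH] x [/= cp cl pc].
  by rewrite -cl; apply: avoids_refl => xp; move: pc; rewrite xp mem_head.
move: cp pc => /andP[xz zc]; rewrite inE negb_or => /andP[/eqP px pc].
apply: avoids_trans (IH z _) _ => //.
apply: (@avoids_cons _ _ x); last by apply: avoids_refl => xp; apply: px; rewrite xp.
  by move=> zp; move: pc; rewrite zp mem_head.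
by rewrite adj_sym.
Qed.

Lemma avoids_neq p x y : avoids p x y -> y <> p.
Proof. by move=> [c [_ <- /negP pc]] yp; apply: pc; rewrite -{1}yp mem_last. Qed.

(** The neighbour is the vertex that follows the last visit to [p] on a path from [p] to [x]. *)
Lemma side_exists p x : x <> p -> exists2 q, adj p q & avoids p q x.
Proof.
have [_ _ _ /(_ p x)[c cp cl] _] := adj_tree T => xp.
have H a : path (@adj _ T) a c -> last a c = x ->
    p \notin a :: c \/ exists2 q, adj p q & avoids p q x.
  elim: c {cp cl} a => [|b c IH] a /=.
    by move=> _ ax; left; rewrite ax inE eq_sym; apply/eqP.
  move=> /andP[ab bc] bx; have [pc|] := IH b bc bx; last by right.
  case: (eqVneq p a) => [pa|pa]; last by left; rewrite inE negb_or pa.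
  by right; exists b; [rewrite pa|exists c; split].
by have [|] := H p cp cl; [rewrite mem_head|].
Qed.

(** Otherwise the path from [q] to [x], made simple and closed up through [p], would be a
    circuit. *)
Lemma side_entry p q x : adj p q -> avoids p q x -> adj x p -> x = q.
Proof.
move=> pq [c [cp cl pc]] xp; have [_ _ _ _ acyclic] := adj_tree T.
case/shortenP: cp cl => c' cp' uc' sub cl.
have := acyclic (p :: q :: c'); rewrite /ucycle /cycle.
have -> : path (@adj _ T) p (rcons (q :: c') p).
  by rewrite rcons_cons /= pq rcons_path cp' cl.
have -> : uniq (p :: q :: c').
  rewrite cons_uniq uc' andbT; apply/negP; rewrite inE => /orP[/eqP e|pc'].
    by move: pc; rewrite e mem_head.
  by move: pc; rewrite inE negb_or (sub _ pc') andbF.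
by move=> /(_ isT) /=; case: c' cl {cp' uc' sub}.
Qed.

Lemma side_unique p q q' x : adj p q -> adj p q' -> avoids p q x -> avoids p q' x ->
  q = q'.
Proof.
move=> pq pq' qx /avoids_sym xq'; apply/esym/(@side_entry p) => //.
  exact: avoids_trans qx xq'.
by rewrite adj_sym.
Qed.

(** Walks serve as finite nonempty connected sets of vertices; their order is irrelevant
    afterwards. *)
Definition is_walk F := exists x c, F = x :: c /\ path (@adj _ T) x c.

Lemma walk_invariant F (P : V -> Prop) : is_walk F ->
  (forall x y, x \in F -> y \in F -> adj x y -> P x -> P y) ->
  forall x y, x \in F -> y \in F -> P x -> P y.
Proof.
move=> [a [c [-> ac]]] step.
suff H x : x \in a :: c -> P a <-> P x by move=> x y /H hx /H hy /hx /hy.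
elim: c a ac step x => [|b c IH] a /=; first by move=> _ _ x; rewrite inE => /eqP ->.
move=> /andP[ab bc] step x; rewrite inE => /orP[/eqP ->//|xc].
apply: (iff_trans (B := P b)).
  split; apply: step; rewrite ?inE ?eqxx ?orbT//.
  by rewrite adj_sym.
apply: IH => // y z yc zc; apply: step; rewrite inE ?yc ?zc orbT//.
Qed.

Lemma walk_avoids p F x y : is_walk F -> p \notin F -> x \in F -> y \in F ->
  avoids p x y.
Proof.
move=> Fw pF xF yF; have neq z : z \in F -> z <> p by move=> + zp; rewrite zp (negPf pF).
apply: (walk_invariant Fw _ xF yF); last by apply: avoids_refl; exact: neq.
move=> a b aF bF ab /avoids_trans; apply; apply: (avoids_cons (neq _ aF) ab).
by apply: avoids_refl; exact: neq.
Qed.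

(** A walk can pass from the side of [q] to [p] only through [q]. *)
Lemma walk_side p q F x : is_walk F -> adj p q -> p \in F -> x \in F ->
  avoids p q x -> q \in F.
Proof.
move=> Fw pq pF xF qx; apply: contrapT => /negP qF.
suff /avoids_neq : avoids p q p by [].
apply: (walk_invariant Fw _ xF pF qx) => a b aF bF ab qa.
case: (eqVneq b p) => [bp|/eqP bp].
  by move: qF; rewrite -(side_entry pq qa) ?aF// -bp.
apply: (avoids_trans qa); apply: (avoids_cons (avoids_neq qa) ab).
exact: avoids_refl.
Qed.

Lemma walk_act g F : is_walk F -> is_walk (map (act g) F).
Proof.
move=> [x [c [-> xc]]]; exists (act g x), (map (act g) c); split => //.
by rewrite path_map (eq_path (e' := @adj _ T))// => a b /=; exact: act_adj.
Qed.

Lemma walk_through (s : seq V) x : exists2 F, is_walk F & {subset x :: s <= F}.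
Proof.
elim: s x => [|y s IH] x; first by exists [:: x] => //; exists x, [::].
have [F [a [c [-> ac]]] sF] := IH y.
have [_ _ _ /(_ x a)[b xb ba] _] := adj_tree T.
exists (x :: b ++ c); first by exists x, (b ++ c); rewrite cat_path xb ba.
move=> z; rewrite inE => /orP[/eqP ->|/sF]; first exact: mem_head.
rewrite inE => /orP[/eqP ->|zc].
  by rewrite -cat_cons mem_cat -ba mem_last.
by rewrite -cat_cons mem_cat zc orbT.
Qed.

End TreeSides.

(** * Following paths of the group in the tree *)

Section Cells.
Local Open Scope group_scope.
Context {G : groupType} (S : genset G) {T : splitting G}.
Local Notation V := (vertex T).
Local Notation d := (wdist S).
Local Notation conn := (conn S).
Implicit Types (p q x y : V) (F : seq V) (g h : G).

(* For a finite walk F the map sending g to the cell gF is a coarse equivariant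
   map to the tree; it avoids choosing a base point. *)
Definition cell F g : seq V := map (act g) F.

(** Guarantees that the cells along a path of [G] cannot jump over a vertex of the tree. *)
Definition overlapping F := forall g h, (d g h <= 1)%N ->
  exists2 x, x \in cell F g & x \in cell F h.

Definition crosses F p q g := (p \in cell F g) && (q \in cell F g).

Definition beyond F p q g :=
  p \notin cell F g /\ forall x, x \in cell F g -> avoids p q x.

Lemma mem_cell F g x : (x \in cell F g) = (act g^-1 x \in F).
Proof.
apply/mapP/idP => [[y yF ->]|xF]; first by rewrite -actM mulVg act1.
by exists (act g^-1 x) => //; rewrite -actM mulgV act1.
Qed.

Lemma crossesM F k p q g : crosses F (act k p) (act k q) (k * g) = crosses F p q g.
Proof. by rewrite /crosses !mem_cell !invgM !actM -!(actM k^-1) mulVg !act1. Qed.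

(** A walk through [p] and its images under the generators will do: the cells of neighbours [g] and
    [h] share [act g p] or [act h p]. *)
Lemma overlapping_exists p (s : seq V) :
  exists F, [/\ is_walk F, overlapping F & {subset p :: s <= F}].
Proof.
have [F Fw sF] := walk_through (s ++ [seq act t p | t <- (S : seq G)]) p.
exists F; split => // [g h gh|x]; last first.
  rewrite inE => xs; apply: sF; rewrite inE mem_cat; case: (x == p) xs => //= ->.
  by [].
have pF : p \in F by apply: sF; exact: mem_head.
have tF t : t \in (S : seq G) -> act t p \in F.
  move=> tS; apply: sF; rewrite inE mem_cat; apply/orP; right; apply/orP; right.
  by apply/mapP; exists t.
have [/eqP|gh1] := eqVneq (d g h) 0%N.
  by move=> /eqP/wdist_eq0 <-; exists (act g p); rewrite mem_cell -actM mulVg act1.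
have := word_lengthP S (g^-1 * h); rewrite -/(d g h).
have -> : d g h = 1%N by lia.
move=> [[|t [|t' w]] [/= aS // _]]; rewrite big_seq1 => te.
move: aS; rewrite andbT => /orP[] tS.
  exists (act h p); rewrite mem_cell -actM -?te ?mulVg ?act1//.
  exact: tF.
exists (act g p); rewrite mem_cell -actM ?mulVg ?act1//.
by rewrite -[h^-1 * g]invgK invgM invgK -te; exact: tF.
Qed.

Section Fixed.
Context {F : seq V}.
Hypotheses (Fw : is_walk F) (Fo : overlapping F).
Local Notation cell := (cell F).
Local Notation crosses := (crosses F).
Local Notation beyond := (beyond F).

Let cell_walk g : is_walk (cell g). Proof. exact: walk_act. Qed.

Let cell_neq0 g : exists x, x \in cell g.
Proof.
by have [x [c [-> _]]] := cell_walk g; exists x; exact: mem_head.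
Qed.

Lemma beyond_exists p g : p \notin cell g -> exists2 q, adj p q & beyond p q g.
Proof.
move=> pg; have [x xg] := cell_neq0 g.
have [|q pq qx] := @side_exists _ _ p x; first by move=> xp; rewrite -xp xg in pg.
exists q => //; split => // y yg; apply: avoids_trans qx _.
exact: walk_avoids (cell_walk g) pg xg yg.
Qed.

Lemma beyond_mem p q g x : p \notin cell g -> x \in cell g -> avoids p q x ->
  beyond p q g.
Proof.
move=> pg xg qx; split => // y yg; apply: avoids_trans qx _.
exact: walk_avoids (cell_walk g) pg xg yg.
Qed.

Lemma beyond_step p q g h : beyond p q g -> (d g h <= 1)%N -> p \notin cell h ->
  beyond p q h.
Proof.
by move=> [pg gq] gh ph; have [x xg xh] := Fo gh; exact: beyond_mem ph xh (gq _ xg).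
Qed.

Lemma beyond_exit p q g h : adj p q -> beyond p q g -> (d g h <= 1)%N ->
  p \in cell h -> crosses p q h.
Proof.
move=> pq [pg gq] gh ph; have [x xg xh] := Fo gh.
rewrite /crosses ph; exact: walk_side (cell_walk h) pq ph xh (gq _ xg).
Qed.

(** Cells cannot change side without containing [p], and the first one that does contains the whole
    edge. *)
Lemma beyond_leave p q g h n P : adj p q -> beyond p q g -> conn P n g h ->
  ~ beyond p q h -> exists2 k, crosses p q k & (d g k <= n)%N.
Proof.
move=> pq gq gh; elim: gh gq => [x _ //|{}n x y z _ xy yz IH xq zq].
case: (boolP (p \in cell y)) => py.
  by exists y; [exact: beyond_exit xq xy py|lia].
have [k kc yk] := IH (beyond_step xq xy py) zq; exists k => //.
have := wdist_triangle S y x k; lia.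
Qed.

(* A path that leaves the set of points whose cells contain p leaves it and
   comes back through one and the same edge at p. *)
Lemma excursion_ind (P : G -> Prop) (Q : nat -> G -> G -> Prop) p :
  (forall g, p \in cell g -> P g -> Q 0%N g g) ->
  (forall m n g h k, Q m g h -> Q n h k -> Q (m + n)%N g k) ->
  (forall g h, p \in cell g -> p \in cell h -> P g -> P h -> (d g h <= 1)%N -> Q 1%N g h) ->
  (forall q n g h, adj p q -> crosses p q g -> crosses p q h ->
    conn P n g h -> Q n g h) ->
  forall n g h, p \in cell g -> p \in cell h -> conn P n g h -> Q n g h.
Proof.
move=> Q0 QD Q1 Qx n g h pg ph gh.
(* The induction carries along the excursion in progress: the point [g0] where it began, its edge
   towards [q] and the length [k] travelled so far. *)
suff H : (p \in cell g -> Q n g h) /\ (p \notin cell g ->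
    forall q k g0, adj p q -> crosses p q g0 -> beyond p q g -> conn P k g0 g ->
    Q (k + n)%N g0 h) by case: H => H _; exact: H.
elim: gh ph {pg} => [x Px|{}n x y z Px xy yz IH] ph.
  by split=> [xc|/negP//]; exact: Q0.
have [IH1 IH2] := IH ph; have Py := conn_start yz.
split=> [px|px q k g0 pq g0c xq g0x].
  case: (boolP (p \in cell y)) => py.
    by rewrite -add1n; apply: (QD _ _ _ y); [exact: Q1|exact: IH1].
  have [q pq yq] := beyond_exists py; rewrite -add1n; apply: (IH2 py q) => //.
    apply: (@beyond_exit _ _ y) => //; first by rewrite wdistC.
  by apply: connS xy _ => //; exact: conn0.
have g0y : conn P k.+1 g0 y by exact: conn_rcons g0x xy Py.
case: (boolP (p \in cell y)) => py; last first.
  by rewrite addnS -addSn; apply: (IH2 py q) => //; exact: beyond_step xq xy py.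
rewrite addnS -addSn; apply: (QD _ _ _ y); last exact: IH1.
by apply: (Qx q) => //; exact: beyond_exit xq xy py.
Qed.

(** The inverses of [g] and [h] both bring the edge into the finite set [F]. For any two pairs in
    [F] one fixes an element carrying one to the other, if there is any; [rho] bounds these
    elements, and [e] is [g^-1 * h] corrected by one of them. *)
Lemma crosses_coset : exists rho, forall a b g h x y, crosses a b g -> crosses a b h ->
  x \in F -> y \in F -> act g x = a -> act g y = b ->
  exists e, [/\ act e x = x, act e y = y & (d (g * e) h <= rho)%N].
Proof.
pose Q (t : (V * V) * (V * V)) n := (exists k, act k t.1.1 = t.2.1 /\ act k t.1.2 = t.2.2) ->
  exists k, [/\ act k t.1.1 = t.2.1, act k t.1.2 = t.2.2 & (d 1 k <= n)%N].
pose FF := [seq (x, y) | x <- F, y <- F].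
have [|t _|rho rhoP] := @seq_bound _ [seq (u, v) | u <- FF, v <- FF] Q.
- by move=> t m n mn h /h[k [k1 k2 kn]]; exists k; split => //; exact: leq_trans mn.
- have [[k [k1 k2]]|no] := pselect (exists k, act k t.1.1 = t.2.1 /\ act k t.1.2 = t.2.2).
    by exists (d 1 k) => _; exists k.
  by exists 0%N => /no.
exists rho => a b g h x y _ /andP[ah bh] xF yF gx gy.
have tFF : ((x, y), (act h^-1 a, act h^-1 b)) \in [seq (u, v) | u <- FF, v <- FF].
  by apply: allpairs_f; apply: allpairs_f; rewrite // -mem_cell.
have [|k [/= k1 k2 kr]] := rhoP _ tFF.
  by exists (h^-1 * g); rewrite /= !actM gx gy.
exists (g^-1 * h * k); split.
- by rewrite !actM k1 -(actM h) mulgV act1 -gx -actM mulVg act1.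
- by rewrite !actM k2 -(actM h) mulgV act1 -gy -actM mulVg act1.
by rewrite !mulgA mulgV mul1g -{2}(mulg1 h) wdistM wdistC.
Qed.

End Fixed.
End Cells.

(** * Generation and undistortion of vertex groups *)

Section Spelling.
Local Open Scope group_scope.

Lemma spells_sub (G : groupType) (s s' : seq G) n g : {subset s <= s'} ->
  spells s n g -> spells s' n g.
Proof.
move=> ss [w [sw ws wg]]; exists w; split => //.
by apply: sub_all sw => x /orP[/ss->//|/ss->]; rewrite orbT.
Qed.

Lemma spells_one (G : groupType) (s : seq G) : spells s 0%N 1.
Proof. by exists [::]; rewrite big_nil. Qed.

Lemma spells_mul (G : groupType) (s : seq G) m n g h :
  spells s m g -> spells s n h -> spells s (m + n)%N (g * h).
Proof.
move=> [w [sw <- <-]] [w' [sw' <- <-]]; exists (w ++ w').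
by rewrite /is_word all_cat size_cat big_cat; split => //; exact/andP.
Qed.

Lemma spells_letter (G : groupType) (s : seq G) g : g \in s -> spells s 1%N g.
Proof. by move=> gs; exists [:: g]; rewrite /= gs big_seq1. Qed.

Lemma spells_morph (H G : groupType) (f : H -> G) (s : seq H) n h :
  {morph f : x y / x * y} -> spells s n h -> spells (map f s) n (f h).
Proof.
move=> fM [w [sw ws wh]]; exists (map f w); split; rewrite ?size_map//.
  apply/allP => _ /mapP[x xw ->]; move/allP: sw => /(_ _ xw).
  by move=> /orP[xs|xs]; apply/orP; [left|right; rewrite -(morphV fM)]; exact: map_f.
rewrite -wh big_map; elim: w {sw ws wh} => [|x w IH].
  by rewrite !big_nil (morph1 fM).
by rewrite !big_cons IH fM.
Qed.

End Spelling.

Section VertexGroup.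
Local Open Scope group_scope.
Context {R : realType} {G : groupType} (S : genset G) {T : splitting G} (p : vertex T).
Hypothesis edge_fg : forall q, adj p q -> finitely_generated (edge_group p q).
Hypothesis edge_undist : forall q, adj p q ->
  undistorted R (val : edge_group p q -> G).
Local Notation V := (vertex_group p).
Local Notation d := (wdist S).

Let vM (v w : V) : val (v * w) = val v * val w.
Proof. exact: valM. Qed.

Let valV (v : V) : val v^-1 = (val v)^-1.
Proof. exact: (morphV vM). Qed.

Lemma estab_fix q g : adj p q -> estab p q g -> act g p = p /\ act g q = q.
Proof.
move=> pq /orP[] /andP[/eqP gp /eqP gq] => //.
by case: (act_no_inversion pq (conj gp gq)).
Qed.

Lemma estab_vstab q g : adj p q -> estab p q g -> vstab p g.
Proof. by move=> pq /(estab_fix pq)[gp _]; apply/eqP. Qed.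

Context {F : seq (vertex T)}.
Hypotheses (Fw : is_walk F) (Fo : overlapping S F) (pF : p \in F).

(** This is [crosses_coset] for the degenerate pair [(p, p)] and the identity as first element. Away
    from the cells containing [p] the value of [pr] is arbitrary. *)
Lemma vertex_projection : exists rho (pr : G -> V),
  forall g, p \in cell F g -> (d (val (pr g)) g <= rho)%N.
Proof.
have [rho rhoP] := crosses_coset (F := F) S.
have /choice[pr prP] g : exists v : V, p \in cell F g -> (d (val v) g <= rho)%N.
  case: (boolP (p \in cell F g)) => [pg|_]; last by exists 1.
  have [||||e [ep _ er]] := rhoP p p 1 g p p _ _ pF pF.
  - by rewrite /crosses andbb mem_cell invg1 act1.
  - by rewrite /crosses andbb.
  - exact: act1.
  - exact: act1.
  have ev : vstab p e by apply/eqP.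
  by exists (Sub e ev); rewrite SubK -(mul1g e).
by exists rho, pr.
Qed.

Lemma mem_cell_vstab (v : V) : p \in cell F (val v).
Proof.
rewrite mem_cell; have /eqP -> : vstab p (val v)^-1; last exact: pF.
by have := valP v^-1; rewrite valV.
Qed.

(** There may be infinitely many edges at [p], but translation by the inverse of [v] brings [g] into
    the ball of radius [r], whose cells contain finitely many vertices: these form [Qs]. *)
Lemma crosses_edge_group r : exists rho (Qs : seq (vertex T)),
  forall q g h (v w : V), adj p q -> crosses F p q g -> crosses F p q h ->
  (d (val v) g <= r)%N -> (d (val w) h <= r)%N ->
  exists2 q', q' \in Qs /\ adj p q' & exists2 e, estab p q' e &
    (d (val v * e) (val w) <= rho)%N.
Proof.
have [rho rhoP] := crosses_coset (F := F) S.
have [ball ballP] := finite_ball S r.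
exists (r + rho + r)%N, [seq act c y | c <- ball, y <- F].
move=> q g h v w pq gc hc vg wh; set v' := (val v)^-1.
have /eqP vp : vstab p (val v) by exact: valP.
have v'p : act v' p = p by exact: actV vp.
have gc' : crosses F p (act v' q) (v' * g) by rewrite -{1}v'p crossesM.
have hc' : crosses F p (act v' q) (v' * h) by rewrite -{1}v'p crossesM.
have v'g : (d 1 (v' * g) <= r)%N by rewrite -(mulVg (val v)) wdistM.
set g0 := v' * g in gc' v'g *; set q' := act v' q in gc' hc' *.
have pq' : adj p q' by rewrite -v'p act_adj.
clearbody g0 q'.
have /andP[] := gc'; rewrite !mem_cell => xF yF.
have [||e [ex ey er]] := rhoP p q' g0 (v' * h) _ _ gc' hc' xF yF.
- by rewrite -actM mulgV act1.
- by rewrite -actM mulgV act1.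
exists q'; first split.
- apply/allpairsP; exists (g0, act g0^-1 q'); split => //=; first exact: ballP.
  by rewrite -actM mulgV act1.
- exact: pq'.
exists (g0 * e * g0^-1).
  by rewrite /estab inE !actM ex ey -!(actM g0) mulgV !act1 !eqxx.
rewrite -(wdistM S v') !mulgA mulVg mul1g.
have h1 : (d (g0 * e * g0^-1) (g0 * e) <= r)%N.
  by rewrite -{2}(mulg1 (g0 * e)) wdistM -(wdistM S g0) mulgV mulg1.
have h2 : (d (v' * h) (v' * val w) <= r)%N by rewrite wdistM wdistC.
apply: (leq_trans (wdist_triangle S (v' * h) _ _)); apply: leq_add => //.
by apply: (leq_trans (wdist_triangle S (g0 * e) _ _)); exact: leq_add.
Qed.

Lemma edge_group_spelling q : adj p q -> exists (s : seq V) C,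
  forall e : V, estab p q (val e) -> exists2 n, (n <= C * d 1 (val e) + C)%N & spells s n e.
Proof.
move=> pq; have [Ts Tg] := edge_fg pq; pose Te := Genset Tg.
have [C CP] := undistorted_nat Te S (edge_undist pq).
have incl_st (e : edge_group p q) : vstab p (val e).
  exact: estab_vstab pq (valP e).
pose incl (e : edge_group p q) : V := Sub (val e) (incl_st e).
have inclM : {morph incl : x y / x * y}.
  by move=> x y; apply: val_inj; rewrite vM !SubK.
exists (map incl Ts), C => e eq.
pose e' : edge_group p q := Sub (val e) eq.
have -> : e = incl e' by apply: val_inj; rewrite !SubK.
exists (wdist Te 1 e'); last first.
  apply: spells_morph => //; have := word_lengthP Te (1^-1 * e').
  by rewrite invg1 mul1g /wdist invg1 mul1g.
by have := CP 1 e'; rewrite val1 SubK.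
Qed.

(** A path of [G] between elements of [V] is projected to [V]. Steps between cells containing [p]
    have bounded image; an excursion moves along one of finitely many edge groups, where
    undistortion yields a word of linear length. One count thus gives both generation and the
    distance bound. *)
Lemma vertex_group_finitely_generated : exists (S' : genset V) A,
  forall v w, (wdist S' v w <= A * d (val v) (val w) + A)%N.
Proof.
have [r [pr prP]] := vertex_projection.
have [rho [Qs QsP]] := crosses_edge_group r.
have /choice[se seP] q : exists s : seq V, adj p q -> exists C, forall e : V, estab p q (val e) ->
    exists2 n, (n <= C * d 1 (val e) + C)%N & spells s n e.
  by have [/edge_group_spelling[s sP]|] := boolP (adj p q); [exists s|exists [::]].
have [||C CP] := @seq_bound _ Qs (fun q C => adj p q -> forall e : V, estab p q (val e) ->
    exists2 n, (n <= C * d 1 (val e) + C)%N & spells (se q) n e).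
- move=> q m n mn h pq e /(h pq e)[k km kP]; exists k => //.
  by apply: (leq_trans km); rewrite leq_add// leq_mul2r mn orbT.
- move=> q _; have [pq|] := boolP (adj p q); last by exists 0%N.
  by have [C CP] := seP q pq; exists C.
have [ball ballP] := finite_ball S (2 * r + 1 + rho)%N.
pose s : seq V := pmap insub ball ++ flatten (map se Qs).
have s_ball (v : V) : (d 1 (val v) <= 2 * r + 1 + rho)%N -> spells s 1%N v.
  move=> vb; apply: spells_letter; rewrite mem_cat; apply/orP; left.
  by rewrite mem_pmap_sub; exact: ballP.
have s_edge q (e : V) : q \in Qs -> adj p q -> estab p q (val e) ->
    exists2 n, (n <= C * d 1 (val e) + C)%N & spells s n e.
  move=> qQ pq /(CP q qQ pq)[n nC ns]; exists n => //; apply: spells_sub ns => x xq.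
  by rewrite mem_cat; apply/orP; right; apply/flatten_mapP; exists q.
pose A := (1 + C * (1 + 2 * r + rho) + C)%N.
pose Q n g h := exists2 m, (m <= A * n)%N & spells s m ((pr g)^-1 * pr h).
have QP n g h : p \in cell F g -> p \in cell F h -> conn S (fun=> True) n g h -> Q n g h.
  apply: (excursion_ind Fw Fo).
  - by move=> x _ _; exists 0%N => //; rewrite mulVg; exact: spells_one.
  - move=> m k x y z [m' mm xy] [k' kk yz]; exists (m' + k')%N.
      by rewrite mulnDr leq_add.
    by have := spells_mul xy yz; rewrite -mulgA mulVKg.
  - move=> x y px py _ _ xy; exists 1%N; first by rewrite /A; lia.
    apply: s_ball; rewrite vM valV -(mulVg (val (pr x))) wdistM.
    have := prP x px; have := prP y py; rewrite (wdistC S _ y) => h1 h2.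
    have := wdist_triangle S x (val (pr x)) (val (pr y)).
    have := wdist_triangle S y x (val (pr y)); lia.
  move=> q k x y pq xc yc xy; have px : p \in cell F x by case/andP: xc.
  have py : p \in cell F y by case/andP: yc.
  (* A path of length 0 must cost nothing; from length 1 on, [A] absorbs the additive constants. *)
  have xy' := conn_wdist xy; case: k xy xy' => [|k] xy xy'.
    have -> : x = y by apply: (wdist_eq0 (S := S)); lia.
    by exists 0%N => //; rewrite mulVg; exact: spells_one.
  have [q' [q'Q pq'] [e ee er]] := QsP q x y (pr x) (pr y) pq xc yc (prP x px) (prP y py).
  pose e' : V := Sub e (estab_vstab pq' ee).
  have [|m me ms] := s_edge q' e' q'Q pq'; first by rewrite SubK.
  exists (m + 1)%N; last first.
    rewrite -(mulVKg e' ((pr x)^-1 * pr y)); apply: (spells_mul ms); apply: s_ball.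
    rewrite !vM !valV SubK.
    rewrite -(mulVg e) -(wdistM S e) mulVKg mulgA mulgV mul1g -(wdistM S (val (pr x))) mulVKg.
    by rewrite (leq_trans er)//; clear; lia.
  rewrite SubK in me.
  have h1 := prP x px; have h2 := prP y py; rewrite (wdistC S _ y) in h2.
  have h3 : (d 1 e <= k.+1 + 2 * r + rho)%N.
    rewrite -(wdistM S (val (pr x))) mulg1.
    have h3 := wdist_leD h1 (wdist_leD xy' h2).
    rewrite wdistC in er; apply: (leq_trans (wdist_leD h3 er)); clear; lia.
  have h4 : (C * d 1 e <= C * (k.+1 + 2 * r + rho))%N by rewrite leq_mul2l h3 orbT.
  by move: me h4; rewrite /A; clear; lia.
have main v w : exists2 m, (m <= A * d (val v) (val w) + 2)%N & spells s m (v^-1 * w).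
  have vc := mem_cell_vstab v; have wc := mem_cell_vstab w.
  have [//|m mA ms] := QP (d (val v) (val w)) (val v) (val w) vc wc.
    by apply: conn_geodesic.
  exists (1 + m + 1)%N; first lia.
  have -> : v^-1 * w = (v^-1 * pr (val v)) * ((pr (val v))^-1 * pr (val w)) * ((pr (val w))^-1 * w).
    by rewrite -!mulgA !mulVKg.
  apply: spells_mul; last first.
    apply: s_ball; rewrite vM valV -(mulVg (val (pr (val w)))) wdistM.
    by rewrite (leq_trans (prP _ wc))//; lia.
  apply: spells_mul => //; apply: s_ball; rewrite vM valV -(mulVg (val v)) wdistM.
  by rewrite wdistC (leq_trans (prP _ vc))//; lia.
have s_gen : generates s.
  by move=> v; have [m _] := main 1 v; rewrite invg1 mul1g; exists m.
exists (Genset s_gen), (A + 2)%N => v w.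
have [m mA ms] := main v w; apply: (leq_trans (word_length_le (S := Genset s_gen) ms)).
by apply: (leq_trans mA); apply: leq_add; [rewrite leq_mul2r leq_addr orbT|lia].
Qed.

Lemma vertex_group_undistorted (S' : genset V) : exists A, forall v w,
  (wdist S' v w <= A * d (val v) (val w) + A)%N /\ (d (val v) (val w) <= A * wdist S' v w)%N.
Proof.
have [S0 [A AP]] := vertex_group_finitely_generated.
have [B BP] := @hom_lipschitz _ _ S0 S' id (fun _ _ => erefl).
have [C CP] := @hom_lipschitz _ _ S' S val vM.
exists (B * A + C)%N => v w; split; last first.
  by rewrite (leq_trans (CP v w))// leq_mul2r leq_addl orbT.
apply: (leq_trans (BP v w)); have : (B * wdist S0 v w <= B * (A * d (val v) (val w) + A))%N.
  by rewrite leq_mul2l AP orbT.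
lia.
Qed.

End VertexGroup.

(** * Detours in vertex groups and along edges *)

Ltac lia_goal := clear; lia.

(** Avoidance of the ball of radius s/L about [z], in the non-strict form used for detours;
    [diverges] has the strict one. *)
Definition off (G : groupType) (S : genset G) L s (z w : G) := (s <= L * wdist S w z)%N.

Section Detours.
Local Open Scope group_scope.

(** Displacements of at most half the radius s/L cost a factor 2 in the constant. *)
Lemma off_near (G : groupType) (S : genset G) L s z x y c : off S L s z x ->
  (wdist S x y <= c)%N -> (2 * L * c <= s)%N -> off S (2 * L) s z y.
Proof.
rewrite /off => xz xy cs; have h : (L * wdist S x z <= L * (c + wdist S y z))%N.
  by rewrite leq_mul2l (wdist_leD xy (leqnn _)) orbT.
rewrite mulnDr in h; lia.
Qed.

Lemma off_le (G : groupType) (S : genset G) L L' s z x : (L <= L')%N -> off S L s z x ->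
  off S L' s z x.
Proof. by move=> LL /leq_trans; apply; rewrite leq_mul2r LL orbT. Qed.

Lemma conn_off_le (G : groupType) (S : genset G) L L' s n n' z x y : (L <= L')%N ->
  (n <= n')%N -> conn S (off S L s z) n x y -> conn S (off S L' s z) n' x y.
Proof.
by move=> LL nn xy; apply: (conn_leq nn); apply: conn_sub xy => w; exact: off_le.
Qed.

Lemma conn_near (G : groupType) (S : genset G) L s z x y c : off S L s z x ->
  (wdist S x y <= c)%N -> (2 * L * c <= s)%N -> conn S (off S (2 * L) s z) c x y.
Proof.
move=> xz xy cs; apply: (conn_leq xy); apply: conn_geodesic => w wxy.
by apply: (off_near xz _ cs); lia.
Qed.

Lemma conn_lipschitz (H G : groupType) (S' : genset H) (S : genset G) (f : H -> G) A
    (P : H -> Prop) (P' : G -> Prop) n x y :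
  (forall x y, (wdist S (f x) (f y) <= A * wdist S' x y)%N) ->
  (forall x w, P x -> (wdist S (f x) w <= A)%N -> P' w) ->
  conn S' P n x y -> conn S P' (A * n) (f x) (f y).
Proof.
move=> fA PP'; elim=> [{}x Px|{}n {}x u {}y Px xu _ IH].
  by rewrite muln0; apply: conn0; apply: (PP' x) => //; rewrite wdistxx.
rewrite mulnS; apply: conn_cat IH.
have h : (wdist S (f x) (f u) <= A)%N.
  by apply: (leq_trans (fA _ _)); rewrite -{2}(muln1 A) leq_mul2l xu orbT.
apply: (conn_leq h); apply: conn_geodesic => w wx; apply: (PP' x) => //; lia.
Qed.

Section VertexGroup.
Context {R : realType} {G : groupType} (S : genset G) {T : splitting G} (p : vertex T).
Hypothesis edge_fg : forall q, adj p q -> finitely_generated (edge_group p q).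
Hypothesis edge_undist : forall q, adj p q ->
  undistorted R (val : edge_group p q -> G).
Hypothesis edge_wide : forall q, adj p q -> relatively_wide R (edge_in_vertex_group p q).
Local Notation V := (vertex_group p).
Context (S' : genset V) {F : seq (vertex T)}.
Hypotheses (Fw : is_walk F) (Fo : overlapping S F) (pF : p \in F).
Local Notation d := (wdist S).
Local Notation d' := (wdist S').

(** After translation by the inverse of [v], relative wideness applies to 1 and [e'], for one of
    finitely many edge groups; the bounded gap between [v * e'] and [w] is closed by a geodesic. *)
Lemma vertex_detour r L : exists L', forall s q g h (v w z : V), (L' <= s)%N ->
  adj p q -> crosses F p q g -> crosses F p q h ->
  (d (val v) g <= r)%N -> (d (val w) h <= r)%N -> (d' v w <= L * s)%N ->
  off S' L s z v -> off S' L s z w -> conn S' (off S' L' s z) (L' * s) v w.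
Proof.
have [rho [Qs QsP]] := crosses_edge_group S p r (F := F).
have [A AP] := vertex_group_undistorted edge_fg edge_undist Fw Fo pF S'.
pose c := (A * rho + A)%N; pose L1 := (2 * L + c + 1)%N.
have [||L' L'P] := @seq_bound _ Qs (fun q L' => adj p q -> forall s u u' z, (L' <= s)%N ->
    edge_in_vertex_group p q u -> edge_in_vertex_group p q u' ->
    (d' u u' <= L1 * s)%N -> off S' L1 s z u -> off S' L1 s z u' ->
    conn S' (off S' L' s z) (L' * s) u u').
- move=> q m n mn h pq s u u' z ns qu qu' uu' uz uz'.
  apply: (conn_off_le mn); last by apply: h => //; exact: leq_trans ns.
  by rewrite leq_mul2r mn orbT.
- move=> q _; have [pq|] := boolP (adj p q); last by exists 0%N.
  have [L' L'P] := wide_detour S' (edge_wide pq) L1; exists L' => _ s u u' z Ls qu qu' uu' uz uz'.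
  by apply: L'P => //; rewrite wdistC.
exists (L' + 2 * L + 2 * L * c + c + 1)%N => s q g h v w z Ls pq gc hc vg wh vw vz wz.
have [q' [q'Q pq'] [e ee er]] := QsP q g h v w pq gc hc vg wh.
pose e' : V := Sub e (estab_vstab pq' ee).
have ew : (d' (v * e') w <= c)%N.
  have [h1 _] := AP (v * e') w; apply: (leq_trans h1).
  by rewrite leq_add2r leq_mul2l; apply/orP; right; apply: leq_trans er.
have cs : (2 * L * c <= s)%N by move: Ls; lia_goal.
have s0 : (0 < s)%N by move: Ls; lia_goal.
have wz2 : off S' (2 * L) s z (v * e').
  by apply: off_near wz _ cs; rewrite wdistC.
have path1 : conn S' (off S' L' s z) (L' * s) v (v * e').
  rewrite -{1}(mulg1 v).
  apply: (@conn_map _ _ (off S' L' s (v^-1 * z))).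
    by move=> u; rewrite /off -(wdistM S' v) mulVKg.
  apply: (L'P q' q'Q pq'); first by move: Ls; lia_goal.
  - by change (is_true (estab p q' (1 : G))); rewrite /estab inE !act1 !eqxx.
  - exact: ee.
  - have ew' : (d' w (v * e') <= c)%N by rewrite wdistC.
    rewrite -(wdistM S' v) mulg1; apply: (leq_trans (wdist_leD vw ew')).
    have : (c * 1 <= c * s)%N by rewrite leq_mul2l s0 orbT.
    by rewrite /L1 !mulnDl; lia_goal.
  - apply: (off_le (L := L)); first by rewrite /L1; lia_goal.
    by rewrite /off -(wdistM S' v) mulVKg mulg1.
  - apply: (off_le (L := 2 * L)); first by rewrite /L1; lia_goal.
    by rewrite /off -(wdistM S' v) mulVKg.
have path2 : conn S' (off S' (2 * L) s z) c (v * e') w.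
  by apply: conn_sym; apply: conn_near wz _ cs; rewrite wdistC.
apply: (@conn_leq _ _ _ (L' * s + c)).
  have : (c * 1 <= c * s)%N by rewrite leq_mul2l s0 orbT.
  by rewrite !mulnDl; lia_goal.
by apply: conn_cat; [apply: conn_off_le path1|apply: conn_off_le path2]; lia_goal.
Qed.

(* A path of G between points of V is pushed into V one excursion at a time.
   Excursions short at scale s stay away from z; the others have length at
   least s/const, which pays for the detour of length O(s) that replaces them. *)
Lemma diverges_val f : exists f', forall u : nat -> V, diverges S' f u ->
  diverges S f' (fun n => val (u n)).
Proof.
have [r [pr prP]] := vertex_projection S pF.
have [A AP] := vertex_group_undistorted edge_fg edge_undist Fw Fo pF S'.
pose e := (2 * r * A + A)%N; pose c0 := (A * (2 * r + 1) + A)%N; pose c1 := (A * r + A)%N.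
(* Moving to the projection costs the factor 2, passing to the metric of [V] the factor [A]. *)
pose L2 L := (2 * L * A)%N.
have /choice[D DP] L := vertex_detour r (L2 L + A * L + e).
pose M L := (2 * L2 L + c0 + A + e + D L + D L * (4 * L2 L * A))%N.
pose L5 L := (M L * L + 2 * c1 + 2 * M L)%N.
exists (fun L => f (L5 L) + D L + 2 * L * r + 2 * L2 L * c0 + 4 * L2 L * e + 2 * (L * A) * c1 + 1)%N.
move=> u uf L s a b m n fs am mb nL ab; set z := u m.
have s0 : (0 < s)%N by move: fs; lia_goal.
have off_val (v : V) k : off S k s (val z) (val v) -> off S' (k * A) s z v.
  rewrite /off => /leq_trans; apply; rewrite -mulnA leq_mul2l.
  by have [_ ->] := AP v z; rewrite orbT.
have off_pr g : p \in cell F g -> off S L s (val z) g -> off S' (L2 L) s z (pr g).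
  move=> pg gz; apply: off_val; apply: (off_near gz (c := r)); last by move: fs; lia_goal.
  by rewrite wdistC; exact: prP.
have M_L2 : (L2 L <= M L)%N by rewrite /M; lia_goal.
have pr_dist g h n' : p \in cell F g -> p \in cell F h -> (d g h <= n')%N ->
    (d' (pr g) (pr h) <= A * n' + e)%N.
  move=> pg ph gh; have [h1 _] := AP (pr g) (pr h); apply: (leq_trans h1).
  have gr := prP g pg; have hr := prP h ph; rewrite wdistC in hr.
  have h2 := wdist_leD gr (wdist_leD gh hr).
  have h3 : (A * d (val (pr g)) (val (pr h)) <= A * (r + (n' + r)))%N by rewrite leq_mul2l h2 orbT.
  by apply: (leq_trans (leq_add h3 (leqnn A))); rewrite /e; lia_goal.
(* The proviso on [n'] keeps each excursion within the range of [vertex_detour]; pieces of a path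
   inherit it. *)
pose Q n' g h := (n' <= L * s)%N -> conn S' (off S' (M L) s z) (M L * n') (pr g) (pr h).
have va := mem_cell_vstab pF (u a); have vb := mem_cell_vstab pF (u b).
have ab' : conn S (off S L s (val z)) n (val (u a)) (val (u b)).
  by apply: conn_sub ab => w /ltnW.
have /(_ nL) path : Q n (val (u a)) (val (u b)).
  move: ab'; apply: (excursion_ind Fw Fo) va vb.
  - move=> g pg gz _; rewrite muln0; apply: conn0.
    exact: off_le M_L2 (off_pr _ pg gz).
  - move=> k k' g h l kQ kQ' kL; rewrite mulnDr.
    by apply: (@conn_cat _ _ _ _ _ _ (pr h)); [apply: kQ|apply: kQ']; move: kL; lia_goal.
  - move=> g h pg ph gz _ gh _.
    have c0' : (d' (pr g) (pr h) <= c0)%N.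
      by apply: (leq_trans (pr_dist _ _ _ pg ph gh)); rewrite /c0 /e; lia_goal.
    have path1 := conn_near (off_pr _ pg gz) c0' ltac:(move: fs; lia_goal).
    by apply: conn_off_le path1; rewrite /M; lia_goal.
  move=> q k g h pq gc hc gh kL.
  have pg : p \in cell F g by case/andP: gc.
  have ph : p \in cell F h by case/andP: hc.
  have gz := conn_start gh; have hz := conn_end gh.
  have prk := pr_dist _ _ _ pg ph (conn_wdist gh).
  case: k gh kL prk => [|k] gh kL prk.
    have -> : g = h by apply: (wdist_eq0 (S := S)); apply/eqP; rewrite -leqn0; exact: conn_wdist gh.
    by rewrite muln0; apply: conn0; exact: off_le M_L2 (off_pr _ ph hz).
  have [small|big] := leqP (4 * L2 L * A * k.+1) s.
    have path1 := conn_near (off_pr _ pg gz) prk ltac:(move: fs small; lia_goal).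
    apply: conn_off_le path1; first by rewrite /M; lia_goal.
    by rewrite /M !mulnDl; move: (leq_pmulr e (ltn0Sn k)); lia_goal.
  have L2L : (L2 L <= L2 L + A * L + e)%N by rewrite -addnA leq_addr.
  have := DP L s q g h (pr g) (pr h) z _ pq gc hc (prP _ pg) (prP _ ph) _
    (off_le L2L (off_pr _ pg gz)) (off_le L2L (off_pr _ ph hz)).
  move=> /(_ _ _)/wrap[||path1]; first by move: fs; lia_goal.
    apply: (leq_trans prk); rewrite !mulnDl.
    have h1 : (A * k.+1 <= A * (L * s))%N by rewrite leq_mul2l kL orbT.
    have h2 : (e * 1 <= e * s)%N by rewrite leq_mul2l s0 orbT.
    by move: h1 h2; lia_goal.
  apply: conn_off_le path1; first by rewrite /M; lia_goal.
  have h1 : (D L * s <= D L * (4 * L2 L * A * k.+1))%N by rewrite leq_mul2l (ltnW big) orbT.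
  by apply: (leq_trans h1); rewrite mulnA leq_mul2r /M; lia_goal.
have c1a : (d' (u a) (pr (val (u a))) <= c1)%N.
  have [h1 _] := AP (u a) (pr (val (u a))); apply: (leq_trans h1).
  by rewrite leq_add2r leq_mul2l wdistC prP// orbT.
have c1b : (d' (u b) (pr (val (u b))) <= c1)%N.
  have [h1 _] := AP (u b) (pr (val (u b))); apply: (leq_trans h1).
  by rewrite leq_add2r leq_mul2l wdistC prP// orbT.
have path_a := conn_near (off_val _ _ (conn_start ab')) c1a ltac:(move: fs; lia_goal).
have path_b := conn_sym (conn_near (off_val _ _ (conn_end ab')) c1b ltac:(move: fs; lia_goal)).
have LA : (2 * (L * A) <= M L)%N by rewrite mulnA.
have := conn_cat (conn_off_le LA (leqnn _) path_a)
  (conn_cat path (conn_off_le LA (leqnn _) path_b)).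
move=> /(conn_sub _) full; apply: (uf (L5 L) s a b m _ _ am mb _ (full _ _)); first by move: fs; lia_goal.
  have h1 : (M L * n <= M L * (L * s))%N by rewrite leq_mul2l nL orbT.
  have h2 : (c1 * 1 <= c1 * s)%N by rewrite leq_mul2l s0 orbT.
  have aux k c : (k * n <= k * (L * s) -> c * 1 <= c * s ->
    c + (k * n + c) <= (k * L + 2 * c + 2 * k) * s)%N by lia_goal.
  exact: aux.
move=> w; rewrite /off => h.
have : (2 * M L * d' w (u m) <= L5 L * d' w (u m))%N by rewrite leq_mul2r /L5; lia_goal.
by rewrite -/z -mulnA; move: h s0; lia_goal.
Qed.

End VertexGroup.
Section CrossingDetour.
Context {R : realType} {G : groupType} (S : genset G) {T : splitting G}.
Hypothesis edge_hyp : forall p q : vertex T, adj p q ->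
  [/\ finitely_generated (edge_group p q),
      undistorted R (val : edge_group p q -> G) &
      relatively_wide R (edge_in_vertex_group p q)].
Local Notation d := (wdist S).

(** Here [z] may lie anywhere in [G]. If the vertex group has an element [v] within s/K of [z], a
    detour around [v] in the vertex group avoids [z] too; if it has none, every path in the vertex
    group does, and a geodesic suffices. *)
Lemma edge_detour (F : seq (vertex T)) x y L c : is_walk F -> overlapping S F -> adj x y ->
  exists L', forall s h u u' z, (L' <= s)%N ->
  crosses F x y 1 -> crosses F x y h -> (d u 1 <= c)%N -> (d u' h <= c)%N ->
  (d u u' <= L * s)%N -> off S L s z u -> off S L s z u' ->
  conn S (off S L' s z) (L' * s) u u'.
Proof.
move=> Fw0 Fo0 xy; have [F' [Fw Fo FF']] := overlapping_exists S x F.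
have xF : x \in F' by apply: FF'; exact: mem_head.
have sub a b k : crosses F a b k -> crosses F' a b k.
  move=> /andP[kg kh]; rewrite /crosses !mem_cell in kg kh *.
  by apply/andP; split; apply: FF'; rewrite inE ?kg ?kh orbT.
have fg q : adj x q -> finitely_generated (edge_group x q) by move=> /edge_hyp[].
have und q : adj x q -> undistorted R (val : edge_group x q -> G) by move=> /edge_hyp[].
have wide q : adj x q -> relatively_wide R (edge_in_vertex_group x q) by move=> /edge_hyp[].
have [S' _] := vertex_group_finitely_generated fg und Fw Fo xF.
have [A AP] := vertex_group_undistorted fg und Fw Fo xF S'.
have [r [pr prP]] := vertex_projection S xF.
pose c' := (c + r)%N; pose L1 := (A * L + A * (c + c') + A + 4 * L * A)%N.
have [D DP] := vertex_detour fg und wide S' Fw Fo xF r L1.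
pose K := (4 * L + 4 * (D * A) + 1)%N.
pose L' := (2 * L + D + 2 * L * c' + c' + 4 * (D * (A * A + A)) + 2 * (D * A) + A * D +
  2 * K + 2 * K * A + A * L1 + 1)%N.
exists (L' + 2 * c')%N => s h u u' z Ls h1 hh u1 uh uu uz uz'.
have s0 : (0 < s)%N by move: Ls; rewrite /L'; lia_goal.
pose w := pr h.
have xh : x \in cell F' h by case/andP: (sub _ _ _ hh).
have hw := prP h xh; rewrite wdistC -/w in hw.
have uw := wdist_leD uh hw; rewrite -/c' in uw.
have z1 : off S (2 * L) s z (val (1 : vertex_group x)).
  by apply: (off_near uz u1); move: Ls; rewrite /L' /c'; lia_goal.
have zw : off S (2 * L) s z (val w) by apply: (off_near uz' uw); move: Ls; rewrite /L'; lia_goal.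
have u1' := u1; rewrite wdistC in u1'.
have dw := wdist_leD u1' (wdist_leD uu uw).
have dw' : (wdist S' 1 w <= L1 * s)%N.
  have [h2 _] := AP 1 w; apply: (leq_trans h2).
  have h3 : (A * d (val (1%g : vertex_group x)) (val w) <= A * (c + (L * s + c')))%N.
    by rewrite leq_mul2l dw orbT.
  apply: (leq_trans (leq_add h3 (leqnn A))).
  have : ((A * (c + c') + A) * 1 <= (A * (c + c') + A) * s)%N by rewrite leq_mul2l s0 orbT.
  by rewrite /L1; lia_goal.
have mid : conn S (off S L' s z) (L' * s) (val (1 : vertex_group x)) (val w).
  have [[v vz]|far] := pselect (exists v : vertex_group x, K * d (val v) z <= s)%N.
    have off_v (t : vertex_group x) : off S (2 * L) s z (val t) -> off S' L1 s v t.
      move=> tz; rewrite /off in tz *.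
      have h2 : (2 * L * d (val t) z <= 2 * L * (d (val t) (val v) + d (val v) z))%N.
        by rewrite leq_mul2l wdist_triangle orbT.
      have h3 : (4 * L * d (val v) z <= K * d (val v) z)%N.
        by rewrite leq_mul2r /K; apply/orP; right; lia_goal.
      have [_ h4] := AP t v.
      have h5 : (4 * L * d (val t) (val v) <= 4 * L * (A * wdist S' t v))%N.
        by rewrite leq_mul2l h4 orbT.
      have h6 : (4 * L * A * wdist S' t v <= L1 * wdist S' t v)%N.
        by rewrite leq_mul2r /L1; apply/orP; right; lia_goal.
      by move: vz tz h2 h3 h5 h6; lia_goal.
    have path := DP s y 1 h 1 w v ltac:(move: Ls; rewrite /L'; lia_goal) xy (sub _ _ _ h1)
      (sub _ _ _ hh) ltac:(by rewrite wdistxx) (prP h xh) dw' (off_v _ z1) (off_v _ zw).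
    have lip (a b : vertex_group x) : (d (val a) (val b) <= A * wdist S' a b)%N.
      by have [] := AP a b.
    apply: (@conn_leq _ _ _ (A * (D * s))); first by rewrite mulnA leq_mul2r /L'; lia_goal.
    apply: (conn_lipschitz lip _ path) => a g; rewrite /off => az ag.
    have [h2 _] := AP a v.
    have h3 : (d (val a) (val v) <= A + (d g z + d (val v) z))%N.
      by rewrite (wdistC S (val v)); exact: wdist_leD ag (wdist_triangle S _ _ _).
    have h4 : (D * wdist S' a v <= D * (A * (A + (d g z + d (val v) z)) + A))%N.
      rewrite leq_mul2l (leq_trans h2) ?orbT// leq_add2r leq_mul2l h3 orbT//.
    have h5 : (4 * (D * A) * d (val v) z <= K * d (val v) z)%N.
      by rewrite leq_mul2r /K; apply/orP; right; lia_goal.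
    have h6 : (2 * (D * A) * d g z <= L' * d g z)%N.
      by rewrite leq_mul2r /L'; apply/orP; right; lia_goal.
    by move: Ls vz az h4 h5 h6; rewrite {1}/L'; lia_goal.
  have lip (a b : vertex_group x) : (d (val a) (val b) <= A * wdist S' a b)%N.
    by have [] := AP a b.
  have path := @conn_geodesic _ S' (fun=> True) 1 w (fun _ _ => I).
  apply: (@conn_leq _ _ _ (A * wdist S' 1 w)).
    have h2 : (A * wdist S' 1 w <= A * (L1 * s))%N by rewrite leq_mul2l dw' orbT.
    by apply: (leq_trans h2); rewrite mulnA leq_mul2r /L'; lia_goal.
  apply: (conn_lipschitz lip _ path) => a g _ ag.
  apply: (off_le (L := 2 * K)); first by rewrite /L'; lia_goal.
  apply: (off_near (x := val a) _ ag); last by move: Ls; rewrite /L'; lia_goal.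
  by rewrite /off leqNgt; apply/negP => near; apply: far; exists a; exact: ltnW.
have c2 : (2 * L <= L' + 2 * c')%N by rewrite /L'; lia_goal.
have path1 := conn_near uz u1 ltac:(move: Ls; rewrite /L' /c'; lia_goal).
have path2 := conn_sym (conn_near uz' uw ltac:(move: Ls; rewrite /L'; lia_goal)).
apply: (@conn_leq _ _ _ (c + (L' * s + c'))).
  have : (c' * 1 <= c' * s)%N by rewrite leq_mul2l s0 orbT.
  by rewrite /c' !mulnDl; lia_goal.
apply: conn_cat (conn_off_le c2 (leqnn _) path1) _.
apply: conn_cat _ (conn_off_le c2 (leqnn _) path2).
by apply: conn_off_le mid; rewrite ?leq_addr.
Qed.

(** Translation by the inverse of [g] moves the edge into [F], which contains finitely many
    edges. *)
Lemma crossing_detour (F : seq (vertex T)) L c : is_walk F -> overlapping S F ->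
  exists L', forall s a b g h u u' z, (L' <= s)%N -> adj a b ->
  crosses F a b g -> crosses F a b h -> (d u g <= c)%N -> (d u' h <= c)%N ->
  (d u u' <= L * s)%N -> off S L s z u -> off S L s z u' ->
  conn S (off S L' s z) (L' * s) u u'.
Proof.
move=> Fw Fo; pose Q (t : vertex T * vertex T) L' := adj t.1 t.2 ->
  forall s h u u' z, (L' <= s)%N ->
  crosses F t.1 t.2 1 -> crosses F t.1 t.2 h -> (d u 1 <= c)%N -> (d u' h <= c)%N ->
  (d u u' <= L * s)%N -> off S L s z u -> off S L s z u' ->
  conn S (off S L' s z) (L' * s) u u'.
have [||L' L'P] := @seq_bound _ [seq (x, y) | x <- F, y <- F] Q.
- move=> t m n mn h ta s k u u' z ns t1 tk u1 uk uu uz uz'.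
  apply: (conn_off_le mn); last by apply: (h ta s k) => //; exact: leq_trans ns.
  by rewrite leq_mul2r mn orbT.
- move=> [x y] _; have [xy|] := boolP (adj x y); last by move=> /negP no; exists 0%N => /no.
  by have [L' L'P] := edge_detour L c Fw Fo xy; exists L' => _ s h u u' z; exact: L'P.
exists L' => s a b g h u u' z Ls ab gc hc ug uh uu uz uz'.
have tF : (act g^-1 a, act g^-1 b) \in [seq (x, y) | x <- F, y <- F].
  by case/andP: gc => ga gb; apply: allpairs_f; rewrite -mem_cell.
have ab' : adj (act g^-1 a) (act g^-1 b) by rewrite act_adj.
have gd k l : d (g^-1 * k) (g^-1 * l) = d k l by exact: wdistM.
rewrite -(mulVKg g u) -(mulVKg g u').
apply: (@conn_map _ _ (off S L' s (g^-1 * z))).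
  by move=> k; rewrite /off -(wdistM S g) mulVKg.
apply: (L'P _ tF ab' s (g^-1 * h)) => //=.
- by rewrite -(mulVg g) crossesM.
- by rewrite crossesM.
- by rewrite -(mulVg g) gd.
- by rewrite gd.
- by rewrite gd.
- by rewrite /off gd.
- by rewrite /off gd.
Qed.

End CrossingDetour.
End Detours.

(** * Morse rays that cross the same edge *)

Section Projection.
Local Open Scope group_scope.
Context {G : groupType} (S : genset G).
Local Notation d := (wdist S).

Lemma projection_exists (r : nat -> G) u : exists k, forall j, (d u (r k) <= d u (r j))%N.
Proof.
have ex : exists D, `[< exists k, d u (r k) = D >] by exists (d u (r 0%N)); apply/asboolP; exists 0%N.
have [k kE] : exists k, d u (r k) = ex_minn ex by case: ex_minnP => D /asboolP.
exists k => j; rewrite kE; case: ex_minnP => D _; apply.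
by apply/asboolP; exists j.
Qed.

Lemma ray_dist r i j : ray S r -> d (r i) (r j) = (j - i + (i - j))%N.
Proof.
move=> [_ rr]; case: (leqP i j) => ij; first by rewrite rr//; move: ij; clear; lia.
by rewrite wdistC rr; [move: ij; clear; lia|exact: ltnW].
Qed.

(** [r k] is also a nearest point of the ray for every point of the geodesic from [u]. So the leg on
    the geodesic is at most the distance of the ends, and the leg on the ray at most twice that
    distance. *)
Lemma projection_quasi_geodesic r u k : ray S r ->
  (forall j, (d u (r k) <= d u (r j))%N) ->
  exists n q, [/\ q 0%N = u, q n = 1, qgeod S 3 n q & exists2 i, (i <= n)%N & q i = r k].
Proof.
move=> rr kmin; have [f [f0 fn fg]] := geodesic_segment S u (r k).
set n := d u (r k) in fn fg kmin.
exists (n + k)%N, (fun i => if (i <= n)%N then f i else r (k - (i - n))%N); split => //.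
- case: leqP => h; last by rewrite addKn subnn; case: rr.
  have k0 : k = 0%N by move: h; clear; lia.
  by rewrite k0 addn0 fn k0; case: rr.
- move=> i j ik jk ij; case: (leqP j n) => jn.
    by rewrite (leq_trans ij jn) fg ?ij//; clear; lia.
  case: (leqP i n) => i_n; last first.
    rewrite ray_dist//; move: ij jk jn i_n; clear; lia.
  have fik : d (f i) (r k) = (n - i)%N by rewrite -fn fg// i_n leqnn.
  have rjk : d (r k) (r (k - (j - n))%N) = (j - n)%N by rewrite ray_dist//; move: jk jn; clear; lia.
  have fui : d u (f i) = i by rewrite -f0 fg ?subn0.
  have h1 := wdist_triangle S (r k) (f i) (r (k - (j - n))%N).
  have h2 := wdist_triangle S (f i) (r k) (r (k - (j - n))%N).
  have h3 := wdist_triangle S (f i) u (r (k - (j - n))%N).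
  have h4 := kmin (k - (j - n))%N.
  rewrite (wdistC S (r k) (f i)) in h2.
  move: fik rjk fui h1 h2 h3 h4 jn i_n; clear; lia.
by exists n; rewrite ?leq_addr// leqnn.
Qed.

End Projection.

Section CrossingRays.
Local Open Scope group_scope.
Context {R : realType} {G : groupType} (S : genset G) {T : splitting G}.
Hypothesis edge_hyp : forall p q : vertex T, adj p q ->
  [/\ finitely_generated (edge_group p q),
      undistorted R (val : edge_group p q -> G) &
      relatively_wide R (edge_in_vertex_group p q)].
Context {F : seq (vertex T)}.
Hypotheses (Fw : is_walk F) (Fo : overlapping S F).
Local Notation d := (wdist S).

(* The point halfway between r t and the projection of u would be bypassed by a
   detour from r t to u followed by a geodesic from u to its projection. *)
Lemma far_projection f c : exists D, forall r t u k a b g h, ray S r -> diverges S f r ->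
  adj a b -> crosses F a b g -> crosses F a b h -> (d (r t) g <= c)%N -> (d u h <= c)%N ->
  (forall j, (d u (r k) <= d u (r j))%N) -> (d (r t) u <= 4 * d (r t) (r k))%N ->
  (d (r t) u <= D)%N.
Proof.
have [L' L'P] := crossing_detour edge_hyp 64 c Fw Fo.
pose L3 := (2 * L' + 64 + 2)%N; pose S0 := (f L3 + L' + 1)%N.
exists (32 * S0 + 32)%N => r t u k a b g h rr rf ab gc hc rg uh kmin far.
pose tau := d (r t) (r k); have tauE := ray_dist t k rr; rewrite -/tau in far tauE.
(* The point [r m] will lie 4s from [r k] towards [r t], about halfway. Since [s] is positive, 4 tau
   is at most 64 s, whence the constant 64 for [crossing_detour]. *)
pose s := (tau %/ 8)%N.
have s8 : (8 * s <= tau < 8 * s + 8)%N.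
  rewrite /s; move: (divn_eq tau 8) (ltn_pmod tau (isT : 0 < 8)%N); clear; lia.
rewrite leqNgt; apply/negP => big.
have sS : (S0 <= s)%N by move: big far s8; clear; lia.
have [s0 sL sf] : [/\ 0 < s, L' <= s & f L3 <= s]%N by split; move: sS; rewrite /S0; clear; lia.
pose m := (if k <= t then k + 4 * s else k - 4 * s)%N.
have mk : d (r k) (r m) = (4 * s)%N.
  by rewrite ray_dist// /m; case: (leqP k t) => h'; move: tauE s8 h'; clear; lia.
have mt : (4 * s <= d (r t) (r m))%N.
  by rewrite ray_dist// /m; case: (leqP k t) => h'; move: tauE s8 h'; clear; lia.
(* By the choice of [k], such a [w] is at least as far from [r m] as from [r k], and these two are
   4s apart. *)
have near w : (d u w + d w (r k) <= d u (r k))%N -> (2 * s <= d w (r m))%N.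
  move=> wk; have h1 := kmin m; have h2 := wdist_triangle S w u (r m).
  have h3 := wdist_triangle S w (r k) (r m); rewrite (wdistC S (r k) w) in h3.
  move: wk h1 h2 h3 mk; clear; lia.
have uk : (d u (r k) <= d (r t) u)%N by rewrite (wdistC S (r t)); exact: kmin.
have tu : (d (r t) u <= 64 * s)%N by move: far s8 s0; clear; lia.
have path1 : conn S (off S L' s (r m)) (L' * s) (r t) u.
  apply: (L'P s a b g h) => //; rewrite /off.
    by move: mt; clear; lia.
  by have := near u; rewrite wdistxx leqnn => /(_ isT); clear; lia.
have path2 : conn S (off S 1 s (r m)) (64 * s) u (r k).
  apply: (conn_leq (leq_trans uk tu)); apply: conn_geodesic => w /near.
  by rewrite /off; clear; lia.
have L1 : (L' <= L'.+1)%N by [].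
have path3 := conn_cat (conn_off_le L1 (leqnn _) path1)
  (conn_off_le (isT : 1 <= L'.+1)%N (leqnn _) path2).
have path4 : conn S (fun w => s < L3 * d w (r m))%N (L' * s + 64 * s) (r t) (r k).
  apply: conn_sub path3 => w; rewrite /off => h1.
  have : (2 * L'.+1 * d w (r m) <= L3 * d w (r m))%N.
    by rewrite leq_mul2r /L3; apply/orP; right; clear; lia.
  by move: h1 s0; clear; lia.
have len : (L' * s + 64 * s <= L3 * s)%N by rewrite -mulnDl leq_mul2r /L3; apply/orP; right; clear; lia.
case: (leqP k t) => kt.
  apply: (rf L3 s k t m _ sf _ _ len (conn_sym path4)); rewrite /m kt.
    by clear; lia.
  by move: tauE s8 kt; clear; lia.
have kt' : (k <= t)%N = false by rewrite leqNgt kt.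
apply: (rf L3 s t k m _ sf _ _ len path4); rewrite /m kt'.
  by move: tauE s8 kt; clear; lia.
by move: tauE s8 kt; clear; lia.
Qed.

(** Let delta be the distance in question. If [r t] is at least delta/4 away from the projection of
    [r' t'] to [r], or the same holds with the rays exchanged, [far_projection] applies. Otherwise
    the path from [r' t'] to its projection [r k] and back along [r] to 1 shows that [r k] is within
    [N 3] of [r'], so that delta is at most delta/4 + [N 3] + delta/4. *)
Lemma crossing_rays N c : exists D, forall a b g h r r' t t', adj a b ->
  crosses F a b g -> crosses F a b h -> ray S r -> ray S r' -> morse S N r ->
  morse S N r' -> (d (r t) g <= c)%N -> (d (r' t') h <= c)%N -> (d (r t) (r' t') <= D)%N.
Proof.
have [f fP] := morse_diverges S 1 N; have [D DP] := far_projection f c.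
exists (D + 2 * N 3)%N => a b g h r r' t t' ab gc hc rr rr' rN r'N tg t'h.
have rf := fP r (ray_qray rr) rN; have r'f := fP r' (ray_qray rr') r'N.
have [k kmin] := projection_exists S r (r' t'); have [k' k'min] := projection_exists S r' (r t).
have [far|near] := leqP (d (r t) (r' t')) (4 * d (r t) (r k)).
  by rewrite (leq_trans (DP _ _ _ _ _ _ _ _ rr rf ab gc hc tg t'h kmin far))// leq_addr.
have [far|near'] := leqP (d (r' t') (r t)) (4 * d (r' t') (r' k')).
  by rewrite wdistC (leq_trans (DP _ _ _ _ _ _ _ _ rr' r'f ab hc gc t'h tg k'min far))// leq_addr.
have [n [q [q0 qn q3 [i i_n qi]]]] := projection_quasi_geodesic rr kmin.
have [||j jP] := r'N 3 n q t' 0%N q3 _ _ i i_n.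
- by rewrite q0 wdistxx.
- by rewrite qn; case: rr' => -> _; rewrite wdistxx.
have h1 := k'min j; rewrite qi in jP.
have h2 := wdist_triangle S (r k) (r t) (r' j).
have h3 := wdist_triangle S (r' k') (r t) (r' t').
rewrite (wdistC S (r' k')) in h3; rewrite (wdistC S (r' t') (r t)) in near'.
by move: near near' jP h1 h2 h3; clear; lia.
Qed.

(** Compares the crossing with a fixed one, [g0], which is regarded as close to the origin of the
    same ray. *)
Lemma crossing_bounded a b N c : adj a b -> exists D, forall r n g, ray S r ->
  morse S N r -> crosses F a b g -> (d (r n) g <= c)%N -> (n <= D)%N.
Proof.
move=> ab; have [[g0 g0c]|no] := pselect (exists g, crosses F a b g); last first.
  by exists 0%N => r n g _ _ gc; case: no; exists g.
have [D DP] := crossing_rays N (c + d 1 g0).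
exists D => r n g rr rN gc ng; rewrite -(ray_dist1 n rr).
have r0 : r 0%N = 1 by case: rr.
rewrite -{1}r0; apply: (DP a b g0 g r r 0%N n) => //.
  by rewrite r0 leq_addl.
by rewrite (leq_trans ng)// leq_addr.
Qed.

End CrossingRays.

(** * Morse boundaries in terms of discrete rays *)

Section RealRays.
Local Open Scope ring_scope.
Local Open Scope quotient_scope.

Section CayleyGraph.
Context {R : realType} {G : groupType} (S : genset G).
Local Notation d := (wdist S).
Local Notation X := (cayley_graph R S).
Local Notation vp := (@vertex_point R G S).
Implicit Types (x y : X) (g u v w : G) (t : R).

Definition edge_graph_point u v t (h : on_edge S (u, v, t)) : X :=
  \pi_(metric_quotient (edge_pseudodist S)) (exist _ (u, v, t) h : edge_point S).

Lemma edge_graph_point_surj x : exists u v t h, x = @edge_graph_point u v t h.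
Proof.
rewrite -[x]reprK; case: (repr x) => [[[u v] t] h].
by exists u, v, t, h.
Qed.

Lemma mdist_edge_vertex u v t (h : on_edge S (u, v, t)) w :
  mdist (edge_graph_point h) (vp w) =
  Num.min (t * (d u v)%:R + (d u w)%:R) ((1 - t) * (d u v)%:R + (d v w)%:R).
Proof.
rewrite /edge_graph_point /vertex_point mdist_pi /= /edge_dist /vertex_dist.
rewrite /src_dist /tgt_dist /src /tgt /=.
case: ifP => [/andP[/eqP -> /eqP ->]|_]; first by rewrite !wdistxx !mulr0 !addr0 subrr normr0 minxx.
case: ifP => [/andP[/eqP -> /eqP ->]|_]; first by rewrite !wdistxx !mulr0 !addr0 subrr normr0 minxx.
by rewrite !wdistxx !mulr0 !addr0 minxx.
Qed.

Lemma mdist_vertex g (h : G) : mdist (vp g) (vp h) = (d g h)%:R.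
Proof.
rewrite -[vp g]/(edge_graph_point (on_edge_vertex (R := R) S g)) mdist_edge_vertex.
by rewrite wdistxx !mulr0 !add0r minxx.
Qed.

Lemma mdist_edge_src u v t (h : on_edge S (u, v, t)) :
  mdist (edge_graph_point h) (vp u) = t * (d u v)%:R.
Proof.
rewrite mdist_edge_vertex wdistxx addr0 (wdistC S v u).
case/andP: (h) => /= _ /andP[t0 t1]; apply/min_idPl.
have : 0 <= (d u v)%:R :> R by [].
by nra.
Qed.

Lemma mdist_edge_tgt u v t (h : on_edge S (u, v, t)) :
  mdist (edge_graph_point h) (vp v) = (1 - t) * (d u v)%:R.
Proof.
rewrite mdist_edge_vertex wdistxx addr0.
case/andP: (h) => /= _ /andP[t0 t1]; apply/min_idPr.
have : 0 <= (d u v)%:R :> R by [].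
by nra.
Qed.

Lemma mdist_same_edge u v t t' (h : on_edge S (u, v, t)) (h' : on_edge S (u, v, t')) :
  mdist (edge_graph_point h) (edge_graph_point h') = `|t - t'| * (d u v)%:R.
Proof.
rewrite /edge_graph_point mdist_pi /= /edge_dist /src_dist /src /tgt /= !eqxx /=.
by rewrite -mulrBl normrM [X in _ * X]ger0_norm.
Qed.

Lemma mdist_swap_edge u v t t' (h : on_edge S (u, v, t)) (h' : on_edge S (v, u, t')) :
  d u v = 1%N -> mdist (edge_graph_point h) (edge_graph_point h') = `|t - (1 - t')|.
Proof.
move=> uv; rewrite /edge_graph_point mdist_pi /= /edge_dist /src_dist /tgt_dist /src /tgt /= !eqxx /=.
have -> : (u == v) = false by apply/eqP => e; move: uv; rewrite e wdistxx.
by rewrite /= (wdistC S v u) uv !mulr1.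
Qed.

Lemma vertex_near x : exists g, mdist x (vp g) <= 1.
Proof.
have [u [v [t [h ->]]]] := edge_graph_point_surj x; exists u.
rewrite mdist_edge_src; case/andP: (h) => /= uv /andP[t0 t1].
have : (d u v)%:R <= 1 :> R by rewrite -[1]/(1%:R) ler_nat.
have : 0 <= (d u v)%:R :> R by [].
by nra.
Qed.

(** Makes geodesic rays based at the vertex 1 pass through vertices at all integral times. *)
Lemma vertex_integral x n : mdist x (vp 1%g) = n%:R -> exists g, x = vp g.
Proof.
have [u [v [t [h xE]]]] := edge_graph_point_surj x; rewrite xE.
case/andP: (h) => /= uv /andP[t0 t1].
have is_src : t * (d u v)%:R = 0 -> exists g, edge_graph_point h = vp g.
  by move=> tu; exists u; apply: mdist_positivity; rewrite mdist_edge_src.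
have is_tgt : (1 - t) * (d u v)%:R = 0 -> exists g, edge_graph_point h = vp g.
  by move=> tu; exists v; apply: mdist_positivity; rewrite mdist_edge_tgt.
move: uv; rewrite leq_eqVlt => /orP[/eqP uv|]; last first.
  by rewrite ltnS leqn0 => /eqP uv _; apply: is_src; rewrite uv mulr0.
rewrite mdist_edge_vertex uv !mulr1 in is_src is_tgt *.
have integral (s : R) (k : nat) : 0 <= s <= 1 -> s + k%:R = n%:R -> s = 0 \/ s = 1.
  move=> /andP[s0 s1] sk; have kn : (k <= n)%N by rewrite -(ler_nat R); lra.
  have : s = (n - k)%:R by rewrite natrB//; lra.
  case: (n - k)%N => [|[|m]] e; [by left|by right|].
  by move: s1; rewrite e -natr1 -natr1; have : 0 <= m%:R :> R by []; lra.
rewrite minElt; case: ifP => _ /integral [|s0|s1].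
- by rewrite t0 t1.
- exact: is_src.
- by apply: is_tgt; rewrite s1 subrr.
- by apply/andP; split; lra.
- exact: is_tgt.
- by apply: is_src; lra.
Qed.

(** For 0 < t < 1 both distances are below 1, which by integrality of the word metric forces the
    edge carrying [x] to have the ends [g] and [h]. *)
Lemma edge_point_unique x g (h : G) t (e : on_edge S (g, h, t)) : d g h = 1%N ->
  mdist x (vp g) = t -> mdist x (vp h) = 1 - t -> x = edge_graph_point e.
Proof.
move=> gh xg xh; apply: mdist_positivity.
case/andP: (e) => /= _ /andP[t0 t1].
have [tz|tz] := eqVneq t 0.
  have -> : x = vp g by apply: mdist_positivity; rewrite xg.
  by rewrite metric_sym mdist_edge_src tz mul0r.
have [ty|ty] := eqVneq t 1.
  have -> : x = vp h by apply: mdist_positivity; rewrite xh ty subrr.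
  by rewrite metric_sym mdist_edge_tgt ty subrr mul0r.
have tp : 0 < t < 1 by rewrite !lt_neqAle t0 t1 ty eq_sym tz.
have [u [v [s [k xE]]]] := edge_graph_point_surj x.
rewrite xE !mdist_edge_vertex in xg xh *.
case/andP: (k) => /= uv /andP[s0 s1].
have nat_lt1 (a b : G) : (d a b)%:R < 1 :> R -> a = b.
  by rewrite -[1]/(1%:R) ltr_nat ltnS leqn0 => /eqP ab; exact: wdist_eq0 ab.
have d0 (a b : G) : 0 <= (d a b)%:R :> R by [].
have [u0 v0] := (d0 u v, d0 v u).
have p1 : 0 <= s * (d u v)%:R by exact: mulr_ge0.
have p2 : 0 <= (1 - s) * (d u v)%:R by apply: mulr_ge0 => //; lra.
have near_g : u = g \/ v = g.
  move: xg; rewrite minElt; case: ifP => _ e1; [left|right]; apply: nat_lt1; lra.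
have near_h : u = h \/ v = h.
  move: xh; rewrite minElt; case: ifP => _ e1; [left|right]; apply: nat_lt1; lra.
have g_ne_h : g <> h by move=> E; move: gh; rewrite E wdistxx.
case: near_g near_h => [ug|vg] [uh|vh].
- by case: g_ne_h; rewrite -ug -uh.
- subst u v; rewrite mdist_same_edge gh mulr1.
  move: xg; rewrite gh !mulr1 wdistxx (wdistC S h g) gh minElt; case: ifP => [_|/negbT]; first by rewrite addr0 => ->; rewrite subrr normr0.
  by rewrite -leNgt => ? ?; apply/eqP; rewrite normr_eq0; apply/eqP; lra.
- subst u v; rewrite mdist_swap_edge ?(wdistC S h g)//.
  move: xg; rewrite (wdistC S h g) gh !mulr1 wdistxx minElt; case: ifP => [a|_] b;
  by apply/eqP; rewrite normr_eq0; apply/eqP; lra.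
- by case: g_ne_h; rewrite -vg -vh.
Qed.

End CayleyGraph.

Section HalfLine.
Context {R : realType}.

Lemma at_time_subproof (t : R) : Num.max t 0 \in [set t : R | 0 <= t].
Proof. by apply/mem_set; rewrite /= le_max lexx orbT. Qed.

Definition at_time (t : R) : @half_line R := exist _ (Num.max t 0) (at_time_subproof t).

Lemma time_at_time (t : R) : 0 <= t -> time (at_time t) = t.
Proof. by move=> t0; rewrite /time /at_time /=; apply/max_idPl. Qed.

Lemma time_ge0 (t : @half_line R) : 0 <= time t.
Proof. by have := valP t; rewrite inE. Qed.

Lemma time_inj : injective (@time R). Proof. exact: val_inj. Qed.

End HalfLine.

Section CayleyRays.
Context {R : realType} {G : groupType} (S : genset G).
Local Notation d := (wdist S).
Local Notation X := (cayley_graph R S).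
Local Notation vp := (@vertex_point R G S).
Implicit Types (c : @half_line R -> X) (r : nat -> G).

Definition follows c r := forall n, c (at_time n%:R) = vp (r n).

Lemma on_edge_ray r (rr : ray S r) n (t : R) : 0 <= t <= 1 -> on_edge S (r n, r n.+1, t).
Proof.
by move=> t01; rewrite /on_edge /= t01 andbT (proj2 rr)// subSnn.
Qed.

Lemma frac_bounds (t : @half_line R) : 0 <= time t - (Num.truncn (time t))%:R <= 1.
Proof.
have /andP[h1 h2] := truncn_itv (time_ge0 t); move: h2; rewrite -natr1; lra.
Qed.

Definition graph_ray r (rr : ray S r) (t : @half_line R) : X :=
  edge_graph_point (on_edge_ray rr (Num.truncn (time t)) (frac_bounds t)).

Lemma ray_step r n : ray S r -> d (r n) (r n.+1) = 1%N.
Proof. by move=> [_ ->//]; rewrite subSnn. Qed.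

Lemma graph_ray_src r (rr : ray S r) t :
  mdist (graph_ray rr t) (vp (r (Num.truncn (time t)))) = time t - (Num.truncn (time t))%:R.
Proof. by rewrite /graph_ray mdist_edge_src ray_step// mulr1. Qed.

Lemma graph_ray_tgt r (rr : ray S r) t :
  mdist (graph_ray rr t) (vp (r (Num.truncn (time t)).+1)) =
  (Num.truncn (time t)).+1%:R - time t.
Proof. by rewrite /graph_ray mdist_edge_tgt ray_step// mulr1 -natr1; lra. Qed.

Lemma follows_graph_ray r (rr : ray S r) : follows (graph_ray rr) r.
Proof.
move=> n; apply: mdist_positivity; have := graph_ray_src rr (at_time n%:R).
by rewrite time_at_time// natrK subrr.
Qed.

Lemma graph_ray_geodesic r (rr : ray S r) : is_geodesic_ray (vp 1%g) (graph_ray rr).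
Proof.
split=> [t t0|].
  have -> : t = at_time 0%:R by apply: time_inj; rewrite time_at_time.
  by rewrite follows_graph_ray; case: rr => ->.
suff main s t : time s <= time t -> mdist (graph_ray rr s) (graph_ray rr t) = time t - time s.
  move=> s t; case: (leP (time s) (time t)) => st.
    by rewrite main// distrC ger0_norm// subr_ge0.
  by rewrite metric_sym main ?(ltW st)// ger0_norm// subr_ge0 ltW.
move=> st; have hs := graph_ray_src rr s; have ht := graph_ray_src rr t.
have hs' := graph_ray_tgt rr s; have ht' := graph_ray_tgt rr t.
set n := Num.truncn (time s) in hs hs' *; set m := Num.truncn (time t) in ht ht' *.
have nm : (n <= m)%N by exact: le_truncn.
have [e|ne] := eqVneq n m.
  have : forall k (kn : k = Num.truncn (time t)) (h : on_edge S (r k, r k.+1, time t - k%:R)),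
      edge_graph_point h = graph_ray rr t.
    by move=> k -> h; rewrite /graph_ray; congr edge_graph_point; exact: bool_irrelevance.
  move=> /(_ n e) ht2.
  have bt : 0 <= time t - n%:R <= 1 by rewrite e; exact: frac_bounds.
  rewrite -(ht2 (on_edge_ray rr n bt)) /graph_ray mdist_same_edge ray_step// mulr1.
  rewrite -/n distrC ger0_norm; lra.
have nm' : (n < m)%N by rewrite ltn_neqAle ne.
(* The upper bound passes through [r n.+1] and [r m]; the lower one compares with [r n] and
   [r m.+1], which are m + 1 - n apart. *)
have h1 := metric_triangle (graph_ray rr s) (vp (r n.+1)) (graph_ray rr t).
have h2 := metric_triangle (vp (r n.+1)) (vp (r m)) (graph_ray rr t).
have h3 := metric_triangle (vp (r n)) (graph_ray rr s) (vp (r m.+1)).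
have h4 := metric_triangle (graph_ray rr s) (graph_ray rr t) (vp (r m.+1)).
rewrite (metric_sym (vp (r n)) (graph_ray rr s)) in h3.
rewrite (metric_sym (vp (r m)) (graph_ray rr t)) in h2.
rewrite mdist_vertex (proj2 rr)// in h2.
rewrite mdist_vertex (proj2 rr) in h3; last by rewrite (leq_trans nm).
rewrite natrB// in h2; rewrite natrB in h3; last by rewrite (leq_trans nm).
rewrite -!natr1 in hs' ht' h2 h3; lra.
Qed.

Lemma geodesic_ray_follows c : is_geodesic_ray (vp 1%g) c ->
  exists2 r, ray S r & follows c r.
Proof.
move=> [c0 cg].
have c00 : c (at_time 0) = vp 1%g by apply: c0; rewrite time_at_time.
have /choice[r rP] n : exists g, c (at_time n%:R) = vp g.
  apply: (@vertex_integral _ _ _ _ n).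
  by rewrite -c00 cg !time_at_time// subr0 ger0_norm.
exists r => //; split=> [|i j ij].
  apply: (wdist_eq0 (S := S)); apply/eqP; rewrite -(eqr_nat R) -mdist_vertex -rP.
  by rewrite c00 mdistxx.
apply/eqP; rewrite -(eqr_nat R) -mdist_vertex -!rP cg !time_at_time// distrC ger0_norm.
  by rewrite natrB.
by rewrite subr_ge0 ler_nat.
Qed.

Lemma follows_unique c r (rr : ray S r) : is_geodesic_ray (vp 1%g) c ->
  forall t, (forall n, n%:R <= time t + 1 -> c (at_time n%:R) = vp (r n)) ->
  c t = graph_ray rr t.
Proof.
move=> [_ cg] t cr; have t0 := time_ge0 t; have /andP[n1 n2] := truncn_itv t0.
set n := Num.truncn (time t) in n1 n2.
apply: edge_point_unique; first exact: ray_step.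
  rewrite -cr; last by rewrite -/n; lra.
  by rewrite cg time_at_time// ger0_norm// subr_ge0.
rewrite -/n -cr; last by rewrite -natr1; lra.
rewrite cg time_at_time// distrC ger0_norm -?natr1; last by rewrite -natr1 in n2; lra.
by rewrite opprB addrCA; lra.
Qed.

Lemma follows_near c r t : is_geodesic_ray (vp 1%g) c -> follows c r ->
  mdist (c t) (vp (r (Num.truncn (time t)))) <= 1.
Proof.
move=> [_ cg] cr; rewrite -cr cg time_at_time//.
have /andP[h1 h2] := frac_bounds t; rewrite ger0_norm; lra.
Qed.

Lemma asymptotic_close c c' r r' : is_geodesic_ray (vp 1%g) c ->
  is_geodesic_ray (vp 1%g) c' -> follows c r -> follows c' r' ->
  asymptotic c c' <-> exists K, close_to S K r r'.
Proof.
move=> cg c'g cr c'r; split=> [[M [cM c'M]]|[K [rK r'K]]].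
  exists (Num.truncn (M + 1)); split => i.
    have [t ht] := cM (at_time i%:R); exists (Num.truncn (time t)).
    rewrite -ltnS -(ltr_nat R) -mdist_vertex (le_lt_trans _ (truncnS_gt _))//.
    have := follows_near t c'g c'r; rewrite cr in ht.
    have := metric_triangle (vp (r i)) (c' t) (vp (r' (Num.truncn (time t)))); lra.
  have [t ht] := c'M (at_time i%:R); exists (Num.truncn (time t)).
  rewrite -ltnS -(ltr_nat R) -mdist_vertex (le_lt_trans _ (truncnS_gt _))//.
  have := follows_near t cg cr; rewrite c'r in ht; rewrite metric_sym.
  have := metric_triangle (vp (r (Num.truncn (time t)))) (c t) (vp (r' i)); lra.
exists (K%:R + 1); split => t.
  have [j hj] := rK (Num.truncn (time t)); exists (at_time j%:R).
  rewrite -(ler_nat R) -mdist_vertex in hj.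
  have := follows_near t cg cr; rewrite c'r.
  have := metric_triangle (c t) (vp (r (Num.truncn (time t)))) (vp (r' j)); lra.
have [j hj] := r'K (Num.truncn (time t)); exists (at_time j%:R).
rewrite -(ler_nat R) -mdist_vertex in hj.
have := follows_near t c'g c'r; rewrite cr metric_sym.
have := metric_triangle (vp (r j)) (vp (r' (Num.truncn (time t)))) (c' t); lra.
Qed.

End CayleyRays.

Section Gauges.
Context {R : realType} {G : groupType} (S : genset G).
Local Notation d := (wdist S).
Local Notation X := (cayley_graph R S).
Local Notation vp := (@vertex_point R G S).
Implicit Types (c : @half_line R -> X) (r : nat -> G).

(** The Morse condition in the Cayley graph wants endpoints on the ray, the discrete one only near
    it; two extra points bridge the gap. *)
Lemma qgeod_extend A n q u v : qgeod S A n q -> (d (q 0%N) u <= A)%N ->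
  (d (q n) v <= A)%N -> exists q', [/\ q' 0%N = u, q' n.+2 = v,
    qgeod S (2 * A * A + 3 * A + 2) n.+2 q' & forall i, (i <= n)%N -> q' i.+1 = q i].
Proof.
move=> qA qu qv.
exists (fun i => if i == 0%N then u else if (n.+1 < i)%N then v else q i.-1).
split => //; [by rewrite /= ltnSn| |by move=> i i_n; rewrite /= ltnNge ltnS i_n].
set q' := fun i => _; pose idx i := minn i.-1 n.
have near i : (d (q' i) (q (idx i)) <= A)%N.
  rewrite /q' /idx; case: i => [|i] /=; first by rewrite min0n wdistC.
  case: ltnP => h; first by rewrite (_ : minn i n = n) 1?wdistC//; move: h; clear; lia.
  by rewrite (_ : minn i n = i) ?wdistxx//; move: h; clear; lia.
move=> i j i_n jn ij.
have [|||h1 h2] := qA (idx i) (idx j); rewrite /idx; try (move: ij; clear; lia).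
have h3 := near i; have h4 := near j; rewrite wdistC in h4.
have h5 := wdist_leD h3 (wdist_leD h1 h4).
have h6 : (d (q (idx i)) (q (idx j)) <= A + (d (q' i) (q' j) + A))%N.
  by apply: wdist_leD; [rewrite wdistC|apply: wdist_leD (near j)].
have h7 : (A * d (q (idx i)) (q (idx j)) <= A * (A + (d (q' i) (q' j) + A)))%N.
  by rewrite leq_mul2l h6 orbT.
have h8 : (A * (idx j - idx i) <= A * (j - i))%N.
  by rewrite leq_mul2l /idx; apply/orP; right; move: ij; clear; lia.
have h9 : (j - i <= (idx j - idx i) + 2)%N.
  by rewrite /idx; move: i_n jn ij; clear; lia.
have h10 : (A * (j - i) <= (2 * A * A + 3 * A + 2) * (j - i))%N.
  by rewrite leq_mul2r; apply/orP; right; clear; lia.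
have h11 : (A * d (q' i) (q' j) <= (2 * A * A + 3 * A + 2) * d (q' i) (q' j))%N.
  by rewrite leq_mul2r; apply/orP; right; clear; lia.
rewrite -/(idx i) -/(idx j) in h1 h2; rewrite mulnDr mulnDr in h7.
split; [move: h5 h8 h10; clear; lia|move: h2 h7 h9 h11; clear; lia].
Qed.

(* Discrete quasi-geodesics are read as step functions. *)
Lemma real_morse_discrete (N : morse_gauge R) : exists N', forall c r,
  is_geodesic_ray (vp 1%g) c -> follows c r -> is_morse N c -> morse S N' r.
Proof.
pose B A : nat := (2 * A * A + 3 * A + 2)%N; pose C A : R := (2 * B A + 1)%:R.
exists (fun A => Num.truncn (N (C A) + 1)) => c r cg cr cN A n q a b qA qa qb i i_n.
have [q' [q'0 q'n q'B q'q]] := qgeod_extend qA qa qb.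
have C1 : 1 <= C A by rewrite /C -[1]/(1%:R) ler_nat addn1.
have C0 : 0 < C A by lra.
pose Q (t : R) : X := vp (q' (Num.truncn t)).
have Qqg : is_quasi_geodesic (C A) 0 n.+2%:R Q.
  suff main s t : 0 <= s -> s <= t -> t <= n.+2%:R ->
      (C A)^-1 * `|s - t| - C A <= mdist (Q s) (Q t) <= C A * `|s - t| + C A.
    move=> s t; rewrite !in_itv /= => /andP[s0 sn] /andP[t0 tn].
    by case: (leP s t) => [/main|/ltW/main]; [exact|rewrite distrC metric_sym; exact].
  move=> s0 st tn; have t0 := le_trans s0 st.
  rewrite distrC ger0_norm ?subr_ge0// mdist_vertex.
  have /andP[s1 s2] := truncn_itv s0; have /andP[t1 t2] := truncn_itv t0.
  have ij : (Num.truncn s <= Num.truncn t)%N by exact: le_truncn.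
  have jn : (Num.truncn t <= n.+2)%N by rewrite -(ler_nat R); lra.
  have [h1 h2] := q'B _ _ (leq_trans ij jn) jn ij.
  rewrite -/(B A) in h1 h2; rewrite -(ler_nat R) natrD natrM natrB// in h1.
  rewrite -(ler_nat R) natrD natrM natrB// in h2.
  rewrite -natr1 in s2; rewrite -natr1 in t2.
  have B0 : 0 <= (B A)%:R :> R by [].
  have B2 : 2 <= (B A)%:R :> R by rewrite ler_nat /B addn2.
  have D0 : 0 <= (d (q' (Num.truncn s)) (q' (Num.truncn t)))%:R :> R by [].
  have CE : C A = 2 * (B A)%:R + 1 by rewrite /C natrD natrM.
  apply/andP; split; last by rewrite CE; nra.
  by rewrite lerBlDr ler_pdivrMl// CE; nra.
have [||||s sP] := cN (C A) 0 n.+2%:R Q C1 _ Qqg _ _ i.+1%:R.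
- by [].
- by exists (at_time a%:R) => //; rewrite cr /Q truncn0 q'0.
- by exists (at_time b%:R) => //; rewrite cr /Q natrK q'n.
- by rewrite in_itv /= ler0n ler_nat; move: i_n; clear; lia.
exists (Num.truncn (time s)); rewrite -ltnS -(ltr_nat R) -mdist_vertex.
rewrite (le_lt_trans _ (truncnS_gt _))//.
have := follows_near s cg cr; rewrite /Q natrK q'q// in sP.
have := metric_triangle (vp (q i)) (c s) (vp (r (Num.truncn (time s)))); lra.
Qed.

(** The quasi-geodesic is sampled at a, a + 1, ..., a + n and b, and samples are moved to vertices
    within 1. In [N], the term [2 * C] pays for the motion since the last sample and 1 for the
    vertex. *)
Lemma discrete_morse_real (N' : nat -> nat) : exists N : morse_gauge R, forall c r,
  is_geodesic_ray (vp 1%g) c -> follows c r -> morse S N' r -> is_morse N c.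
Proof.
pose k (C : R) := (Num.truncn C).+1; pose A C := (k C * (k C + 2) + k C + 3)%N.
pose N C : R := 2 * C + 1 + (N' (A C))%:R.
have N0 C : 1 <= C -> 0 <= N C.
  by move=> C1; rewrite /N; have : 0 <= (N' (A C))%:R :> R by []; lra.
exists (MorseGauge N0) => c r cg cr rN C a b q C1 ab qC ra rb t tab.
have Ck : C <= (k C)%:R by apply/ltW/truncnS_gt.
have k0 : 1 <= (k C)%:R :> R by rewrite -[1]/(1%:R) ler_nat.
have /choice[g gP] : forall x : X, exists g, mdist x (vp g) <= 1 by exact: vertex_near.
pose n := Num.truncn (b - a); pose time_of i := if (i <= n)%N then a + i%:R else b.
have ba : 0 <= b - a by lra.
have /andP[n1 n2] := truncn_itv ba; rewrite -/n -natr1 in n1 n2.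
have time_le i : (i <= n)%N -> a + i%:R <= b.
  by move=> i_n; have : i%:R <= n%:R :> R by [rewrite ler_nat]; lra.
have time_in i : a <= time_of i <= b.
  rewrite /time_of; case: ifP => [/time_le h|_]; last by rewrite ab lexx.
  by rewrite h andbT; have : 0 <= i%:R :> R by []; lra.
have time_diff i j : (i <= j)%N -> (j <= n.+1)%N ->
    (j - i)%:R - 1 <= time_of j - time_of i <= (j - i)%:R.
  move=> ij jn; rewrite /time_of natrB//.
  have ijR : i%:R <= j%:R :> R by rewrite ler_nat.
  case: (leqP j n) => h.
    by rewrite (leq_trans ij h); apply/andP; split; lra.
  have -> : j = n.+1 by move: h jn; clear; lia.
  rewrite -natr1; case: (leqP i n) => h'.
    have := time_le _ h'; have : i%:R <= n%:R :> R by rewrite ler_nat.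
    by move=> *; apply/andP; split; lra.
  have -> : i = n.+1 by move: h' ij jn; clear; lia.
  by rewrite -natr1; apply/andP; split; lra.
have Qqg : qgeod S (A C) n.+1 (fun i => g (q (time_of i))).
  move=> i j i_n jn ij; have /andP[d1 d2] := time_diff i j ij jn.
  have h : C^-1 * `|time_of i - time_of j| - C <= mdist (q (time_of i)) (q (time_of j))
      <= C * `|time_of i - time_of j| + C by apply: qC; rewrite in_itv /=; exact: time_in.
  have tt : 0 <= time_of j - time_of i.
    have [e|ne] := eqVneq i j; first by rewrite e subrr.
    have : 1 <= (j - i)%:R :> R by rewrite -[1]/(1%:R) ler_nat subn_gt0 ltn_neqAle ne.
    lra.
  move: h; rewrite distrC ger0_norm// => /andP[h1 h2].
  rewrite lerBlDr ler_pdivrMl in h1; last lra.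
  have gi := gP (q (time_of i)); have gj := gP (q (time_of j)).
  have t1 := metric_triangle (vp (g (q (time_of i)))) (q (time_of i)) (q (time_of j)).
  have t2 := metric_triangle (vp (g (q (time_of i)))) (q (time_of j)) (vp (g (q (time_of j)))).
  have t3 := metric_triangle (q (time_of i)) (vp (g (q (time_of i)))) (q (time_of j)).
  have t4 := metric_triangle (vp (g (q (time_of i)))) (vp (g (q (time_of j)))) (q (time_of j)).
  rewrite (metric_sym (vp (g (q (time_of i)))) (q (time_of i))) in t1.
  rewrite (metric_sym (vp (g (q (time_of j)))) (q (time_of j))) in t4.
  rewrite mdist_vertex in t2 t4.
  set D := d _ _ in t2 t4 *; set K := k C in Ck k0 *.
  have D0 : 0 <= D%:R :> R by [].
  have J0 : 0 <= (j - i)%:R :> R by [].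
  have AE : (A C)%:R = K%:R * (K%:R + 2) + K%:R + 3 :> R.
    by rewrite /A -/K !natrD natrM natrD.
  rewrite -!(ler_nat R); move: AE; generalize (A C) => AC AE; rewrite !natrD !natrM AE.
  have Kj : C * (time_of j - time_of i) <= K%:R * (j - i)%:R.
    by apply: ler_pM => //; lra.
  split.
    have : 0 <= K%:R * (K%:R + 2) * (j - i)%:R :> R by apply: mulr_ge0 => //; apply: mulr_ge0; lra.
    have : 0 <= K%:R * (K%:R + 2) :> R by apply: mulr_ge0; lra.
    move: Kj h2 t1 t2 gi gj; rewrite !mulrDl; lra.
  have CD : C * (mdist (q (time_of i)) (q (time_of j)) + C) <= K%:R * (D%:R + 2 + K%:R).
    by apply: ler_pM => //; [lra|have := mdist_ge0 (q (time_of i)) (q (time_of j)); lra|lra].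
  have : 0 <= K%:R * (K%:R + 2) * D%:R :> R by apply: mulr_ge0 => //; apply: mulr_ge0; lra.
  move: CD h1 d1; rewrite !mulrDl !mulrDr; lra.
have endpoint x : range c x -> exists m, (d (g x) (r m) <= A C)%N.
  move=> [s _ sx]; exists (Num.truncn (time s)).
  rewrite -(ler_nat R) -mdist_vertex; have := follows_near s cg cr; rewrite sx => h.
  have := metric_triangle (vp (g x)) x (vp (r (Num.truncn (time s)))).
  rewrite (metric_sym (vp (g x)) x); have := gP x.
  have : 2 <= (A C)%:R :> R by rewrite ler_nat /A; clear; lia.
  lra.
have [ma maP] := endpoint _ ra; have [mb mbP] := endpoint _ rb.
have ta0 : 0 <= t - a by move: tab; rewrite in_itv /= => /andP[]; lra.
have tb : t <= b by move: tab; rewrite in_itv /= => /andP[].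
pose i := Num.truncn (t - a); have /andP[i1 i2] := truncn_itv ta0.
rewrite -/i -natr1 in i1 i2.
have i_n : (i <= n)%N by apply: le_truncn; lra.
have [|||m mP] := rN (A C) n.+1 _ ma mb Qqg _ _ i.
- by rewrite /time_of /= addr0.
- by rewrite /time_of ltnn.
- exact: leqW.
exists (at_time m%:R); rewrite cr.
have iE : time_of i = a + i%:R by rewrite /time_of i_n.
rewrite iE -(ler_nat R) -mdist_vertex in mP.
have /andP[_ h] : C^-1 * `|t - (a + i%:R)| - C <= mdist (q t) (q (a + i%:R))
    <= C * `|t - (a + i%:R)| + C.
  by apply: qC => //; rewrite -iE in_itv /=; exact: time_in.
rewrite ger0_norm in h; last lra.
have h' : C * (t - (a + i%:R)) <= C * 1 by rewrite ler_pM2l; lra.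
have := metric_triangle (q t) (q (a + i%:R)) (vp (r m)).
have := metric_triangle (q (a + i%:R)) (vp (g (q (a + i%:R)))) (vp (r m)).
have := gP (q (a + i%:R)); rewrite /= /N; lra.
Qed.

End Gauges.

(** * Open sets of the boundary *)

Lemma compact_time_bounded (R : realType) (K : set (@half_line R)) : compact K ->
  exists m : nat, forall t, K t -> time t <= m%:R.
Proof.
move=> Kc; have ct : continuous (@time R) by exact: initial_continuous.
have /compact_bounded[M [_ MP]] : compact (@time R @` K : set R^o).
  by apply: continuous_compact Kc; exact: continuous_subspaceT.
exists (Num.truncn M).+1 => t Kt.
have M1 : M < (Num.truncn M).+1%:R by exact: truncnS_gt.
have /= := MP _ M1 (time t); rewrite ger0_norm ?time_ge0//; apply.
by exists t.
Qed.

(** Compact sets of times are bounded, so such a sequence converges in the compact-open topology. *)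
Lemma compact_open_agree (R : realType) (X : metricType R)
    (O : set {compact-open, @half_line R -> X}) (c : {compact-open, @half_line R -> X})
    (g : nat -> {compact-open, @half_line R -> X}) : open O -> O c ->
  (forall m t, time t <= m%:R -> g m t = c t) -> exists m, O (g m).
Proof.
move=> oO Oc gc; suff gcvg : g @ \oo --> c.
  have [m _ /(_ m (leqnn m)) Om] := gcvg O (open_nbhs_nbhs (conj oO Oc)).
  by exists m.
apply/compact_open_cvgP => K W Kc Wo cK.
have [m mK] := compact_time_bounded Kc; exists m => // n /= mn _ [t Kt <-].
rewrite gc; last by rewrite (le_trans (mK t Kt))// ler_nat.
by apply: cK; exists t.
Qed.

Section BoundaryRays.
Context {R : realType} {G : groupType} (S : genset G).
Local Notation d := (wdist S).
Local Notation X := (cayley_graph R S).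
Local Notation vp := (@vertex_point R G S).
Local Notation o := (vp 1%g).
Local Notation dM := (group_morse_boundary R S).
Implicit Types (c : {compact-open, @half_line R -> X}) (r : nat -> G) (x : dM).

Definition morse_class c (h : c \in all_morse_rays o) : dM :=
  \pi_{eq_quot (@asymptotic_in R X (all_morse_rays o))} (exist _ c h).

Definition represents x r := ray S r /\ exists c (h : c \in all_morse_rays o),
  x = morse_class h /\ follows c r.

Lemma morse_class_eq c c' (h : c \in all_morse_rays o) (h' : c' \in all_morse_rays o) :
  morse_class h = morse_class h' <-> asymptotic c c'.
Proof. by split=> [/eqquotP/asboolP//|cc]; apply/eqquotP/asboolP. Qed.

Lemma stratum_incl_pi N c (h : c \in morse_rays o N) :
  stratum_incl (\pi_(morse_stratum o N) (exist _ c h)) = morse_class (morse_rays_sub h).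
Proof.
rewrite /stratum_incl -[LHS]/(morse_class _); apply/morse_class_eq.
have /eqquotP/asboolP := reprK (\pi_(morse_stratum o N) (exist (fun c => c \in morse_rays o N) c h)).
by [].
Qed.

Lemma represents_exists x : exists r N, [/\ ray S r, morse S N r & represents x r].
Proof.
have := reprK x; case: (repr x) => c h xE; have := h; rewrite inE => -[N _ [cg cN]].
have [r rr cr] := geodesic_ray_follows cg; have [N' N'P] := real_morse_discrete S N.
exists r, N'; split => //; first exact: N'P cg cr cN.
by split => //; exists c, h.
Qed.

Lemma represents_eq x x' r r' : represents x r -> represents x' r' ->
  x = x' <-> exists K, close_to S K r r'.
Proof.
move=> [rr [c [h [-> cr]]]] [r'r [c' [h' [-> c'r]]]].
have := h; rewrite inE => -[N _ [cg cN]]; have := h'; rewrite inE => -[N' _ [c'g c'N']].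
by rewrite morse_class_eq; exact: asymptotic_close.
Qed.

Lemma graph_ray_morse N : exists N' : morse_gauge R, forall r (rr : ray S r), morse S N r ->
  (graph_ray rr : {compact-open, @half_line R -> X}) \in morse_rays o N'.
Proof.
have [N' N'P] := @discrete_morse_real R G S N; exists N' => r rr rN; rewrite inE.
split; first exact: graph_ray_geodesic.
exact: N'P (graph_ray_geodesic rr) (follows_graph_ray rr) rN.
Qed.

Lemma represents_ray N r : ray S r -> morse S N r -> exists x, represents x r.
Proof.
move=> rr rN; have [N' N'P] := graph_ray_morse N.
have h := N'P r rr rN; exists (morse_class (morse_rays_sub h)); split => //.
by exists (graph_ray rr), (morse_rays_sub h); split => //; exact: follows_graph_ray.
Qed.

(** Rays violating the claim for larger and larger [m] subconverge, not necessarily to [r], but to a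
    ray [q] of the same gauge that fellow-travels [r]. As [q] represents [x] too, some of these rays
    have their class in [U]. *)
Lemma boundary_open_neighbourhood (U : set dM) N K x r : open U -> ray S r -> morse S N r ->
  represents x r -> U x -> exists m, forall x' r', ray S r' -> morse S N r' ->
  represents x' r' -> (d (r m) (r' m) <= K)%N -> U x'.
Proof.
move=> oU rr rN xr Ux; apply: contrapT => no.
have /choice[F FP] m : exists t : dM * (nat -> G), [/\ ray S t.2, morse S N t.2,
    represents t.1 t.2, (d (r m) (t.2 m) <= K)%N & ~ U t.1].
  apply: contrapT => h; apply: no; exists m => x' r' r'r r'N x'r' rm.
  by apply: contrapT => nU; apply: h; exists (x', r').
have [N' N'P] := graph_ray_morse N.
have [|q qP] := @konig G S (fun n => (F n).2).
  by move=> n i; rewrite ray_dist1//; have [] := FP n.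
have rq : ray S q.
  split; first by have [n _ /(_ 0%N (leqnn _)) <-] := qP 0%N 0%N; have [[]] := FP n.
  move=> i j ij; have [n _ nq] := qP j 0%N; rewrite -!nq//.
  by have [[_ ->]] := FP n.
have qN : morse S N q.
  move=> A n p a b pA pa pb i i_n.
  (* A vertex within [N A] of [p i] occurs on a ray before time [d 1 (p i) + N A] or at it, so
     agreement up to [M] lets the Morse property pass to the limit. *)
  pose M := (maxn (maxn a b) (d 1%g (p i) + N A))%N.
  have [k _ kq] := qP M 0%N; have [Fr FN _ _ _] := FP k.
  have [||t tP] := FN A n p a b pA _ _ i i_n.
  - by rewrite kq// /M !leq_max leqnn.
  - by rewrite kq// /M !leq_max leqnn orbT.
  exists t; rewrite -kq// /M leq_max -(ray_dist1 t Fr); apply/orP; right.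
  by apply: leq_trans (wdist_triangle S (p i) _ _) _; rewrite leq_add2l.
have rq_close : close_to S (2 * N (K + 1)) r q.
  have main i : (d (r i) (q i) <= 2 * N (K + 1))%N.
    have [n i_n nq] := qP i i; rewrite -nq//.
    by have [Fr FN _ Fd _] := FP n; exact: fellow_travel rr Fr rN Fd i i_n.
  by split => i; exists i.
have hq := N'P q rq qN.
pose xq := morse_class (morse_rays_sub hq).
have xq_q : represents xq q.
  by split => //; exists (graph_ray rq), (morse_rays_sub hq); split => //; exact: follows_graph_ray.
have xqE : x = xq by apply/(represents_eq xr xq_q); exists (2 * N (K + 1))%N.
have : open (@stratum_incl R X o N' @^-1` U) by exact: oU.
(* Unfolds the quotient topology and then the induced one: [Q] is open in the compact-open topology
   and cuts out the preimage of [U] among the rays. *)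
rewrite {1}/open /= /quotient_open {1}/open /=.
move=> [Q oO OE].
have inO c (h : c \in morse_rays o N') : Q c <-> U (morse_class (morse_rays_sub h)).
  have -> : Q c = (set_val @^-1` Q) (exist (fun c => c \in morse_rays o N') c h).
    by rewrite /= set_valE.
  by rewrite OE /= stratum_incl_pi.
have FrP n : ray S (F n).2 by have [] := FP n.
have hF n : (graph_ray (FrP n) : {compact-open, @half_line R -> X}) \in morse_rays o N'.
  by apply: N'P; have [] := FP n.
have /choice[idx idxP] m : exists n, forall i, (i <= m.+1)%N -> (F n).2 i = q i.
  by have [n _ nq] := qP m.+1 0%N; exists n.
have [||m Om] := @compact_open_agree R X Q (graph_ray rq) (fun m => graph_ray (FrP (idx m))) oO.
- by apply/inO; rewrite -/xq -xqE.
- move=> m t tm; apply/esym/follows_unique; first exact: graph_ray_geodesic.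
  move=> n nt; rewrite follows_graph_ray idxP// -(ler_nat R) -natr1; lra.
have := (inO _ (hF (idx m))).1 Om.
have [_ _ FR _ nU] := FP (idx m).
suff -> : morse_class (morse_rays_sub (hF (idx m))) = (F (idx m)).1 by [].
apply/represents_eq; [|exact: FR|].
  by split; last (exists (graph_ray (FrP (idx m))), (morse_rays_sub (hF (idx m))); split => //; exact: follows_graph_ray).
by exists 0%N; split => i; exists i; rewrite wdistxx.
Qed.

Lemma boundary_open (U : set dM) : (forall N x r, ray S r -> morse S N r ->
  represents x r -> U x -> exists m, forall x' r', ray S r' -> morse S N r' ->
  represents x' r' -> (d (r m) (r' m) <= 1)%N -> U x') -> open U.
Proof.
move=> UP; change (morse_open U) => N.
rewrite /open /= /quotient_open.
have [N' N'P] := real_morse_discrete S N.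
set W := _ @^-1` _.
suff H c (h : c \in morse_rays o N) : W (exist _ c h) -> exists2 Q : set {compact-open, @half_line R -> X},
    open Q /\ Q c & forall c' (h' : c' \in morse_rays o N), Q c' -> W (exist _ c' h').
  rewrite /open /=; exists (\bigcup_(Q in [set Q | open Q /\ forall c' (h' : c' \in morse_rays o N),
      Q c' -> W (exist _ c' h')]) Q).
    by apply: bigcup_open => Q [].
  apply/seteqP; split => [[c h] [Q [_ OW]] Oc|[c h] Wc].
    by apply: OW; move: Oc; rewrite set_valE.
  by have [Q [oQ Qc] QW] := H c h Wc; exists Q => //; rewrite set_valE.
rewrite /W /= stratum_incl_pi => Uc.
have := h; rewrite inE => -[cg cN]; have [r rr cr] := geodesic_ray_follows cg.
have rN := N'P _ _ cg cr cN.
have cx : represents (morse_class (morse_rays_sub h)) r.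
  by split => //; exists c, (morse_rays_sub h).
have [m mP] := UP N' _ r rr rN cx Uc.
(* Vertices less than 2 apart are at distance at most 1. *)
exists [set g | g @` [set at_time m%:R] `<=` (ball (c (at_time m%:R)) 2)^°].
  split; last by move=> _ [_ -> <-]; exact: nbhsx_ballx.
  by apply: compact_open_open; [exact: compact_set1|exact: open_interior].
move=> c' h' Oc'; rewrite stratum_incl_pi.
have := h'; rewrite inE => -[c'g c'N]; have [r' r'r c'r'] := geodesic_ray_follows c'g.
apply: (mP _ r' r'r (N'P _ _ c'g c'r' c'N)).
  by split => //; exists c', (morse_rays_sub h').
have : ball (c (at_time m%:R)) 2 (c' (at_time m%:R)) by apply: interior_subset; apply: Oc'; exists (at_time m%:R).
rewrite ballEmdist /= cr c'r' mdist_vertex.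
by rewrite -[2]/(2%:R) ltr_nat.
Qed.

End BoundaryRays.

End RealRays.

(** * Connected components *)

Lemma component_clopen (X : topologicalType) (U : set X) x y : open U -> open (~` U) ->
  connected_component setT x y -> U x -> U y.
Proof.
move=> oU cU [B [Bx _ Bconn] By] Ux.
suff BU : B `&` U = B by move: By; rewrite -BU => -[].
apply: Bconn; first by exists x.
  by exists U.
by exists U => //; rewrite -[U]setCK; exact: open_closedC.
Qed.

Section Embedding.
Context {X Y : topologicalType} (f : Y -> X) (y : Y).
Hypothesis f_inj : injective f.
Hypothesis f_cont : continuous f.
Hypothesis f_open : forall U, open U -> exists2 W, open W & f @^-1` W = U.
Let C := connected_component [set: X] (f y).
Let C' := connected_component [set: Y] y.
Hypothesis C_range : C `<=` range f.

Lemma component_image y' : C' y' -> C (f y').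
Proof.
move=> Cy'; have fC : f @` C' `<=` C.
  apply: connected_component_max => //.
    by exists y => //; exact: connected_component_refl.
  apply: connected_continuous_connected; first exact: component_connected.
  exact: continuous_subspaceT.
by apply: fC; exists y'.
Qed.

Lemma component_preimage y' : C (f y') -> C' y'.
Proof.
suff : f @^-1` C `<=` C' by apply.
apply: connected_component_max => //; first exact: connected_component_refl.
move=> D [z Dz] [U oU DU] [F cF DF].
have [W oW WU] := f_open oU.
have [W' oW' WF] := f_open (closed_openC cF).
have CW : C `&` W = C.
  apply: (@component_connected _ setT (f y)).
  - by exists (f z); split; [move: Dz; rewrite DU => -[]|move: Dz; rewrite DU -WU => -[]].
  - by exists W.
  - exists (~` W'); first exact: open_closedC.
    apply/seteqP; split => x [Cx]; have [x' _ x'E] := C_range Cx; rewrite -x'E in Cx *.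
      move=> Wx; split => // W'x.
      have : D x' by rewrite DU; split => //; rewrite -WU.
      by rewrite DF => -[_]; apply/(_ : ~ F x'); rewrite -[~ F x']/((~` F) x') -WF.
    move=> nW'; split => //.
    have : D x'.
      rewrite DF; split => //; apply: contrapT => nF.
      by apply: nW'; rewrite -[W' _]/((f @^-1` W') x') WF.
    by rewrite DU -WU => -[].
apply/seteqP; split => x'; first by rewrite DU => -[].
move=> Cx'; rewrite DU; split => //; rewrite -WU /=.
by move: Cx'; rewrite /= -CW => -[].
Qed.

Lemma embedding_component : homeomorphic C C'.
Proof.
have /choice[g gP] (c : C) : exists c' : C', f (set_val c') = set_val c.
  have Cc : C (set_val c) by exact: set_valP.
  have [y' _ y'E] := C_range Cc.
  have Cy' : C' y' by apply: component_preimage; rewrite y'E.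
  by exists (exist _ y' (mem_set Cy')).
pose h (c' : C') : C := exist _ (f (set_val c')) (mem_set (component_image (set_valP c'))).
exists g, h; split.
- apply/continuousP => U [V oV VU]; have [W oW WV] := f_open oV.
  exists W => //; apply/seteqP; split => c /=.
    by rewrite -gP -VU -WV.
  by rewrite -VU -WV /= gP.
- apply/continuousP => U [W oW WU]; exists (f @^-1` W).
    by move/continuousP: f_cont; exact.
  by apply/seteqP; split => c' /=; rewrite -WU.
- by move=> c; apply: val_inj; rewrite /= gP.
- by move=> c'; apply: val_inj; apply: f_inj; rewrite gP.
Qed.

End Embedding.

(** * Sides of edges, and rays that select an end *)

Lemma morse_le (G : groupType) (S : genset G) (N N' : nat -> nat) r :
  (forall A, N A <= N' A) -> morse S N r -> morse S N' r.
Proof.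
move=> NN rN A n q a b qA qa qb i i_n.
by have [t tP] := rN A n q a b qA qa qb i i_n; exists t; exact: leq_trans (NN A).
Qed.

(** Both rays start at 1, so [a] and [b] differ by at most [K]. *)
Lemma rays_close (G : groupType) (S : genset G) r r' K a b : ray S r -> ray S r' ->
  wdist S (r a) (r' b) <= K -> wdist S (r a) (r' a) <= 2 * K.
Proof.
move=> rr rr' ab; have h1 := wdist_triangle S (r' b) (r a) (r' a).
have h2 := ray_dist b a rr'; have h3 := ray_dist1 a rr; have h4 := ray_dist1 b rr'.
have h5 := wdist_triangle S (r a) 1%g (r' b); have h6 := wdist_triangle S (r' b) 1%g (r a).
rewrite (wdistC S (r' b) (r a)) in h6.
by move: ab h1 h2 h3 h4 h5 h6; clear; lia.
Qed.

Section Ends.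
Context {R : realType} {G : groupType} (S : genset G) {T : splitting G}.
Hypothesis edge_hyp : forall p q : vertex T, adj p q ->
  [/\ finitely_generated (edge_group p q),
      undistorted R (val : edge_group p q -> G) &
      relatively_wide R (edge_in_vertex_group p q)].
Local Notation d := (wdist S).
Local Notation dM := (group_morse_boundary R S).

Lemma represents_morse (x : dM) r : represents x r -> exists N, morse S N r.
Proof.
move=> xr; have [r' [N [r'r r'N xr']]] := represents_exists x.
have /(represents_eq xr' xr)[K rK] : x = x by [].
by exists (fun A => N (A + K) + K); exact: morse_close rK r'N.
Qed.

Context {F : seq (vertex T)}.
Hypotheses (Fw : is_walk F) (Fo : overlapping S F).
Implicit Types (p q : vertex T) (r : nat -> G).

Definition eventually_beyond p q r := exists n0, forall n, n0 <= n -> beyond F p q (r n).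
Definition visits p r := forall n0, exists2 n, n0 <= n & p \in cell F (r n).

Let ray_next r n : ray S r -> d (r n) (r n.+1) <= 1.
Proof. by move=> [_ ->//]; rewrite subSnn. Qed.

Let ray_prev r n : ray S r -> d (r n.+1) (r n) <= 1.
Proof. by rewrite wdistC; exact: ray_next. Qed.

Lemma visits_or_beyond p r : ray S r ->
  visits p r \/ exists2 q, adj p q & eventually_beyond p q r.
Proof.
move=> rr; have [v|nv] := pselect (visits p r); [by left|right].
have [n0 n0P] : exists n0, forall n, n0 <= n -> p \notin cell F (r n).
  apply: contrapT => h; apply: nv => n0; apply: contrapT => h'; apply: h; exists n0 => n n0n.
  by apply/negP => pn; apply: h'; exists n.
have [q pq qn0] := beyond_exists Fw (n0P n0 (leqnn _)); exists q => //; exists n0.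
elim=> [|n IH]; first by rewrite leqn0 => /eqP <-.
rewrite leq_eqVlt => /orP[/eqP <-//|]; rewrite ltnS => n0n.
apply: (beyond_step Fw Fo (IH n0n)); first exact: ray_next.
exact/n0P/leqW.
Qed.

Lemma visits_not_beyond p q r : visits p r -> ~ eventually_beyond p q r.
Proof.
move=> v [n0 n0P]; have [n n0n pn] := v n0.
by have [] := n0P n n0n; rewrite pn.
Qed.

(** After time [D] the rays are not within [K] of any crossing of the edge. So neither of them
    changes side after time [m], nor does a geodesic from [r m] to [r' m]. *)
Lemma beyond_determined p q N K : adj p q -> exists D, forall r r' m, ray S r -> ray S r' ->
  morse S N r -> morse S N r' -> D < m -> d (r m) (r' m) <= K ->
  eventually_beyond p q r -> eventually_beyond p q r'.
Proof.
move=> pq; have [D DP] := crossing_bounded edge_hyp Fw Fo N K pq.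
exists D => r r' m rr rr' rN rN' Dm mK [n0 n0P].
have no_cross s n g : ray S s -> morse S N s -> m <= n -> d (s n) g <= K -> ~ crosses F p q g.
  by move=> sr sN mn ng gc; have := DP s n g sr sN gc ng; rewrite leqNgt (leq_trans Dm mn).
have rm : beyond F p q (r m).
  have H k : beyond F p q (r (m + k)) -> beyond F p q (r m).
    elim: k => [|k IH]; first by rewrite addn0.
    rewrite addnS => bk; apply: IH.
    case: (boolP (p \in cell F (r (m + k)))) => pk; last first.
      by apply: (beyond_step Fw Fo bk) => //; exact: ray_prev.
    have := beyond_exit Fw Fo pq bk (ray_prev _ rr) pk.
    by case/(no_cross r (m + k) (r (m + k)) rr rN (leq_addr _ _)); rewrite wdistxx.
  by apply: (H n0); apply: n0P; rewrite leq_addl.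
have r'm : beyond F p q (r' m).
  apply: contrapT => nb.
  have [k kc mk] := beyond_leave Fw Fo pq rm
    (@conn_geodesic _ S (fun=> True) (r m) (r' m) (fun _ _ => Logic.I)) nb.
  by apply: (no_cross r m k rr rN (leqnn _) _ kc); exact: leq_trans mk mK.
exists m; elim=> [|n IH]; first by rewrite leqn0 => /eqP <-.
rewrite leq_eqVlt => /orP[/eqP <-//|]; rewrite ltnS => mn.
case: (boolP (p \in cell F (r' n.+1))) => pk; last first.
  by apply: (beyond_step Fw Fo (IH mn)) => //; exact: ray_next.
have := beyond_exit Fw Fo pq (IH mn) (ray_next _ rr') pk.
by case/(no_cross r' n.+1 (r' n.+1) rr' rN' (leqW mn)); rewrite wdistxx.
Qed.

Lemma beyond_represents p q (x : dM) r r' : adj p q -> represents x r -> represents x r' ->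
  eventually_beyond p q r -> eventually_beyond p q r'.
Proof.
move=> pq xr xr'; have [N rN] := represents_morse xr; have [N' r'N] := represents_morse xr'.
have /(represents_eq xr xr')[K [rK _]] : x = x by [].
have [rr _] := xr; have [rr' _] := xr'.
have [D DP] := beyond_determined (fun A => N A + N' A) (2 * K) pq.
apply: (DP r r' D.+1) => //.
- by apply: morse_le rN => A; rewrite leq_addr.
- by apply: morse_le r'N => A; rewrite leq_addl.
- by have [j] := rK D.+1; exact: rays_close.
Qed.

Definition side p q : set dM := [set x | exists2 r, represents x r & eventually_beyond p q r].

Lemma side_open p q : adj p q -> open (side p q).
Proof.
move=> pq; apply: boundary_open => N x r rr rN xr [r0 xr0 /(beyond_represents pq xr0 xr) rb].
have [D DP] := beyond_determined N 1 pq; exists D.+1 => x' r' rr' rN' x'r' rD.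
by exists r' => //; exact: DP rr rr' rN rN' (leqnn _) rD rb.
Qed.

Lemma side_closed p q : adj p q -> open (~` side p q).
Proof.
move=> pq; apply: boundary_open => N x r rr rN xr nb.
have [D DP] := beyond_determined N 1 pq; exists D.+1 => x' r' rr' rN' x'r' rD.
move=> [r0 x'r0 /(beyond_represents pq x'r0 x'r') r'b]; apply: nb; exists r => //.
by apply: (DP r' r D.+1) => //; rewrite wdistC.
Qed.

Lemma component_side p q (x y : dM) : adj p q -> connected_component setT x y ->
  side p q x -> side p q y.
Proof.
move=> pq; apply: component_clopen; [exact: side_open|exact: side_closed].
Qed.

(** The path may return to [p], whence the induction on its length; what follows the last return
    starts at [q]. *)
Lemma walk_towards p q x c : adj p q -> path (@adj _ T) p c -> last p c = x ->
  avoids p q x -> exists c', [/\ path (@adj _ T) q c', last q c' = x & size c' < size c].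
Proof.
move=> pq; have [n] := ubnP (size c); elim: n c => // n IH c.
rewrite ltnS => cn cp cx qx; case: c cn cp cx => [|b c] /= cn.
  by move=> _ px; case: (avoids_neq qx).
move=> /andP[pb bc] bx; case: (boolP (p \in b :: c)) => pc; last first.
  have bq : b = q by apply: (side_unique pb pq) qx; exists c.
  by exists c; rewrite -bq.
have := pc; rewrite inE => /orP[/eqP e|pc'].
  have [//||c' [h1 h2 h3]] := IH c cn _ _ qx.
  - by rewrite e.
  - by rewrite e.
  by exists c'; split => //; exact: leqW.
case/splitPr: pc' cn bc bx {pc} => c1 c2; rewrite size_cat /= => cn.
rewrite cat_path last_cat /= => /and3P[_ _ h2] h3.
have [|c' [k1 k2 k3]] := IH c2 _ h2 h3 qx.
  by apply: leq_ltn_trans cn; rewrite addnS -addSn leq_addl.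
by exists c'; split => //; rewrite (leq_trans k3)// addnS -addSn leqW// leq_addl.
Qed.

(* The vertices p, next p, next (next p), ... form a ray of the tree, and next
   always points to the end of the tree selected by r. *)
Section Descent.
Context (next : vertex T -> vertex T) (r : nat -> G).
Hypothesis next_adj : forall p, adj p (next p).
Hypothesis r_ray : ray S r.
Hypothesis r_next : forall p, eventually_beyond p (next p) r.

Lemma last_crossing p n : p \in cell F (r n) -> exists2 t, crosses F p (next p) (r t) &
  forall k, t < k -> beyond F p (next p) (r k).
Proof.
move=> pn; have [n0 n0P] := r_next p.
have [m nm mP] : exists2 m, n <= m & forall k, m <= k -> beyond F p (next p) (r k).
  by exists (maxn n n0) => [|k]; [rewrite leq_maxl|rewrite geq_max => /andP[_ /n0P]].
elim: m nm mP => [|m IH] nm mP.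
  have n0' : n = 0 by move: nm; clear; lia.
  by have [] := mP 0 (leqnn _); rewrite -n0' pn.
case: (boolP (p \in cell F (r m))) => pm.
  exists m; last exact: mP.
  exact: (beyond_exit Fw Fo (next_adj p) (mP m.+1 (leqnn _)) (ray_prev _ r_ray) pm).
apply: IH => [|k].
  move: nm; rewrite leq_eqVlt => /orP[/eqP e|]; last by rewrite ltnS.
  by have [] := mP m.+1 (leqnn _); rewrite -e pn.
rewrite leq_eqVlt => /orP[/eqP <-|]; last exact: mP.
exact: (beyond_step Fw Fo (mP m.+1 (leqnn _)) (ray_prev _ r_ray) pm).
Qed.

Lemma crossing_iter p0 i : p0 \in F ->
  exists2 t, crosses F (iter i next p0) (next (iter i next p0)) (r t) &
    forall k, t < k -> beyond F (iter i next p0) (next (iter i next p0)) (r k).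
Proof.
move=> p0F; elim: i => [|i [t /andP[_ tc] _]]; last exact: last_crossing tc.
by apply: (@last_crossing _ 0); rewrite mem_cell (proj1 r_ray) invg1 act1.
Qed.

(** If all crossings took place before [M], the cell of [r M] would lie beyond every vertex of the
    tree ray, and paths from these vertices to a vertex of the cell would become shorter forever. *)
Lemma crossing_late p0 : p0 \in F -> forall M, exists i, exists2 t, M <= t &
  crosses F (iter i next p0) (next (iter i next p0)) (r t).
Proof.
move=> p0F M; apply: contrapT => h.
have all_beyond i : beyond F (iter i next p0) (next (iter i next p0)) (r M).
  have [t tc tb] := crossing_iter i p0F; apply: tb; rewrite ltnNge; apply/negP => Mt.
  by apply: h; exists i, t.
have [x xM] : exists x, x \in cell F (r M).
  by have [y [c [e _]]] := walk_act (r M) Fw; exists y; rewrite /cell e mem_head.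
have [_ _ _ /(_ p0 x)[c0 c0p c0x] _] := adj_tree T.
have short i : exists c, [/\ path (@adj _ T) (iter i next p0) c, last (iter i next p0) c = x &
    size c + i <= size c0].
  elim: i => [|i [c [cp cx ci]]]; first by exists c0; rewrite addn0.
  have [c' [h1 h2 h3]] := walk_towards (next_adj _) cp cx (proj2 (all_beyond i) x xM).
  by exists c'; split => //; move: h3 ci; clear; lia.
by have [c [_ _]] := short (size c0).+1; clear; lia.
Qed.

End Descent.

(** A late crossing by [r'] is matched by a crossing of the same edge by [r], at bounded distance,
    and the two rays fellow-travel up to that time. *)
Lemma ends_close N r r' : ray S r -> ray S r' -> morse S N r -> morse S N r' ->
  (forall p, exists2 q, adj p q & eventually_beyond p q r /\ eventually_beyond p q r') ->
  exists K, close_to S K r r'.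
Proof.
move=> rr rr' rN rN' both.
have /choice[next nextP] p : exists q, adj p q /\ (eventually_beyond p q r /\ eventually_beyond p q r').
  by have [q pq qb] := both p; exists q.
have next_adj p : adj p (next p) by have [] := nextP p.
have r_next p : eventually_beyond p (next p) r by have [_ []] := nextP p.
have r'_next p : eventually_beyond p (next p) r' by have [_ []] := nextP p.
have [p0 p0F] : exists p0, p0 \in F.
  by have [y [c [-> _]]] := Fw; exists y; rewrite mem_head.
have [D DP] := crossing_rays edge_hyp Fw Fo N 0.
have main n : d (r n) (r' n) <= 2 * N (D + 1).
  have [i [t' nt' tc']] := crossing_late next_adj rr' r'_next p0F n.
  have [t tc _] := crossing_iter next_adj rr r_next i p0F.
  apply: (fellow_travel rr rr' rN _ nt'); apply: (DP _ _ (r t) (r' t') r r' t t' (next_adj _) tc tc') => //;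
    by rewrite wdistxx.
by exists (2 * N (D + 1)); split => i; exists i.
Qed.

Lemma end_component (x : dM) r : represents x r -> (forall p, ~ visits p r) ->
  connected_component setT x = [set x].
Proof.
move=> xr nv; have [rr _] := xr.
apply/seteqP; split => [y xy|_ ->]; last exact: connected_component_refl.
have [r' [N' [rr' r'N yr']]] := represents_exists y.
have [N rN] := represents_morse xr.
apply/(represents_eq yr' xr); apply: (@ends_close (fun A => N A + N' A)) => //.
- by apply: morse_le r'N => A; rewrite leq_addl.
- by apply: morse_le rN => A; rewrite leq_addr.
move=> p; have [/nv//|[q pq rb]] := visits_or_beyond p rr; exists q => //; split => //.
have [r0 yr0 r0b] : side p q y by apply: component_side xy _ => //; exists r.
exact: beyond_represents yr0 yr' r0b.
Qed.

End Ends.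

(** * Rays over a vertex and the boundary of the vertex group *)

Section VertexBoundary.
Context {R : realType} {G : groupType} (S : genset G) {T : splitting G}.
Hypothesis edge_hyp : forall p q : vertex T, adj p q ->
  [/\ finitely_generated (edge_group p q),
      undistorted R (val : edge_group p q -> G) &
      relatively_wide R (edge_in_vertex_group p q)].
Context (p : vertex T) {F : seq (vertex T)}.
Hypotheses (Fw : is_walk F) (Fo : overlapping S F) (pF : p \in F).
Local Notation V := (vertex_group p).
Context (S' : genset V).
Local Notation d := (wdist S).
Local Notation d' := (wdist S').
Local Notation dG := (group_morse_boundary R S).
Local Notation dV := (group_morse_boundary R S').
Implicit Types (q : vertex T) (r : nat -> G) (u : nat -> V).

Let incl u : nat -> G := fun n => val (u n).

Let fg q : adj p q -> finitely_generated (edge_group p q).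
Proof. by move=> /edge_hyp[]. Qed.
Let und q : adj p q -> undistorted R (val : edge_group p q -> G).
Proof. by move=> /edge_hyp[]. Qed.
Let wide q : adj p q -> relatively_wide R (edge_in_vertex_group p q).
Proof. by move=> /edge_hyp[]. Qed.

Let undistorted_V : exists A, forall v w : V,
  d' v w <= A * d (val v) (val w) + A /\ d (val v) (val w) <= A * d' v w.
Proof. exact: (vertex_group_undistorted fg und Fw Fo pF S'). Qed.

Lemma excursion_start q r n : adj p q -> ray S r -> beyond F p q (r n) ->
  exists2 i, i <= n & crosses F p q (r i).
Proof.
move=> pq rr; elim: n => [|n IH] rb.
  by case: rb; rewrite (proj1 rr) mem_cell invg1 act1 pF.
have rn : d (r n.+1) (r n) <= 1 by rewrite (ray_dist _ _ rr); clear; lia.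
case: (boolP (p \in cell F (r n))) => pn.
  by exists n; [exact: leqnSn|exact: (beyond_exit Fw Fo pq rb rn pn)].
by have [i i_n ic] := IH (beyond_step Fw Fo rb rn pn); exists i => //; exact: leqW.
Qed.

Lemma excursion_end q r n : adj p q -> ray S r -> visits (F := F) p r -> beyond F p q (r n) ->
  exists2 j, n <= j & crosses F p q (r j).
Proof.
move=> pq rr v; have [j nj] := v n; rewrite -{1}(subnKC nj); move: (j - n) => k {j nj}.
elim: k n => [|k IH] n; first by rewrite addn0 => pn []; rewrite pn.
have rn : d (r n) (r n.+1) <= 1 by rewrite (ray_dist _ _ rr); clear; lia.
case: (boolP (p \in cell F (r n.+1))) => pn pj rb.
  by exists n.+1; [exact: leqnSn|exact: (beyond_exit Fw Fo pq rb rn pn)].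
rewrite -addSnnS in pj.
by have [i ni ic] := IH n.+1 pj (beyond_step Fw Fo rb rn pn); exists i => //; exact: ltnW.
Qed.

(** An excursion crosses the same edge when it starts and when it ends, and by [crossing_rays] these
    two times differ by a bounded amount. *)
Lemma visiting_near N : exists K, forall r, ray S r -> morse S N r -> visits (F := F) p r ->
  forall n, exists v : V, d (r n) (val v) <= K.
Proof.
have [rho [pr prP]] := vertex_projection S pF.
have [D DP] := crossing_rays edge_hyp Fw Fo N 0.
exists (D + rho) => r rr rN v n; case: (boolP (p \in cell F (r n))) => pn.
  by exists (pr (r n)); rewrite wdistC (leq_trans (prP _ pn))// leq_addl.
have [q pq rb] := beyond_exists Fw pn.
have [i i_n ic] := excursion_start pq rr rb; have [j nj jc] := excursion_end pq rr v rb.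
have ij : d (r i) (r j) <= D.
  by apply: (DP _ _ (r i) (r j) r r i j pq ic jc) => //; rewrite wdistxx.
have ni : d (r n) (r i) <= D.
  by move: ij; rewrite !(ray_dist _ _ rr); move: i_n nj; clear; lia.
have pi : p \in cell F (r i) by case/andP: ic.
have ri := prP _ pi; rewrite wdistC in ri.
by exists (pr (r i)); exact: wdist_leD ni ri.
Qed.

(** A ray eventually beyond [q] and yet near [V] would be near crossings of one edge at arbitrarily
    late times. *)
Lemma near_visiting N K r : ray S r -> morse S N r ->
  (forall n, exists v : V, d (r n) (val v) <= K) -> visits (F := F) p r.
Proof.
move=> rr rN near; have [//|[q pq [n0 n0P]]] := visits_or_beyond Fw Fo p rr.
have [D DP] := crossing_bounded edge_hyp Fw Fo N K pq.
pose n := n0 + D.+1; have [v nv] := near n.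
have rb : beyond F p q (r n) by apply: n0P; rewrite leq_addr.
have vb : ~ beyond F p q (val v) by case; rewrite (mem_cell_vstab pF).
have [k kc nk] := beyond_leave Fw Fo pq rb
  (@conn_geodesic _ S (fun=> True) (r n) (val v) (fun _ _ => Logic.I)) vb.
by have := DP r n k rr rN kc (leq_trans nk nv); rewrite /n; clear; lia.
Qed.

Lemma close_incl K u u' : exists K', close_to S' K u u' -> close_to S K' (incl u) (incl u').
Proof.
have [A AP] := undistorted_V; exists (A * K) => -[h1 h2].
have le v w : d' v w <= K -> d (val v) (val w) <= A * K.
  by move=> vw; have [_ h] := AP v w; rewrite (leq_trans h)// leq_mul2l vw orbT.
by split=> i; [have [j ij] := h1 i|have [j ij] := h2 i]; exists j; exact: le.
Qed.

Lemma incl_close K u u' : exists K', close_to S K (incl u) (incl u') -> close_to S' K' u u'.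
Proof.
have [A AP] := undistorted_V; exists (A * K + A) => -[h1 h2].
have le v w : d (val v) (val w) <= K -> d' v w <= A * K + A.
  move=> vw; have [h _] := AP v w; rewrite (leq_trans h)// leq_add2r leq_mul2l vw orbT//.
by split=> i; [have [j ij] := h1 i|have [j ij] := h2 i]; exists j; exact: le.
Qed.

(** The passage is through divergence, which survives the inclusion of [V] by [diverges_val]; the
    resulting Morse quasi-geodesic of [G] is then straightened. *)
Lemma vertex_ray_to_ray N : exists N' K, forall u, ray S' u -> morse S' N u ->
  exists r, [/\ ray S r, morse S N' r & close_to S K (incl u) r].
Proof.
have [A AP] := undistorted_V.
have [f fP] := morse_diverges S' 1 N.
have [f' f'P] := diverges_val fg und wide S' Fw Fo pF f.
have [N1 N1P] := diverges_morse S A f'.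
have [K KP] := straighten S A N1.
exists (fun B => N1 (B + K) + K), K => u ur uN.
have uA : qray S A (incl u).
  move=> i j _ _ ij; have [h1 h2] := AP (u i) (u j); rewrite (proj2 ur) in h1 h2 => //.
  by split => //; exact: leq_trans (leq_addr _ _).
have uN1 := N1P _ uA (f'P _ (fP u (ray_qray ur) uN)).
have [|r rr ur_close] := KP _ uA _ uN1.
  by rewrite /incl (proj1 ur) val1 wdistxx.
by exists r; split => //; exact: morse_close ur_close uN1.
Qed.

(** For the gauge undistortion is enough: quasi-geodesics of [V] are quasi-geodesics of [G], to
    which the Morse property of [r] applies. *)
Lemma ray_to_vertex_ray N : exists N' K, forall r, ray S r -> morse S N r ->
  visits (F := F) p r -> exists u, [/\ ray S' u, morse S' N' u & close_to S K (incl u) r].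
Proof.
have [A AP] := undistorted_V; have [K0 K0P] := visiting_near N.
pose A1 B := (A * B + A * B + B * A + B + A * B + K0)%N.
pose N1 B := (A * (N (A1 B) + K0) + A)%N.
pose B0 := (A + 2 * (A * K0) + 2 * K0)%N.
have [K1 K1P] := straighten S' B0 N1.
exists (fun B => N1 (B + K1) + K1), (A * K1 + K0) => r rr rN v.
have /choice[w wP] := K0P r rr rN v.
have wdle i j : d (val (w i)) (val (w j)) <= K0 + (d (r i) (r j) + K0).
  by apply: wdist_leD; [rewrite wdistC|exact: wdist_leD (leqnn _) (wP j)].
have wq : qray S' B0 w.
  move=> i j _ _ ij; have [h1 h2] := AP (w i) (w j).
  have h3 := wdle i j; rewrite (proj2 rr)// in h3.
  have h4 : d (r i) (r j) <= K0 + (d (val (w i)) (val (w j)) + K0).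
    by apply: (wdist_leD (wP i)); apply: (wdist_leD (leqnn _)); rewrite wdistC.
  rewrite (proj2 rr)// in h4.
  have h5 : A * d (val (w i)) (val (w j)) <= A * (K0 + (j - i + K0)) by rewrite leq_mul2l h3 orbT.
  have h6 : A * (j - i) <= B0 * (j - i) by rewrite leq_mul2r /B0; apply/orP; right; clear; lia.
  have h7 : A * d' (w i) (w j) <= B0 * d' (w i) (w j).
    by rewrite leq_mul2r /B0; apply/orP; right; clear; lia.
  split; first by apply: (leq_trans h1); move: h5 h6; rewrite {3}/B0; clear; lia.
  by apply: (leq_trans h4); move: h2 h7; rewrite {2}/B0; clear; lia.
have wN : morse S' N1 w.
  move=> B n q a b qB qa qb i i_n.
  have [|||t tP] := rN (A1 B) n (fun i => val (q i)) a b _ _ _ i i_n.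
  - move=> k l kn ln kl; have [h1 h2] := qB k l kn ln kl; have [h3 h4] := AP (q k) (q l).
    have h5 : A * d' (q k) (q l) <= A * (B * (l - k) + B) by rewrite leq_mul2l h1 orbT.
    have h6 : B * d' (q k) (q l) <= B * (A * d (val (q k)) (val (q l)) + A) by rewrite leq_mul2l h3 orbT.
    have h7 : A * B * (l - k) <= A1 B * (l - k) by rewrite leq_mul2r /A1; apply/orP; right; clear; lia.
    have h8 : A * B * d (val (q k)) (val (q l)) <= A1 B * d (val (q k)) (val (q l)).
      by rewrite leq_mul2r /A1; apply/orP; right; clear; lia.
    split; first by apply: (leq_trans h4); move: h5 h7; rewrite {3}/A1; clear; lia.
    by apply: (leq_trans h2); move: h6 h8; rewrite {3}/A1; clear; lia.
  - have [_ h] := AP (q 0) (w a); have h' : A * d' (q 0) (w a) <= A * B by rewrite leq_mul2l qa orbT.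
    have wa := wP a; rewrite wdistC in wa.
    apply: (leq_trans (wdist_leD (leq_trans h h') wa)); rewrite /A1; clear; lia.
  - have [_ h] := AP (q n) (w b); have h' : A * d' (q n) (w b) <= A * B by rewrite leq_mul2l qb orbT.
    have wb := wP b; rewrite wdistC in wb.
    apply: (leq_trans (wdist_leD (leq_trans h h') wb)); rewrite /A1; clear; lia.
  exists t; have [h _] := AP (q i) (w t); apply: (leq_trans h); rewrite /N1 leq_add2r leq_mul2l.
  by rewrite (wdist_leD tP (wP t)) orbT.
have [|u ur u_close] := K1P _ wq _ wN.
  have [h _] := AP 1%g (w 0); apply: (leq_trans h).
  have := wP 0; rewrite (proj1 rr) => h'.
  have h'' : A * d (val (1%g : V)) (val (w 0)) <= A * K0 by rewrite leq_mul2l h' orbT.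
  by move: h''; rewrite /B0; clear; lia.
exists u; split => //; first exact: morse_close u_close wN.
have le x y : d' x y <= K1 -> d (val x) (val y) <= A * K1.
  by move=> xy; have [_ h] := AP x y; rewrite (leq_trans h)// leq_mul2l xy orbT.
have [h1 h2] := u_close; split => i.
  have [j ij] := h2 i; exists j; rewrite /incl.
  by have := wP j; rewrite wdistC => h; apply: wdist_leD h; rewrite wdistC; exact: le.
have [j ij] := h1 i; exists j; rewrite /incl.
by have := wP i; rewrite wdistC => h; apply: wdist_leD h; rewrite wdistC; exact: le.
Qed.

Definition limits (y : dV) (x : dG) := exists u r, [/\ represents y u, represents x r &
  exists K, close_to S K (incl u) r].

Lemma limits_close y x u r : represents y u -> represents x r ->
  limits y x <-> exists K, close_to S K (incl u) r.
Proof.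
move=> yu xr; split=> [[u' [r' [yu' xr' [K uK]]]]|ur]; last by exists u, r.
have /(represents_eq yu yu')[K1 uK1] : y = y by [].
have /(represents_eq xr' xr)[K2 rK2] : x = x by [].
have [K3 K3P] := close_incl K1 u u'.
by exists (K3 + K + K2); exact: close_to_trans (close_to_trans (K3P uK1) uK) rK2.
Qed.

Lemma limits_unique y x x' : limits y x -> limits y x' -> x = x'.
Proof.
move=> yx [u [r' [yu x'r' [K' ur']]]]; have [r [N [_ _ xr]]] := represents_exists x.
have /(limits_close yu xr)[K ur] := yx; apply/(represents_eq xr x'r').
by exists (K + K'); exact: close_to_trans (close_to_sym ur) ur'.
Qed.

Lemma limits_injective y y' x : limits y x -> limits y' x -> y = y'.
Proof.
move=> yx [u' [r [y'u' xr [K' ur']]]]; have [u [N [_ _ yu]]] := represents_exists y.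
have /(limits_close yu xr)[K ur] := yx; apply/(represents_eq yu y'u').
have [K1 K1P] := incl_close (K + K') u u'; exists K1; apply: K1P.
exact: close_to_trans ur (close_to_sym ur').
Qed.

Lemma limits_exists N y u : ray S' u -> morse S' N u -> represents y u ->
  exists2 x, limits y x & exists r, represents x r /\ exists K, close_to S K (incl u) r.
Proof.
move=> ur uN yu; have [N' [K NK]] := vertex_ray_to_ray N.
have [r [rr rN cr]] := NK u ur uN; have [x xr] := represents_ray (R := R) rr rN.
by exists x; [exists u, r; split => //; exists K|exists r; split => //; exists K].
Qed.

Lemma limits_visits y x r : limits y x -> represents x r -> visits (F := F) p r.
Proof.
move=> yx xr; have [u [N [_ _ yu]]] := represents_exists y.
have /(limits_close yu xr)[K [_ ru]] := yx; have [N' rN] := represents_morse xr.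
apply: (near_visiting (N := N') (K := K)) => //; first by case: xr.
by move=> n; have [i iP] := ru n; exists (u i); rewrite wdistC.
Qed.

Lemma visits_limits x r : represents x r -> visits (F := F) p r -> exists y, limits y x.
Proof.
move=> xr v; have [N rN] := represents_morse xr; have [N' [K NK]] := ray_to_vertex_ray N.
have [u [ur uN cu]] := NK r (proj1 xr) rN v; have [y yu] := represents_ray (R := R) ur uN.
by exists y, u, r; split => //; exists K.
Qed.

Lemma limit_map : exists f : dV -> dG, forall y x, limits y x <-> x = f y.
Proof.
have /choice[f fP] (y : dV) : exists x, limits y x.
  have [u [N [ur uN yu]]] := represents_exists y.
  by have [x yx _] := limits_exists ur uN yu; exists x.
by exists f => y x; split=> [yx|->//]; exact: limits_unique yx (fP y).
Qed.

Lemma limit_map_continuous (f : dV -> dG) : (forall y x, limits y x <-> x = f y) ->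
  continuous f.
Proof.
move=> fP; apply/continuousP => U oU; apply: boundary_open => N y u ur uN yu /= Ufy.
have [N' [K NK]] := vertex_ray_to_ray N; have [A AP] := undistorted_V.
have [r [rr rN cr]] := NK u ur uN; have [x xr] := represents_ray (R := R) rr rN.
have xE : x = f y by apply/fP; exists u, r; split => //; exists K.
pose E := K + A * (2 * N 2) + K; rewrite -xE in Ufy.
have [m mP] := boundary_open_neighbourhood (2 * E) oU rr rN xr Ufy.
(* The vertex [u j] close to [r m] has [j] at most this bound, so closeness of [u] and [u'] at this
   time gives, by fellow travelling, closeness of [r] and [r'] at time [m]. *)
exists (A * (K + m) + A) => y' u' u'r u'N y'u' uu'.
have [r' [r'r r'N cr']] := NK u' u'r u'N; have [x' x'r'] := represents_ray (R := R) r'r r'N.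
have x'E : x' = f y' by apply/fP; exists u', r'; split => //; exists K.
rewrite /= -x'E; apply: (mP x' r' r'r r'N x'r').
have [_ /(_ m)[j jm]] := cr; have [/(_ j)[i ij] _] := cr'.
have jle : j <= A * (K + m) + A.
  have [h _] := AP 1%g (u j); rewrite (ray_dist1 j ur) in h; apply: (leq_trans h).
  rewrite leq_add2r leq_mul2l; apply/orP; right.
  have rm := ray_dist1 m rr; rewrite wdistC in jm.
  have h1 := wdist_leD (eq_leq rm) jm.
  by rewrite addnC; exact: h1.
have uu'j := fellow_travel ur u'r uN uu' jle.
have [_ h] := AP (u j) (u' j).
have h' : d (val (u j)) (val (u' j)) <= A * (2 * N 2) by rewrite (leq_trans h)// leq_mul2l uu'j orbT.
rewrite wdistC in jm; apply: (rays_close rr r'r (b := i)).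
exact: wdist_leD (wdist_leD jm h') ij.
Qed.

Lemma limit_map_open (f : dV -> dG) : (forall y x, limits y x <-> x = f y) ->
  forall U, open U -> exists2 W, open W & f @^-1` W = U.
Proof.
move=> fP U oU; have f_inj : injective f.
  by move=> y y' e; apply: (@limits_injective y y' (f y)); apply/fP.
(* This is the image of [U] together with the complement of the range, so that its openness includes
   the closedness of the range. *)
exists [set x | forall y, f y = x -> U y]; last first.
  apply/seteqP; split => y /=; first by apply.
  by move=> Uy y' /f_inj ->.
apply: boundary_open => N x r rr rN xr /= Ux.
(* If the ray is eventually beyond some [q], so are the nearby rays of the same gauge, and their
   classes are not limits of points of [dV]. *)
have [v|[q pq rb]] := visits_or_beyond Fw Fo p rr; last first.
  have [D DP] := beyond_determined edge_hyp Fw Fo N 1 pq; exists D.+1 => x' r' r'r r'N x'r' rr' y yE.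
  have /fP yx' := esym yE.
  have := visits_not_beyond (limits_visits yx' x'r') (q := q).
  by case; exact: DP rr r'r rN r'N (leqnn _) rr' rb.
have [N' [K NK]] := ray_to_vertex_ray N; have [A AP] := undistorted_V.
have [u [ur uN cu]] := NK r rr rN v; have [y yu] := represents_ray (R := R) ur uN.
have yE : f y = x by apply/esym/fP; exists u, r; split => //; exists K.
pose E := K + 2 * N 2 + K; pose E' := A * E + A.
have [m mP] := boundary_open_neighbourhood (2 * E') oU ur uN yu (Ux y yE).
exists (A * m + K) => x' r' r'r r'N x'r' rr' y' y'E.
have /fP y'x' := esym y'E; have v' := limits_visits y'x' x'r'.
have [u' [u'r u'N cu']] := NK r' r'r r'N v'; have [y'' y''u'] := represents_ray (R := R) u'r u'N.
have y''E : limits y'' x' by exists u', r'; split => //; exists K.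
rewrite (limits_injective y'x' y''E); apply: (mP y'' u' u'r u'N y''u').
have [/(_ m)[j mj] _] := cu; have [_ /(_ j)[i ij]] := cu'.
have jle : j <= A * m + K.
  have [_ h] := AP 1%g (u m); rewrite (ray_dist1 m ur) in h.
  by rewrite -(ray_dist1 j rr); exact: wdist_leD h mj.
have rr'j := fellow_travel rr r'r rN rr' jle.
rewrite wdistC in ij; have h1 := wdist_leD (wdist_leD mj rr'j) ij.
have [h2 _] := AP (u m) (u' i); apply: (rays_close ur u'r (b := i)).
by apply: (leq_trans h2); rewrite /E' leq_add2r leq_mul2l h1 orbT.
Qed.

(** A point of the component whose ray does not visit [p] would lie in a clopen side at [p], and
    then so would [x]. *)
Lemma component_of_vertex (x : dG) r : represents x r -> visits (F := F) p r ->
  exists y : dV, homeomorphic (connected_component [set: dG] x)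
                              (connected_component [set: dV] y).
Proof.
move=> xr v; have [f fP] := limit_map; have [y yx] := visits_limits xr v.
exists y; have -> : x = f y by apply/fP.
apply: embedding_component.
- by move=> z z' e; apply: (@limits_injective z z' (f z)); apply/fP.
- exact: limit_map_continuous.
- exact: limit_map_open.
move=> x' xx'; have [r' [N' [r'r _ x'r']]] := represents_exists x'.
have [v'|[q pq r'b]] := visits_or_beyond Fw Fo p r'r.
  by have [z /fP ->] := visits_limits x'r' v'; exists z.
have xE : x = f y by apply/fP.
have [r0 xr0 r0b] : side (F := F) p q x.
  apply: (component_side edge_hyp Fw Fo pq (x := x')); last by exists r'.
  by apply: connected_component_sym; rewrite xE.
case: (visits_not_beyond v (q := q)).
exact: (beyond_represents edge_hyp Fw Fo pq xr0 xr r0b).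
Qed.

End VertexBoundary.

Theorem corollary4 (R : realType) (G : groupType) (T : splitting G)
    (G_fg : finitely_generated G)
    (edge_hyp : forall p q : vertex T, adj p q ->
      [/\ finitely_generated (edge_group p q),
          undistorted R (val : edge_group p q -> G) &
          relatively_wide R (edge_in_vertex_group p q)]) :
  forall (S : genset G) (x : group_morse_boundary R S),
    connected_component [set: group_morse_boundary R S] x = [set x] \/
    exists p : vertex T,
      finitely_generated (vertex_group p) /\
      forall S' : genset (vertex_group p),
        exists y : group_morse_boundary R S',
          homeomorphic
            (connected_component [set: group_morse_boundary R S] x)
            (connected_component [set: group_morse_boundary R S'] y).
Proof.
move=> S x; have [_ _ [p0] _ _] := adj_tree T.
have [F0 [F0w F0o _]] := overlapping_exists S p0 [::].
have [r [N [rr rN xr]]] := represents_exists x.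
have [[p v]|nv] := pselect (exists p, visits (F := F0) p r); last first.
  left; apply: (end_component edge_hyp F0w F0o xr) => p v; apply: nv; exists p => //.
(* The walk is enlarged so as to contain [p]; the visits to [p] persist. *)
right; exists p; have [F [Fw Fo sF]] := overlapping_exists S p F0.
have pF : p \in F by apply: sF; exact: mem_head.
have vF : visits (F := F) p r.
  move=> n; have [m nm pm] := v n; exists m => //; move: pm; rewrite !mem_cell => pm.
  by apply: sF; rewrite inE pm orbT.
have fg q : adj p q -> finitely_generated (edge_group p q) by move=> /edge_hyp[].
have und q : adj p q -> undistorted R (val : edge_group p q -> G) by move=> /edge_hyp[].
split; first by have [S' _] := vertex_group_finitely_generated fg und Fw Fo pF; exists S'; exact: genseqP.
by move=> S'; exact: (component_of_vertex edge_hyp Fw Fo pF S' xr vF).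
Qed.
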